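(* Consider the Euler equations with external force $f$, $$\partial_t u+(u\cdot\nabla)u+\nabla p=f,\qquad \nabla\cdot u=0,$$ on $\mathbb{T}$ with initial condition $u(0)=u_0\in H_3$, and let $T>0$ be a finite time of existence for the solution $u\in C([0,T];H_3)\cap C^1([0,T];H_2)$. For $\alpha,\beta>0$ let $u^{\alpha,\beta}$ be a solution to the Euler-Voigt equations with the external force $f$, $$\partial_t u^{\alpha,\beta}-\alpha^2\partial_t\Delta u^{\alpha,\beta}+(u^{\alpha,\beta}\cdot\nabla)u^{\alpha,\beta}+\nabla p^{\alpha,\beta}=f,\qquad \nabla\cdot u^{\alpha,\beta}=0,$$ on $\mathbb{T}$ with initial condition $u^{\alpha,\beta}(0)=u_0^\beta$, where (i) $u_0^\beta\in H_4$ for $\beta>0$; (ii) $\|u_0^\beta-u_0\|_{H_3}\to 0$ as $\beta\to 0$. Then, for any sequence $\{\beta_n\}$ with $\beta_n>0$ and $\beta_n\to 0$ as $n\to\infty$, there exists a sequence $\{\alpha_n\}$ with $\alpha_n>0$, converging to zero, such that $$\sup_{0<t<T}\|u^{\alpha_n,\beta_n}(t)-u(t)\|_{H_3}\to 0\qquad\text{as } n\to\infty.$$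
   Context: Space-periodic setting: $\mathbb{T}=\mathbb{R}^3/(2\pi\mathbb{Z})^3$ is the three-dimensional torus; the velocities $u,u^{\alpha,\beta}$, the pressures $p,p^{\alpha,\beta}$ and the given external force $f=f(t,x)$ are periodic in space with zero mean, and $\alpha>0$ is the regularization parameter. For $s\ge 0$, $$H_s=\Big\{w=\sum_{k\in\mathbb{Z}^3\setminus\{0\}}\widehat w_k e^{ik\cdot x}\ :\ \sum_{k\ne0}|k|^{2s}|\widehat w_k|^2<\infty,\ k\cdot\widehat w_k=0,\ \widehat w_{-k}=\overline{\widehat w_k}\Big\}$$ (with $\widehat w_k\in\mathbb{C}^3$) is the space of real, zero-mean, divergence-free periodic vector fields of Sobolev class $H^s$, with norm $\|w\|_{H_s}^2=\sum_{k\neq 0}|k|^{2s}|\widehat w_k|^2$.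
   Formalization: The class of the external force f, left open, is fixed: f is continuous in time with values in H^2 and the integral over [0,T] of its H^3 norm is finite; for f merely continuous in H_2 the claim fails. Euler-Voigt solutions are taken in C^1([0,T];H_4). *)

(* Defs.v *)
From HB Require Import structures.
From mathcomp Require Import all_boot all_order all_algebra.
From mathcomp Require Import complex.
From mathcomp Require Import all_classical all_reals all_analysis.

Set Implicit Arguments.
Unset Strict Implicit.
Unset Printing Implicit Defensive.
Import Order.TTheory GRing.Theory Num.Theory.
Import numFieldNormedType.Exports.
Local Open Scope classical_set_scope.
Local Open Scope ring_scope.
Local Open Scope complex_scope.

(* Frequencies k in Z^3 are integer row vectors.  A periodic field w with m
   components is given by its Fourier coefficients: w k 0 j is the k-th
   coefficient of the j-th component.  Its value at a point of R^3 is the sum of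
   its Fourier series, see [value]. *)
Definition pfield (R : realType) (m : nat) : Type := 'rV[int]_3 -> 'rV[R[i]]_m.

Definition freq2 (R : realType) (k : 'rV[int]_3) : R :=
  \sum_(j < 3) (k 0 j)%:~R ^+ 2.

Definition phase (R : realType) (k : 'rV[int]_3) (x : 'rV[R]_3) : R :=
  \sum_(j < 3) (k 0 j)%:~R * x 0 j.

Definition expi (R : realType) (a : R) : R[i] := cos a +i* sin a.

Definition coef_norm2 (R : realType) (m : nat) (c : 'rV[R[i]]_m) : R :=
  \sum_(j < m) (complex.Re (c 0 j) ^+ 2 + complex.Im (c 0 j) ^+ 2).

(* Sobolev norm, +oo if the series of squares diverges. *)
Definition Hnorm (R : realType) (m : nat) (s : R) (w : pfield R m) : \bar R :=
  sqrte (\esum_(k in [set k : 'rV[int]_3 | k != 0])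
           ((freq2 R k `^ s) * coef_norm2 (w k))%:E).

(* Real, zero-mean fields of class H^s, not necessarily divergence-free. *)
Definition Hdot (R : realType) (m : nat) (s : R) : set (pfield R m) :=
  [set w : pfield R m | [/\ w 0 = 0,
               (forall k j, w (- k) 0 j = (w k 0 j)^*) &
               (Hnorm s w < +oo)%E]].
Arguments Hdot {R} m s.

(* The space H_s. *)
Definition Hdiv (R : realType) (s : R) : set (pfield R 3) :=
  Hdot 3 s `&` [set w : pfield R 3 | forall k : 'rV[int]_3, \sum_(j < 3) (k 0 j)%:~R * w k 0 j = 0].

(* Sum of an absolutely convergent real series over Z^3. *)
Definition sumZ3 (R : realType) (a : 'rV[int]_3 -> R) : R :=
  fine (\esum_(k in [set: 'rV[int]_3]) (Num.max (a k) 0)%:E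
        - \esum_(k in [set: 'rV[int]_3]) (Num.max (- a k) 0)%:E)%E.

(* Value at x of the j-th component.  Under the symmetry w (- k) = (w k)^* the
   complex Fourier series has a real sum, hence equals the sum of real parts. *)
Definition value (R : realType) (m : nat) (w : pfield R m) (j : 'I_m)
    (x : 'rV[R]_3) : R :=
  sumZ3 (fun k => complex.Re (w k 0 j * expi (phase k x))).

Definition partial (R : realType) (l : 'I_3) (g : 'rV[R]_3 -> R)
    (x : 'rV[R]_3) : R :=
  'D_(delta_mx 0 l) g x.

Definition laplacian (R : realType) (g : 'rV[R]_3 -> R) (x : 'rV[R]_3) : R :=
  \sum_(l < 3) partial l (partial l g) x.

Definition divergence (R : realType) (w : pfield R 3) (x : 'rV[R]_3) : R :=
  \sum_(l < 3) partial l (value w l) x.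

(* j-th component of (w . nabla) w. *)
Definition advection (R : realType) (w : pfield R 3) (j : 'I_3)
    (x : 'rV[R]_3) : R :=
  \sum_(l < 3) value w l x * partial l (value w j) x.

Definition fsub (R : realType) (m : nat) (v w : pfield R m) : pfield R m :=
  fun k => v k - w k.

(* C([0,T]; X) for a set X of fields, with the H^s norm on X. *)
Definition C0path (R : realType) (m : nat) (T s : R) (X : set (pfield R m))
    (w : R -> pfield R m) : Prop :=
  (forall t, t \in `[0, T] -> X (w t)) /\
  (forall t, t \in `[0, T] ->
     Hnorm s (fsub (w r) (w t)) @[r --> within `[0, T] (nbhs t)] --> 0%E).

Definition diffquot (R : realType) (m : nat) (w : R -> pfield R m) (t h : R) :
    pfield R m :=
  fun k => (h^-1)%:C *: (w (t + h) k - w t k).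

(* C^1([0,T]; X), with one-sided derivatives at the endpoints. *)
Definition C1path (R : realType) (m : nat) (T s : R) (X : set (pfield R m))
    (w : R -> pfield R m) : Prop :=
  C0path T s X w /\
  exists2 dw : R -> pfield R m, C0path T s X dw &
    forall t, t \in `[0, T] ->
      Hnorm s (fsub (diffquot w t h) (dw t))
        @[h --> within [set h | t + h \in `[0, T]] 0^'] --> 0%E.

Definition euler_solution (R : realType) (T : R) (f u : R -> pfield R 3)
    (p : R -> pfield R 1) (u0 : pfield R 3) : Prop :=
  [/\ C0path T 3 (Hdiv 3) u,
      C1path T 2 (Hdiv 2) u,
      (forall t, t \in `]0, T[ -> Hdot 1 3 (p t)),
      u 0 = u0 &
      forall t x, t \in `]0, T[ ->
        divergence (u t) x = 0 /\
        forall j : 'I_3,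
          derive1 (fun r => value (u r) j x) t
          + advection (u t) j x + partial j (value (p t) 0) x
          = value (f t) j x].

Definition euler_voigt_solution (R : realType) (alpha T : R)
    (f u : R -> pfield R 3) (p : R -> pfield R 1) (u0 : pfield R 3) : Prop :=
  [/\ C1path T 4 (Hdiv 4) u,
      (forall t, t \in `]0, T[ -> Hdot 1 3 (p t)),
      u 0 = u0 &
      forall t x, t \in `]0, T[ ->
        divergence (u t) x = 0 /\
        forall j : 'I_3,
          derive1 (fun r => value (u r) j x) t
          - alpha ^+ 2 * derive1 (fun r => laplacian (value (u r) j) x) t
          + advection (u t) j x + partial j (value (p t) 0) x
          = value (f t) j x].

(* Forces in C([0,T]; H^2) with finite integral of the H^3 norm: the class in
   which H_3 solutions of the Euler equations are constructed. *)
Definition admissible_force (R : realType) (T : R) (f : R -> pfield R 3) : Prop :=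
  C0path T 2 (Hdot 3 2) f /\
  (\int[lebesgue_measure]_(t in `[0%R, T]) Hnorm 3 (f t) < +oo)%E.

(* Main.v *)
Require Import Defs.
From HB Require Import structures.
From mathcomp Require Import all_boot all_order all_algebra.
From mathcomp Require Import complex.
From mathcomp Require Import all_classical all_reals all_analysis.
From mathcomp Require Import measurable_realfun.
From mathcomp Require Import ring lra zify.
Import Order.TTheory GRing.Theory Num.Theory.
Import numFieldNormedType.Exports.
Local Open Scope classical_set_scope.
Local Open Scope ring_scope.
Set Implicit Arguments.
Unset Strict Implicit.
Unset Printing Implicit Defensive.

(** Write U for the Euler-Voigt velocity of parameter alpha and initial value
    v0 near u0, u for the Euler velocity, and z = U - u.  A direct H^3 energy
    estimate for z fails: the term (z . grad) u would need one derivative of u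
    more than H^3 provides.  The remedy is to compare U with a truncation phi u
    of the Euler velocity, phi being a cutoff at frequencies of order N, and to
    pay for the lost derivative with powers of N.

    In the energy of w = U - phi u, weighted by |k|^3 and the Voigt factor
    sqrt(1 + alpha^2 |k|^2), the difference of the advection terms splits into
    four parts ([advection_split]).  The one of top order is antisymmetric and
    disappears.  The commutator of U . grad with the weight costs C ||w||^2.
    The stretching term z . grad (phi u) costs N times the absolute sum of the
    coefficients of z; since N |z_m| <= |m| |z_m| + N^3 |m|^-2 |z_m|, it is
    controlled by ||z||_{H^3} and by N^3 ||z||_{L^2} ([stretch_bound]).  The
    commutator with phi involves only frequencies of u above N
    ([cutoff_comm_bound]).  There remain the high frequencies of f and a term of
    order alpha^2 N^3.  So while the energy E stays below rho^2,
      E' <= C E + rho (C' (Q + N^3 ||z||_{L^2}) + 128 N^3 alpha^2 D) + 2 rho h_N,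
    where D bounds the H^2 norm of the time derivative of u, Q bounds the H^3
    norm of the part of u above N, h_N is that of f, and C, C' depend only on the
    bound of u in H^3.  Gronwall's lemma then shows that E never reaches
    rho^2 if the data are small enough ([H3_stage]).

    The quantity ||z||_{L^2} is governed by an L^2 estimate that costs no
    derivative ([L2_stage]): it is at most a constant times
    ||v0 - u0||_{H^3} + alpha^2 D.  The constants can therefore be chosen in the
    order rho, then N (making Q and the time integral of h_N small), then the
    distance of v0 to u0, which makes N^3 ||z(0)|| small, and at last alpha,
    which may depend on v0; the H^4 norm of v0 enters only the initial energy,
    multiplied by alpha ([close_solutions]).  A diagonal choice of alpha_n
    concludes ([diagonal_choice]).

    All of this is done on Fourier coefficients.  The equations are given
    pointwise in physical space; products of Fourier series, differentiation
    under the sum and the uniqueness of Fourier coefficients ([fseries_eq0])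
    turn them into differential equations for the coefficients, and testing
    these with vectors orthogonal to the frequency removes the pressure
    ([euler_fourier], [voigt_fourier]). *)
Implicit Types (R : realType) (I J : choiceType).

Local Notation Z3 := 'rV[int]_3.

(** * Absolutely convergent signed sums *)

Definition summ R I (a : I -> R) : Prop :=
  (\esum_(i in [set: I]) `|a i|%:E < +oo)%E.

(** Over the lattice this is [sumZ3] by conversion.  The index type is general
    because a product of two sums lives on pairs of frequencies. *)
Definition rsum R I (a : I -> R) : R :=
  fine (\esum_(i in [set: I]) (Num.max (a i) 0)%:E
        - \esum_(i in [set: I]) (Num.max (- a i) 0)%:E)%E.

Lemma fsbig_seqE R I (p : I -> R) (s : seq I) :
  uniq s -> (\sum_(i \in [set` s]) (p i)%:E)%E = (\sum_(i <- s) p i)%:E.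
Proof. by move=> us; rewrite -fsbig_seq// sumEFin. Qed.

Lemma esum_leP R I (p : I -> R) (B : R) :
  (forall s : seq I, uniq s -> \sum_(i <- s) p i <= B) ->
  (\esum_(i in [set: I]) (p i)%:E <= B%:E)%E.
Proof.
move=> h; apply: ge_ereal_sup => _ [X [finX _] <-].
rewrite fsbig_finite//= sumEFin lee_fin; apply: h; exact: finmap.fset_uniq.
Qed.

Lemma esum_geP R I (p : I -> R) (s : seq I) :
  uniq s -> ((\sum_(i <- s) p i)%:E <= \esum_(i in [set: I]) (p i)%:E)%E.
Proof.
move=> us; apply: esum_ge; exists [set` s]; last by rewrite fsbig_seqE.
by split => //; exact: finite_seq.
Qed.

Lemma summ_bounded R I (a : I -> R) (B : R) :
  (forall s : seq I, uniq s -> \sum_(i <- s) `|a i| <= B) -> summ a.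
Proof. by move=> h; apply: le_lt_trans (ltry B); exact: esum_leP. Qed.

Lemma summ_le R I (a b : I -> R) :
  (forall i, `|a i| <= b i) -> summ b -> summ a.
Proof.
move=> ab; apply: le_lt_trans; apply: le_esum => i _.
by rewrite lee_fin (le_trans (ab i))// ler_norm.
Qed.

Lemma summ_norm R I (a : I -> R) :
  summ a -> summ (fun i => `|a i|).
Proof. by apply: le_lt_trans; apply: le_esum => i _; rewrite normr_id. Qed.

Lemma rsum_ge0E R I (a : I -> R) :
  (forall i, 0 <= a i) -> rsum a = fine (\esum_(i in [set: I]) (a i)%:E)%E.
Proof.
move=> a0; rewrite /rsum; congr fine.
rewrite (@esum1 _ _ _ (fun i => (Num.max (- a i) 0)%:E)) ?sube0; last first.
  by move=> i _; rewrite max_r// oppr_le0.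
by apply: eq_esum => i _; rewrite max_l.
Qed.

Lemma ge0_rsumE R I (a : I -> R) :
  (forall i, 0 <= a i) -> summ a ->
  (rsum a)%:E = (\esum_(i in [set: I]) (a i)%:E)%E.
Proof.
move=> a0 sa; rewrite rsum_ge0E// fineK// ge0_fin_numE; last first.
  by apply: esum_ge0 => i _; rewrite lee_fin.
apply: le_lt_trans sa; apply: le_esum => i _.
by rewrite lee_fin ler_norm.
Qed.

Lemma rsum_le_bound R I (a : I -> R) (B : R) :
  (forall i, 0 <= a i) ->
  (forall s : seq I, uniq s -> \sum_(i <- s) a i <= B) ->
  summ a /\ rsum a <= B.
Proof.
move=> a0 h.
have sa : summ a.
  apply: (@summ_bounded _ _ _ B) => s us.
  by under eq_bigr do rewrite ger0_norm//; exact: h.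
by split => //; rewrite -lee_fin ge0_rsumE//; exact: esum_leP.
Qed.

Lemma sum_le_rsum R I (a : I -> R) (s : seq I) :
  (forall i, 0 <= a i) -> summ a -> uniq s -> \sum_(i <- s) a i <= rsum a.
Proof. by move=> a0 sa us; rewrite -lee_fin ge0_rsumE//; exact: esum_geP. Qed.

Lemma le_rsum_pt R I (a : I -> R) (i : I) :
  (forall i, 0 <= a i) -> summ a -> a i <= rsum a.
Proof. by move=> a0 sa; have := @sum_le_rsum R I a [:: i] a0 sa erefl; rewrite big_seq1. Qed.

Lemma rsum_ge0 R I (a : I -> R) :
  (forall i, 0 <= a i) -> 0 <= rsum a.
Proof.
by move=> a0; rewrite rsum_ge0E// fine_ge0// esum_ge0// => i _; rewrite lee_fin.
Qed.

Lemma eq_rsum R I (a b : I -> R) :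
  a =1 b -> rsum a = rsum b.
Proof. by move=> /funext ->. Qed.

Lemma eq_summ R I (a b : I -> R) :
  a =1 b -> summ a -> summ b.
Proof. by move=> /funext ->. Qed.

Lemma summD R I (a b : I -> R) :
  summ a -> summ b -> summ (fun i => a i + b i).
Proof.
move=> sa sb; apply: le_lt_trans (lte_add_pinfty sa sb).
rewrite -esumD; [|by move=> i _; rewrite lee_fin..].
by apply: le_esum => i _; rewrite lee_fin ler_normD.
Qed.

Lemma summN R I (a : I -> R) :
  summ a -> summ (fun i => - a i).
Proof. by move=> /summ_norm; apply: summ_le => i; rewrite normrN. Qed.

Lemma summB R I (a b : I -> R) :
  summ a -> summ b -> summ (fun i => a i - b i).
Proof. by move=> sa sb; apply: summD => //; exact: summN. Qed.

Lemma summZ R I (c : R) (a : I -> R) :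
  summ a -> summ (fun i => c * a i).
Proof.
move=> /summ_norm sa; apply: (@summ_bounded _ _ _ (`|c| * rsum (fun i => `|a i|))).
move=> s us; under eq_bigr do rewrite normrM.
rewrite -mulr_sumr ler_wpM2l// sum_le_rsum//.
Qed.

Lemma summ0 R I : summ (fun _ : I => 0 : R).
Proof.
by apply: (@summ_bounded _ _ _ 0) => s _; rewrite big1// => i _; rewrite normr0.
Qed.

Lemma rsum0 R I : rsum (fun _ : I => 0 : R) = 0.
Proof. by rewrite rsum_ge0E// esum1. Qed.

(** The identity (p - q)^+ + q = p + (p - q)^- reduces additivity to that of
    sums of non-negative families. *)
Lemma rsum_diff R I (p q : I -> R) :
  (forall i, 0 <= p i) -> (forall i, 0 <= q i) -> summ p -> summ q ->
  rsum (fun i => p i - q i) = rsum p - rsum q.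
Proof.
move=> p0 q0 sp sq.
pose d i := p i - q i; pose dp i : R := Num.max (d i) 0; pose dm i : R := Num.max (- d i) 0.
have dp0 i : 0 <= dp i by rewrite le_max lexx orbT.
have dm0 i : 0 <= dm i by rewrite le_max lexx orbT.
have sd := summ_norm (summB sp sq).
have sdp : summ dp.
  apply: summ_le sd => i; rewrite ger0_norm// /dp ge_max normr_ge0 andbT.
  exact: ler_norm.
have sdm : summ dm.
  apply: summ_le sd => i; rewrite ger0_norm// /dm ge_max normr_ge0 andbT -normrN.
  exact: ler_norm.
have -> : rsum (fun i => p i - q i) = rsum dp - rsum dm.
  transitivity (fine ((rsum dp)%:E - (rsum dm)%:E)%E); last by rewrite -EFinB.
  by rewrite !ge0_rsumE.
suff : rsum dp + rsum q = rsum p + rsum dm by lra.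
suff : rsum dp + rsum q = rsum p + rsum dm by lra.
apply: EFin_inj; rewrite !EFinD !ge0_rsumE// -!esumD//;
  try by move=> i _; rewrite lee_fin.
apply: eq_esum => i _; rewrite -!EFinD /dp /dm /d; congr EFin.
have [h|h] := boolP (0 <= p i - q i); first by rewrite (max_l h) max_r; lra.
by rewrite -ltNge in h; rewrite (max_r (ltW h)) max_l; lra.
Qed.

(** The choice |a| + a and |a|, rather than the positive and negative parts,
    keeps the two families linear in a and |a|. *)
Lemma pos_neg_parts R I (a : I -> R) : summ a ->
  exists p q : I -> R, [/\ (forall i, 0 <= p i), (forall i, 0 <= q i),
    summ p, summ q & a = fun i => p i - q i].
Proof.
move=> sa; exists (fun i => `|a i| + a i), (fun i => `|a i|).
have sn := summ_norm sa; split => //.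
- by move=> i; have := ler_norm (- a i); rewrite normrN; lra.
- exact: summD.
- by apply/funext => i; lra.
Qed.

Lemma rsumD R I (a b : I -> R) :
  summ a -> summ b -> rsum (fun i => a i + b i) = rsum a + rsum b.
Proof.
move=> /pos_neg_parts[p [q [p0 q0 sp sq ->]]] /pos_neg_parts[p' [q' [p'0 q'0 sp' sq' ->]]].
have padd (x y : I -> R) : (forall i, 0 <= x i) -> (forall i, 0 <= y i) ->
    summ x -> summ y -> rsum (fun i => x i + y i) = rsum x + rsum y.
  move=> x0 y0 sx sy; apply: EFin_inj; rewrite EFinD !ge0_rsumE//.
  - by rewrite -esumD// => i _; rewrite lee_fin.
  - by move=> i; exact: addr_ge0.
  - exact: summD.
rewrite (@eq_rsum _ _ _ (fun i => (p i + p' i) - (q i + q' i))); last by move=> i; ring.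
rewrite !rsum_diff//; [|by move=> i; exact: addr_ge0..|exact: summD|exact: summD].
by rewrite !padd//; ring.
Qed.

Lemma rsumN R I (a : I -> R) :
  summ a -> rsum (fun i => - a i) = - rsum a.
Proof.
move=> sa; have := rsumD sa (summN sa).
by rewrite (@eq_rsum _ _ _ (fun=> 0)) ?rsum0; [lra|move=> i; lra].
Qed.

Lemma rsumB R I (a b : I -> R) :
  summ a -> summ b -> rsum (fun i => a i - b i) = rsum a - rsum b.
Proof. by move=> sa sb; rewrite rsumD ?rsumN//; exact: summN. Qed.

Lemma ler_rsum R I (a b : I -> R) :
  summ a -> summ b -> (forall i, a i <= b i) -> rsum a <= rsum b.
Proof.
move=> sa sb ab; rewrite -subr_ge0 -rsumB//; apply: rsum_ge0 => i.
by rewrite subr_ge0.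
Qed.

Lemma rsumZ R I (c : R) (a : I -> R) :
  summ a -> rsum (fun i => c * a i) = c * rsum a.
Proof.
have pZle (d : R) (p : I -> R) : 0 <= d -> (forall i, 0 <= p i) -> summ p ->
    rsum (fun i => d * p i) <= d * rsum p.
  move=> d0 p0 sp; apply: (@rsum_le_bound _ _ _ _ _ _).2 => [i|s us].
    exact: mulr_ge0.
  by rewrite -mulr_sumr ler_wpM2l// sum_le_rsum.
have pZ (d : R) (p : I -> R) : 0 <= d -> (forall i, 0 <= p i) -> summ p ->
    rsum (fun i => d * p i) = d * rsum p.
  move=> d0 p0 sp; apply/eqP; rewrite eq_le pZle//=.
  have [->|dn0] := eqVneq d 0; first by rewrite mul0r rsum_ge0// => i; rewrite mul0r.
  have dgt : 0 < d by rewrite lt_neqAle eq_sym dn0.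
  have := @pZle d^-1 (fun i => d * p i); rewrite invr_ge0 => /(_ d0).
  rewrite (@eq_rsum _ _ (fun i => d^-1 * (d * p i)) p); last by move=> i; rewrite mulKf.
  move=> /(_ (fun i => mulr_ge0 d0 (p0 i)) (summZ _ sp)) h.
  by rewrite -(ler_pM2l (_ : 0 < d^-1)) ?invr_gt0// mulKf.
have aZ (d : R) (p : I -> R) : 0 <= d -> summ p -> rsum (fun i => d * p i) = d * rsum p.
  move=> d0 /pos_neg_parts[p' [q' [p0 q0 sp sq ->]]].
  rewrite (@eq_rsum _ _ _ (fun i => d * p' i - d * q' i)); last by move=> i; ring.
  rewrite [in RHS]rsum_diff// [LHS]rsum_diff; try exact: summZ; try by move=> i; exact: mulr_ge0.
  by rewrite !pZ//; ring.
move=> sa; have [c0|c0] := leP 0 c; first exact: aZ.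
rewrite (@eq_rsum _ _ _ (fun i => - ((- c) * a i))); last by move=> i; ring.
rewrite rsumN; last exact: summZ.
by rewrite aZ//; [ring|lra].
Qed.

Lemma ler_norm_rsum R I (a b : I -> R) :
  summ b -> (forall i, `|a i| <= b i) -> `|rsum a| <= rsum b.
Proof.
move=> sb ab; have sa := summ_le ab sb.
rewrite ler_norml -rsumN//; apply/andP; split; apply: ler_rsum => //; try exact: summN.
  by move=> i; have /ler_normlP[] := ab i; lra.
by move=> i; have /ler_normlP[] := ab i.
Qed.

Lemma summ_sum R I (J : Type) (r : seq J) (P : pred J)
    (a : J -> I -> R) :
  (forall j, summ (a j)) -> summ (fun i => \sum_(j <- r | P j) a j i).
Proof.
move=> h; elim: r => [|j r IH].
  by apply: eq_summ (summ0 R I) => i; rewrite big_nil.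
case Pj : (P j); last by apply: eq_summ IH => i; rewrite big_cons Pj.
by apply: eq_summ (summD (h j) IH) => i; rewrite big_cons Pj.
Qed.

Lemma rsum_sum R I (J : Type) (r : seq J) (P : pred J)
    (a : J -> I -> R) :
  (forall j, summ (a j)) ->
  rsum (fun i => \sum_(j <- r | P j) a j i) = \sum_(j <- r | P j) rsum (a j).
Proof.
move=> h; elim: r => [|j r IH].
  by rewrite big_nil -[RHS](rsum0 R I); apply: eq_rsum => i; rewrite big_nil.
rewrite big_cons; case Pj : (P j); last first.
  by rewrite -IH; apply: eq_rsum => i; rewrite big_cons Pj.
rewrite -IH -rsumD//; last exact: summ_sum.
by apply: eq_rsum => i; rewrite big_cons Pj.
Qed.

Lemma summ_reindex R I J (e : I -> J) (a : J -> R) :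
  bijective e -> summ a -> summ (fun i => a (e i)).
Proof.
move=> be; rewrite /summ (@reindex_esum _ _ _ [set: I] [set: J] e)//.
by rewrite setTT_bijective.
Qed.

Lemma rsum_reindex R I J (e : I -> J) (a : J -> R) :
  bijective e -> rsum (fun i => a (e i)) = rsum a.
Proof.
move=> be; rewrite /rsum; congr (fine (_ - _)%E);
  by rewrite [in RHS](@reindex_esum _ _ _ [set: I] [set: J] e)// setTT_bijective.
Qed.

(** Tonelli's theorem, by summing the rows in the extended reals. *)
Lemma summ_pair R I J (a : I * J -> R) :
  (forall p, 0 <= a p) -> (forall i, summ (fun j => a (i, j))) ->
  summ (fun i => rsum (fun j => a (i, j))) ->
  summ a /\ rsum a = rsum (fun i => rsum (fun j => a (i, j))).
Proof.
move=> a0 si s.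
have E : (\esum_(p in [set: I * J]) (a p)%:E = (rsum (fun i => rsum (fun j => a (i, j))))%:E)%E.
  rewrite ge0_rsumE//; last by move=> i; exact: rsum_ge0.
  transitivity (\esum_(i in [set: I]) \esum_(j in [set: J]) (a (i, j))%:E)%E.
    rewrite (@esum_esum _ _ _ [set: I] (fun=> setT) (fun i j => (a (i, j))%:E)).
      by congr esum; [apply/seteqP; split|apply/funext => -[]].
    by move=> i j _ _; rewrite lee_fin.
  by apply: eq_esum => i _; rewrite ge0_rsumE.
have sa : summ a.
  rewrite /summ (@eq_esum _ _ _ _ (EFin \o a)) ?E ?ltry// => p _.
  by rewrite ger0_norm.
by split => //; apply: EFin_inj; rewrite -E ge0_rsumE.
Qed.

Lemma summ_pair_row R I J (a : I * J -> R) :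
  summ a -> (forall i, summ (fun j => a (i, j))) /\
    summ (fun i => rsum (fun j => `|a (i, j)|)).
Proof.
move=> /summ_norm sa.
have row (s : seq J) i : uniq s -> \sum_(j <- s) `|a (i, j)| <= rsum (fun p => `|a p|).
  move=> us; rewrite -(big_map (pair i) xpredT (fun p => `|a p|)).
  by apply: sum_le_rsum => //; rewrite map_inj_uniq// => x y [].
have si i : summ (fun j => a (i, j)).
  by apply: summ_bounded => s us; exact: (row s i us).
split => //.
suff : (\esum_(i in [set: I]) (rsum (fun j => `|a (i, j)|))%:E < +oo)%E.
  by apply: le_lt_trans; apply: le_esum => i _; rewrite ger0_norm// rsum_ge0.
rewrite (@eq_esum _ _ _ _ (fun i => \esum_(j in [set: J]) `|a (i, j)|%:E)%E); last first.
  by move=> i _; rewrite ge0_rsumE//; exact: summ_norm.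
rewrite (@esum_esum _ _ _ [set: I] (fun=> setT) (fun i j => `|a (i, j)|%:E)).
  apply: le_lt_trans sa; rewrite le_eqVlt; apply/orP; left; apply/eqP.
  by congr esum; [apply/seteqP; split|apply/funext => -[i j]; rewrite normr_id].
by move=> i j _ _; rewrite lee_fin.
Qed.

(** Fubini's theorem, from Tonelli's applied to two non-negative families. *)
Lemma rsum_pair R I J (a : I * J -> R) :
  summ a -> summ (fun i => rsum (fun j => a (i, j))) /\
  rsum a = rsum (fun i => rsum (fun j => a (i, j))).
Proof.
move=> sa; have [si sn] := summ_pair_row sa.
split.
  by apply: summ_le sn => i; apply: ler_norm_rsum => //; exact/summ_norm/si.
have [p [q [p0 q0 sp sq ->]]] := pos_neg_parts sa.
have [spi spn] := summ_pair_row sp; have [sqi sqn] := summ_pair_row sq.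
have rp : summ (fun i => rsum (fun j => p (i, j))).
  apply: summ_le spn => i; rewrite ger0_norm ?rsum_ge0//.
  by apply: ler_rsum => //; [exact/summ_norm|move=> j; exact: ler_norm].
have rq : summ (fun i => rsum (fun j => q (i, j))).
  apply: summ_le sqn => i; rewrite ger0_norm ?rsum_ge0//.
  by apply: ler_rsum => //; [exact/summ_norm|move=> j; exact: ler_norm].
rewrite rsum_diff// (summ_pair p0 spi rp).2 (summ_pair q0 sqi rq).2 -rsumB//.
by apply: eq_rsum => i; rewrite rsum_diff.
Qed.

Lemma rsum_prod R I J (a : I -> R) (b : J -> R) :
  summ a -> summ b ->
  summ (fun p : I * J => a p.1 * b p.2) /\
  rsum (fun p : I * J => a p.1 * b p.2) = rsum a * rsum b.
Proof.
move=> sa sb; have na := summ_norm sa; have nb := summ_norm sb.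
have s : summ (fun p : I * J => a p.1 * b p.2).
  apply: (@summ_le _ _ _ (fun p => `|a p.1| * `|b p.2|)).
    by move=> p; rewrite normrM.
  apply: (proj1 (@summ_pair _ _ _ (fun p => `|a p.1| * `|b p.2|) _ _ _)).
  - by move=> p; exact: mulr_ge0.
  - by move=> i /=; exact: summZ.
  - apply: eq_summ (summZ (rsum (fun j => `|b j|)) na) => i /=.
    by rewrite rsumZ// mulrC.
split => //; rewrite (rsum_pair s).2 -(mulrC (rsum b)) -rsumZ//.
by apply: eq_rsum => i /=; rewrite rsumZ// mulrC.
Qed.

(** A finite set whose partial sum is within e of the supremum leaves at most e
    for the rest. *)
Lemma summ_tail R I (b : I -> R) (e : R) :
  (forall i, 0 <= b i) -> summ b -> 0 < e ->
  exists2 s : seq I, uniq s & rsum (fun i => if i \in s then 0 else b i) <= e.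
Proof.
move=> b0 sb e0.
have [s us hs] : exists2 s : seq I, uniq s & rsum b - e <= \sum_(i <- s) b i.
  apply: contrapT => h.
  have : rsum b <= rsum b - e.
    apply: (proj2 (rsum_le_bound b0 _)) => s us.
    by rewrite leNgt; apply/negP => hs; apply: h; exists s => //; exact: ltW.
  by lra.
exists s => //.
have t0 i : 0 <= (if i \in s then 0 else b i) by case: ifP.
apply: (proj2 (rsum_le_bound t0 _)) => r ur.
rewrite (eq_bigr (fun i => if i \notin s then b i else 0)); last by move=> i _; case: (i \in s).
rewrite -big_mkcond/= -big_filter.
have u2 : uniq (s ++ [seq i <- r | i \notin s]).
  rewrite cat_uniq us filter_uniq// andbT; apply/hasPn => i.
  by rewrite mem_filter => /andP[].
have := sum_le_rsum b0 sb u2; rewrite big_cat/=; lra.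
Qed.

(** Dominated convergence, along an arbitrary proper filter: outside a finite
    set the dominating family leaves a small remainder, and on that set the
    convergence is uniform. *)
Lemma rsum_cvg R I (T : Type) (F : set_system T)
    (FF : ProperFilter F) (a : T -> I -> R) (l b : I -> R) :
  (\forall t \near F, forall i, `|a t i| <= b i) -> summ b ->
  (forall i, a t i @[t --> F] --> l i) ->
  summ l /\ rsum (a t) @[t --> F] --> rsum l.
Proof.
move=> ab sb al.
have b0 i : 0 <= b i.
  by have [t h] := filter_ex ab; exact: le_trans (h i).
have lb i : `|l i| <= b i.
  have h1 : `|a t i| @[t --> F] --> `|l i| by apply: cvg_norm; exact: al.
  rewrite -(cvg_lim _ h1)//; apply: limr_le; first by apply/cvg_ex; exists `|l i|.
  by near=> t; have : forall i, `|a t i| <= b i by near: t.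
have sl := summ_le lb sb; split => //.
apply/cvgrPdist_le => e e0.
have e4 : 0 < e / 4 by rewrite divr_gt0.
have [s us hs] := summ_tail b0 sb e4.
pose bt i := if i \in s then 0 else b i.
have bt0 i : 0 <= bt i by rewrite /bt; case: ifP.
have sbt : summ bt by apply: summ_le sb => i; rewrite /bt; case: ifP => _; rewrite ?normr0// ger0_norm.
have near_s : \forall t \near F, forall i, i \in s -> `|l i - a t i| <= e / 2 / (size s).+1%:R.
  have : 0 < e / 2 / (size s).+1%:R by rewrite !divr_gt0.
  move: (_ / _) => d d0; elim: (s) => [|j r IH]; first by apply: nearW.
  have /cvgrPdist_le/(_ _ d0) hj := al j.
  near=> t => i; rewrite inE => /orP[/eqP ->|ir].
    by near: t; exact: hj.
  by move: i ir; near: t; exact: IH.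
near=> t.
have hat : forall i, `|a t i| <= b i by near: t.
have hst : forall i, i \in s -> `|l i - a t i| <= e / 2 / (size s).+1%:R by near: t.
have sat := summ_le hat sb.
rewrite -rsumB//.
pose fs i := if i \in s then `|l i - a t i| else 0.
have fs0 i : 0 <= fs i by rewrite /fs; case: ifP.
have [sfs rfs] : summ fs /\ rsum fs <= e / 2.
  apply: rsum_le_bound => // r ur.
  rewrite /fs -big_mkcond/= -big_filter.
  pose d : R := e / 2 / (size s).+1%:R.
  apply: (@le_trans _ _ (\sum_(i <- [seq i <- r | i \in s]) d)).
    rewrite big_seq [leRHS]big_seq; apply: ler_sum => i.
    by rewrite mem_filter => /andP[+ _]; exact: hst.
  have d0 : 0 <= d by rewrite !divr_ge0// ltW.
  have -> : e / 2 = d *+ (size s).+1 by rewrite -[RHS]mulr_natr /d divfK.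
  rewrite big_const_seq count_predT iter_addr_0; apply: ler_wpMn2l => //.
  apply: leqW; apply: uniq_leq_size; first by rewrite filter_uniq.
  by move=> i; rewrite mem_filter => /andP[].
apply: (@le_trans _ _ (rsum (fun i => fs i + 2 * bt i))).
  apply: ler_norm_rsum; first by apply: summD => //; exact: summZ.
  move=> i; rewrite /fs /bt; case: ifP => _; first by lra.
  by rewrite add0r (le_trans (ler_normB _ _))// mulr_natl mulr2n lerD.
rewrite rsumD//; last exact: summZ.
rewrite rsumZ//; have hs' : rsum bt <= e / 4 := hs.
by lra.
Unshelve. all: by end_near. Qed.

(** * Square-summable families and discrete convolution estimates *)

(** The source of every Cauchy-Schwarz inequality below. *)
Lemma discriminant_le R (A B X : R) : 0 <= A ->
  (forall t, 0 <= t ^+ 2 * A - 2 * t * X + B) -> X ^+ 2 <= A * B.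
Proof.
move=> A0 h; have [A1|A1] := eqVneq A 0.
  have [->|X0] := eqVneq X 0; first by rewrite A1 mul0r expr0n.
  have := h ((B + 1) / (2 * X)); rewrite A1 mulr0 add0r.
  have -> : 2 * ((B + 1) / (2 * X)) * X = B + 1 by field.
  by lra.
have := h (X / A).
have -> : (X / A) ^+ 2 * A - 2 * (X / A) * X + B = (A * B - X ^+ 2) / A by field.
have Agt : 0 < A by rewrite lt_neqAle eq_sym A1.
by rewrite pmulr_lge0 ?invr_gt0// subr_ge0.
Qed.

Definition l2norm R I (a : I -> R) : R :=
  Num.sqrt (rsum (fun i => a i ^+ 2)).

Definition l2 R I (a : I -> R) : Prop :=
  summ (fun i => a i ^+ 2).

Lemma l2norm_ge0 R I (a : I -> R) : 0 <= l2norm a.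
Proof. exact: sqrtr_ge0. Qed.

Lemma sqr_l2norm R I (a : I -> R) :
  l2norm a ^+ 2 = rsum (fun i => a i ^+ 2).
Proof. by rewrite sqr_sqrtr// rsum_ge0// => i; exact: sqr_ge0. Qed.

Lemma l2_le R I (a b : I -> R) :
  (forall i, `|a i| <= `|b i|) -> l2 b -> l2 a /\ l2norm a <= l2norm b.
Proof.
move=> ab sb.
have ab2 i : a i ^+ 2 <= b i ^+ 2.
  by rewrite -real_normK ?num_real// -[leRHS]real_normK ?num_real// ler_pXn2r ?nnegrE.
have sa : l2 a.
  by apply: summ_le sb => i; rewrite ger0_norm ?sqr_ge0.
by split => //; rewrite ler_sqrt ?rsum_ge0//; [exact: ler_rsum|move=> i; exact: sqr_ge0].
Qed.

Lemma l2Z R I (c : R) (a : I -> R) :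
  l2 a -> l2 (fun i => c * a i) /\ l2norm (fun i => c * a i) = `|c| * l2norm a.
Proof.
move=> sa; have E : (fun i => (c * a i) ^+ 2) = (fun i => c ^+ 2 * a i ^+ 2).
  by apply/funext => i; rewrite exprMn.
split; first by rewrite /l2 E; exact: summZ.
by rewrite /l2norm E rsumZ// sqrtrM ?sqr_ge0// sqrtr_sqr.
Qed.

(** Bounding the sum of absolute values is what the applications need, and
    gives summability of the products at the same time. *)
Lemma cauchy_schwarz R I (a b : I -> R) :
  l2 a -> l2 b ->
  summ (fun i => a i * b i) /\ rsum (fun i => `|a i * b i|) <= l2norm a * l2norm b.
Proof.
move=> sa sb.
have s : summ (fun i => a i * b i).
  apply: summ_le (summD sa sb) => i; rewrite ler_norml; apply/andP.
  have := sqr_ge0 (a i + b i); have := sqr_ge0 (a i - b i).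
  have := sqr_ge0 (a i); have := sqr_ge0 (b i).
  by move=> *; split; nra.
have sn := summ_norm s; split => //.
rewrite -(@ler_pXn2r _ 2)// ?nnegrE ?mulr_ge0 ?l2norm_ge0 ?rsum_ge0//.
rewrite exprMn !sqr_l2norm; apply: discriminant_le.
  by apply: rsum_ge0 => i; exact: sqr_ge0.
move=> t.
have -> : t ^+ 2 * rsum (fun i => a i ^+ 2) - 2 * t * rsum (fun i => `|a i * b i|)
   + rsum (fun i => b i ^+ 2) = rsum (fun i => (t * `|a i| - `|b i|) ^+ 2).
  rewrite -!rsumZ// -rsumB; [|exact: summZ..].
  rewrite -rsumD//; last by apply: summB; exact: summZ.
  apply: eq_rsum => i; rewrite normrM.
  by rewrite -[a i ^+ 2]real_normK ?num_real// -[b i ^+ 2]real_normK ?num_real//; ring.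
by apply: rsum_ge0 => i; exact: sqr_ge0.
Qed.

Lemma shift_bij (G : zmodType) (l : G) : bijective (fun k : G => k - l).
Proof. by exists (fun k => k + l) => k; rewrite ?subrK ?addrK. Qed.

(** Young's inequality in the dual form that pairs the convolution of an l^2
    family and an l^1 family with an l^2 family. *)
Lemma conv_l2l2l1 R (G : zmodType) (a x y : G -> R) :
  (forall k, 0 <= a k) -> (forall k, 0 <= x k) -> (forall k, 0 <= y k) ->
  l2 a -> l2 x -> summ y ->
  summ (fun p : G * G => a p.1 * x (p.1 - p.2) * y p.2) /\
  rsum (fun p : G * G => a p.1 * x (p.1 - p.2) * y p.2)
    <= l2norm a * l2norm x * rsum y.
Proof.
move=> a0 x0 y0 sa sx sy.
pose c (p : G * G) := a p.2 * x (p.2 - p.1) * y p.1.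
have xl l : l2 (fun k => x (k - l)) /\ l2norm (fun k => x (k - l)) = l2norm x.
  split; first exact: (@summ_reindex _ _ _ _ (fun k => x k ^+ 2) (shift_bij l)).
  by rewrite /l2norm (@rsum_reindex _ _ _ _ (fun k => x k ^+ 2) (shift_bij l)).
have row l : summ (fun k => a k * x (k - l)) /\
    rsum (fun k => a k * x (k - l)) <= l2norm a * l2norm x.
  have [s le] := cauchy_schwarz sa (xl l).1; split => //.
  rewrite (xl l).2 in le; apply: le_trans le; apply: ler_rsum => //.
    exact: summ_norm.
  by move=> k; exact: ler_norm.
have rowE l : rsum (fun k => c (l, k)) = y l * rsum (fun k => a k * x (k - l)).
  rewrite -rsumZ; last exact: (row l).1.
  by apply: eq_rsum => k; rewrite /c/= mulrC.
have bnd l : `|rsum (fun k => c (l, k))| <= (l2norm a * l2norm x) * y l.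
  rewrite rowE ger0_norm; last first.
    by apply: mulr_ge0 => //; apply: rsum_ge0 => k; exact: mulr_ge0.
  by rewrite mulrC ler_wpM2r// (row l).2.
have sZ : summ (fun l => l2norm a * l2norm x * y l) by exact: summZ.
have srow : summ (fun l => rsum (fun k => c (l, k))) by exact: summ_le bnd sZ.
have [sc rc] : summ c /\ rsum c = rsum (fun l => rsum (fun k => c (l, k))).
  apply: summ_pair => //; first by move=> p; rewrite /c !mulr_ge0.
  by move=> l; apply: eq_summ (summZ (y l) (row l).1) => k; rewrite /c/= mulrC.
have bsw : bijective (fun p : G * G => (p.2, p.1)) by exists (fun p => (p.2, p.1)) => -[].
split; first exact: (summ_reindex bsw sc).
rewrite (@rsum_reindex _ _ _ _ c bsw) rc -rsumZ//.
by apply: ler_rsum => // l; apply: le_trans (bnd l); exact: ler_norm.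
Qed.

(** The substitution (k, l) -> (k, k - l) exchanges the two convolved factors. *)
Lemma conv_l2l1l2 R (G : zmodType) (a x y : G -> R) :
  (forall k, 0 <= a k) -> (forall k, 0 <= x k) -> (forall k, 0 <= y k) ->
  l2 a -> summ x -> l2 y ->
  summ (fun p : G * G => a p.1 * x (p.1 - p.2) * y p.2) /\
  rsum (fun p : G * G => a p.1 * x (p.1 - p.2) * y p.2)
    <= l2norm a * rsum x * l2norm y.
Proof.
move=> a0 x0 y0 sa sx sy.
have [s le] := conv_l2l2l1 a0 y0 x0 sa sy sx.
pose c (p : G * G) := a p.1 * y (p.1 - p.2) * x p.2.
pose e (p : G * G) : G * G := (p.1, p.1 - p.2).
have b : bijective e by exists e => -[k l]; rewrite /e /= subKr.
have E : (fun p : G * G => a p.1 * x (p.1 - p.2) * y p.2) =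
         (fun p => c (e p)).
  by apply/funext => -[k l]; rewrite /c /e /= subKr mulrAC.
by rewrite E (rsum_reindex _ b) mulrAC; split => //; exact: summ_reindex b s.
Qed.

(** The series of (n + 1)^(-4/3), the one-dimensional factor in the bound of the
    lattice sum, is written with the cube root so that it telescopes. *)
Definition cbrt_succ R (n : nat) : R := n.+1%:R `^ 3^-1.

Lemma cbrt_succ_gt0 R n : 0 < cbrt_succ R n.
Proof. by apply: powR_gt0; rewrite ltr0n. Qed.

Lemma cbrt_succ3 R n : cbrt_succ R n ^+ 3 = n.+1%:R.
Proof.
by rewrite /cbrt_succ -powR_mulrn ?powR_ge0// -powRrM mulVf// powRr1.
Qed.

(** Let a <= b be the cube roots of two successive integers.  From b^3 - a^3 = 1
    it follows that 1 <= 3 b^2 (b - a), and dividing by a b^3 bounds b^-4 by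
    3 (1/a - 1/b). *)
Lemma cbrt_succ_telescope R n :
  cbrt_succ R n.+1 ^- 4 <= 3 * ((cbrt_succ R n)^-1 - (cbrt_succ R n.+1)^-1).
Proof.
have a0 := cbrt_succ_gt0 R n; have b0 := cbrt_succ_gt0 R n.+1.
have : cbrt_succ R n.+1 ^+ 3 = cbrt_succ R n ^+ 3 + 1 by rewrite !cbrt_succ3 -natr1.
move: (cbrt_succ R n) (cbrt_succ R n.+1) a0 b0 => a b a0 b0 e.
have ab : a <= b.
  by rewrite -(@ler_pXn2r _ 3)// ?nnegrE ?ltW// e; lra.
have -> : 3 * (a^-1 - b^-1) = 3 * (b - a) / (a * b) by field; rewrite !gt_eqF.
have key : (b - a) * (a ^+ 2 + a * b + b ^+ 2) = 1.
  by rewrite -[RHS](addKr (a ^+ 3)) -e; ring.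
have h : 1 <= 3 * b ^+ 2 * (b - a).
  rewrite -key mulrC ler_wpM2r ?subr_ge0//.
  have : a * a <= a * b by rewrite ler_wpM2l// ltW.
  have : a * b <= b * b by rewrite ler_wpM2r// ltW.
  by move=> h1 h2; nra.
rewrite -[leLHS]mul1r ler_pdivrMr ?exprn_gt0// mulrAC ler_pdivlMr ?mulr_gt0// mul1r.
(* The factor b - a is eliminated with 1 <= 3 b^2 (b - a). *)
apply: (@le_trans _ _ (b * b)); first by rewrite ler_wpM2r// ltW.
have -> : 3 * (b - a) * b ^+ 4 = 3 * b ^+ 2 * (b - a) * (b * b) by ring.
by rewrite -[leLHS]mul1r ler_wpM2r// mulr_ge0// ltW.
Qed.

Lemma summ_cbrt R : summ (fun n => cbrt_succ R n ^- 4).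
Proof.
have part M : \sum_(i < M) cbrt_succ R i ^- 4 <= 4.
  case: M => [|M]; first by rewrite big_ord0.
  have c0 : cbrt_succ R 0 = 1 by rewrite /cbrt_succ powR1.
  suff : \sum_(i < M.+1) cbrt_succ R i ^- 4 <= 1 + 3 * (1 - (cbrt_succ R M)^-1).
    have : 0 <= (cbrt_succ R M)^-1 by rewrite invr_ge0 ltW// cbrt_succ_gt0.
    by lra.
  elim: M => [|M IH]; first by rewrite big_ord_recr big_ord0/= c0 expr1n invr1; lra.
  rewrite big_ord_recr/=; have := cbrt_succ_telescope R M; lra.
apply: (@summ_bounded _ _ _ 4) => s us.
have [M hM] : exists M, forall i, i \in s -> (i < M)%N.
  exists (\max_(i <- s) i).+1 => i si; rewrite ltnS.
  by rewrite (big_rem i)//= leq_maxl.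
apply: le_trans (part M).
under eq_bigr do rewrite ger0_norm ?invr_ge0 ?exprn_ge0 ?ltW ?cbrt_succ_gt0//.
rewrite -(big_mkord xpredT (fun i => cbrt_succ R i ^- 4)) /index_iota subn0.
rewrite [leRHS](bigID (mem s))/=.
rewrite -[in leRHS]big_filter (perm_big [seq i <- iota 0 M | i \in s])/=.
  by rewrite lerDl sumr_ge0// => i _; rewrite invr_ge0 exprn_ge0// ltW// cbrt_succ_gt0.
apply: uniq_perm => //; first by rewrite filter_uniq// iota_uniq.
move=> i; rewrite mem_filter mem_iota add0n leq0n/=.
by case si : (i \in s) => //=; rewrite hM.
Qed.

(** * The lattice of frequencies and a Sobolev embedding *)

Definition freq R (k : Z3) : R := Num.sqrt (freq2 R k).

Lemma freq2_ge0 R k : 0 <= freq2 R k.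
Proof. by apply: sumr_ge0 => j _; rewrite sqr_ge0. Qed.

Lemma freq_ge0 R k : 0 <= freq R k.
Proof. exact: sqrtr_ge0. Qed.

Lemma sqr_freq R k : freq R k ^+ 2 = freq2 R k.
Proof. by rewrite sqr_sqrtr// freq2_ge0. Qed.

Lemma freq2_0 R : freq2 R 0 = 0.
Proof. by rewrite /freq2 big1// => j _; rewrite mxE mulr0z expr0n. Qed.

Lemma freq0 R : freq R 0 = 0.
Proof. by rewrite /freq freq2_0 sqrtr0. Qed.

Lemma comp_le_freq2 R (k : Z3) (j : 'I_3) :
  (k 0 j)%:~R ^+ 2 <= freq2 R k.
Proof.
rewrite /freq2 (bigD1 j)//= lerDl sumr_ge0// => i _; exact: sqr_ge0.
Qed.

Lemma freq2_ge1 R k : k != 0 -> 1 <= freq2 R k.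
Proof.
move=> k0; have [j kj] : exists j, k 0 j != 0.
  apply: contrapT => h; move/eqP: k0; apply; apply/rowP => j; rewrite mxE.
  by apply/eqP; apply: contrapT => /negP kj; apply: h; exists j.
apply: le_trans (comp_le_freq2 R k j).
rewrite -rmorphXn -[1]/(1%:~R) ler_int.
have : (k 0 j) ^+ 2 != 0 by rewrite expf_eq0.
by rewrite -gtz0_ge1 lt_def => ->; exact: sqr_ge0.
Qed.

Lemma freq_ge1 R k : k != 0 -> 1 <= freq R k.
Proof. by move=> /(freq2_ge1 R) h; rewrite -(sqrtr1 R) ler_sqrt// freq2_ge0. Qed.

Lemma freqN R k : freq R (- k) = freq R k.
Proof.
by rewrite /freq /freq2; congr Num.sqrt; apply: eq_bigr => j _; rewrite mxE mulrNz sqrrN.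
Qed.

Lemma comp_le_freq R (k : Z3) (j : 'I_3) :
  `|(k 0 j)%:~R| <= freq R k.
Proof.
by rewrite -(@ler_pXn2r _ 2)// ?nnegrE ?freq_ge0// real_normK ?num_real// sqr_freq comp_le_freq2.
Qed.

Lemma cauchy_schwarz_fin R (n : nat) (x y : 'I_n -> R) :
  (\sum_j x j * y j) ^+ 2 <= (\sum_j x j ^+ 2) * (\sum_j y j ^+ 2).
Proof.
apply: discriminant_le; first by apply: sumr_ge0 => j _; exact: sqr_ge0.
move=> t; rewrite !mulr_sumr -sumrB -big_split/=; apply: sumr_ge0 => j _.
have -> : t ^+ 2 * x j ^+ 2 - 2 * t * (x j * y j) + y j ^+ 2 = (t * x j - y j) ^+ 2 by ring.
exact: sqr_ge0.
Qed.

Lemma freq_triangle R (k l : Z3) :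
  freq R (k + l) <= freq R k + freq R l.
Proof.
rewrite -(@ler_pXn2r _ 2)// ?nnegrE ?addr_ge0 ?freq_ge0// sqr_freq sqrrD !sqr_freq.
have E : freq2 R (k + l) = freq2 R k + 2 * (\sum_(j < 3) (k 0 j)%:~R * (l 0 j)%:~R) + freq2 R l.
  rewrite /freq2 mulr_sumr -!big_split/=; apply: eq_bigr => j _.
  by rewrite mxE intrD; ring.
rewrite E lerD2r lerD2l -[leRHS]mulr_natl ler_wpM2l//.
apply: (le_trans (ler_norm _)).
rewrite -(@ler_pXn2r _ 2)// ?nnegrE ?mulr_ge0 ?freq_ge0// real_normK ?num_real//.
by rewrite exprMn !sqr_freq cauchy_schwarz_fin.
Qed.

Lemma freq_le_add R (k l : Z3) :
  freq R k <= freq R (k - l) + freq R l.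
Proof. by rewrite -{1}[k](subrK l) freq_triangle. Qed.

Lemma freq_subC R (k l : Z3) : freq R (k - l) = freq R (l - k).
Proof. by rewrite -freqN opprB. Qed.

Definition cbrt_int R (i : int) : R := cbrt_succ R `|i|%N ^- 4.

Lemma cbrt_int_ge0 R i : 0 <= cbrt_int R i.
Proof. by rewrite invr_ge0 exprn_ge0// ltW// cbrt_succ_gt0. Qed.

Lemma summ_cbrt_int R : summ (cbrt_int R).
Proof.
pose d n := cbrt_succ R n ^- 4.
have d0 n : 0 <= d n by rewrite invr_ge0 exprn_ge0// ltW// cbrt_succ_gt0.
have half (s : seq int) : uniq s -> {in s &, injective absz} ->
    \sum_(i <- s) cbrt_int R i <= rsum d.
  move=> us inj; rewrite -(big_map absz xpredT d).
  by apply: sum_le_rsum => //; [exact: summ_cbrt|rewrite map_inj_in_uniq].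
apply: (@summ_bounded _ _ _ (rsum d + rsum d)) => s us.
under eq_bigr do rewrite ger0_norm ?cbrt_int_ge0//.
rewrite (bigID (fun i : int => 0 <= i))/= -!(big_filter s).
apply: lerD; apply: half; rewrite ?filter_uniq// => x y; rewrite !mem_filter => /andP[? _] /andP[? _]; lia.
Qed.

Definition row3 (p : int * (int * int)) : Z3 :=
  \row_(j < 3) nth 0 [:: p.1; p.2.1; p.2.2] j.

Lemma row3_bij : bijective row3.
Proof.
exists (fun k : Z3 => (k 0 0, (k 0 1, k 0 2%:R))).
  by move=> [a [b c]]; rewrite /row3 !mxE.
move=> k; apply/rowP => j; rewrite /row3 mxE /=.
case: j => -[|[|[|//]]] h /=; congr (k 0 _); exact: val_inj.
Qed.

(** The lattice sum of |k|^-4 over Z^3: by (1 + |k_j|)^2 <= 4 |k|^2, each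
    term is at most 16 times the product of the three (1 + |k_j|)^(-4/3). *)
Lemma summ_lattice R : summ (fun k => (freq2 R k)^-1 ^+ 2).
Proof.
have [b1 _] := rsum_prod (summ_cbrt_int R) (summ_cbrt_int R).
have [b2 _] := rsum_prod (summ_cbrt_int R) b1.
have [e eK Ke] := row3_bij.
have be : bijective e by exists row3.
suff bnd (k : Z3) : (freq2 R k)^-1 ^+ 2 <=
    16 * (cbrt_int R (e k).1 * (cbrt_int R (e k).2.1 * cbrt_int R (e k).2.2)).
  apply: summ_le (summZ 16 (summ_reindex be b2)) => k.
  by rewrite ger0_norm ?exprn_ge0 ?invr_ge0 ?freq2_ge0//.
have [->|k0] := eqVneq k 0.
  by rewrite freq2_0 invr0 expr0n/= !mulr_ge0// cbrt_int_ge0.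
have hk (j : 'I_3) (i : int) : k 0 j = i -> (cbrt_succ R `|i|%N ^+ 3) ^+ 2 <= 4 * freq2 R k.
  move=> <-; rewrite cbrt_succ3.
  have h1 := freq2_ge1 R k0; have h2 := comp_le_freq2 R k j.
  have -> : ((absz (k 0 j)).+1%:R : R) = `|(k 0 j)%:~R| + 1.
    by rewrite -natr1 natr_absz intr_norm.
  rewrite -real_normK ?num_real// in h2.
  have := sqr_ge0 (`|(k 0 j)%:~R| - 1 : R).
  by rewrite sqrrB1 sqrrD1; lra.
have comp (j : 'I_3) : k 0 j = nth 0 [:: (e k).1; (e k).2.1; (e k).2.2] j.
  by rewrite -{1}(Ke k) /row3 mxE.
have h0 := hk 0 _ (comp 0); have h1 := hk 1 _ (comp 1); have h2 := hk 2%:R _ (comp 2%:R).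
move: h0 h1 h2; rewrite /= /cbrt_int; case: (e k) => i0 [i1 i2] /= h0 h1 h2.
move: (cbrt_succ_gt0 R `|i0|) (cbrt_succ_gt0 R `|i1|) (cbrt_succ_gt0 R `|i2|).
move: (cbrt_succ R `|i0|) (cbrt_succ R `|i1|) (cbrt_succ R `|i2|) h0 h1 h2 => a b c h0 h1 h2 a0 b0 c0.
have q0 : 0 < freq2 R k by apply: lt_le_trans (freq2_ge1 R k0).
move: (freq2 R k) q0 h0 h1 h2 => q q0 h0 h1 h2.
have abc0 : 0 < (a * b * c) ^+ 4 by rewrite exprn_gt0// !mulr_gt0.
have -> : 16 * (a ^- 4 * (b ^- 4 * c ^- 4)) = 16 / (a * b * c) ^+ 4.
  by field; rewrite !gt_eqF.
rewrite exprVn ler_pdivlMr// mulrC ler_pdivrMr ?exprn_gt0//.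
have -> : 16 * q ^+ 2 = (4 * q) ^+ 2 by ring.
have q40 : 0 <= 4 * q by rewrite mulr_ge0// ltW.
have q1 := ltW q0; have a1 := ltW a0; have b1' := ltW b0; have c1 := ltW c0.
rewrite -(@ler_pXn2r _ 3)// ?nnegrE ?exprn_ge0 ?mulr_ge0//.
have -> : ((a * b * c) ^+ 4) ^+ 3 = ((a ^+ 3) ^+ 2 * (b ^+ 3) ^+ 2 * (c ^+ 3) ^+ 2) ^+ 2 by ring.
have -> : ((4 * q) ^+ 2) ^+ 3 = ((4 * q) * (4 * q) * (4 * q)) ^+ 2 by ring.
rewrite ler_pXn2r ?nnegrE ?mulr_ge0 ?exprn_ge0//.
by apply: ler_pM; rewrite ?mulr_ge0 ?exprn_ge0 //; apply: ler_pM; rewrite ?exprn_ge0.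
Qed.

(** The Cauchy-Schwarz constant of the embedding of H^2; its finiteness is the
    convergence of the lattice sum. *)
Definition sob R : R := l2norm (fun k => (freq2 R k)^-1).

(** Since |k|^-2 is square-summable over Z^3, H^2 controls the absolute sum of
    the coefficients. *)
Lemma l1_embedding R (x : Z3 -> R) :
  (forall k, 0 <= x k) -> x 0 = 0 -> l2 (fun k => freq2 R k * x k) ->
  summ x /\ rsum x <= sob R * l2norm (fun k => freq2 R k * x k).
Proof.
move=> x0 xz sx; have [s le] := cauchy_schwarz (@summ_lattice R) sx.
have E : (fun k => (freq2 R k)^-1 * (freq2 R k * x k)) = x.
  apply/funext => k; have [->|k0] := eqVneq k 0; first by rewrite xz !mulr0.
  by rewrite mulKf// gt_eqF// (lt_le_trans ltr01)// freq2_ge1.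
have sx' := s; rewrite E in sx'; split => //.
apply: le_trans le; apply: ler_rsum => //; first exact: summ_norm.
move=> k; apply: le_trans (ler_norm _); rewrite le_eqVlt; apply/orP; left.
by apply/eqP; rewrite -[in LHS]E.
Qed.

(** * Complex coefficients and real Fourier series *)

Local Open Scope complex_scope.
Local Notation Re := complex.Re.
Local Notation Im := complex.Im.

Lemma Re_add R (x y : R[i]) : Re (x + y) = Re x + Re y.
Proof. by case: x; case: y. Qed.
Lemma Im_add R (x y : R[i]) : Im (x + y) = Im x + Im y.
Proof. by case: x; case: y. Qed.
Lemma Re_opp R (x : R[i]) : Re (- x) = - Re x.
Proof. by case: x. Qed.
Lemma Im_opp R (x : R[i]) : Im (- x) = - Im x.
Proof. by case: x. Qed.
Lemma Re_mul R (x y : R[i]) : Re (x * y) = Re x * Re y - Im x * Im y.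
Proof. by case: x; case: y. Qed.
Lemma Im_mul R (x y : R[i]) : Im (x * y) = Re x * Im y + Im x * Re y.
Proof. by case: x => a b; case: y. Qed.
Lemma Re_conjc R (x : R[i]) : Re (x^*) = Re x.
Proof. by case: x. Qed.
Lemma Im_conjc R (x : R[i]) : Im (x^*) = - Im x.
Proof. by case: x. Qed.

Lemma complex_intr R (n : int) : (n%:~R : R[i]) = (n%:~R)%:C.
Proof. by rewrite rmorph_int. Qed.

Lemma Re_sum R (J : Type) (r : seq J) (P : pred J) (F : J -> R[i]) :
  Re (\sum_(j <- r | P j) F j) = \sum_(j <- r | P j) Re (F j).
Proof. by elim/big_rec2: _ => [|j x y _ <-]; rewrite ?Re_add. Qed.

Lemma Im_sum R (J : Type) (r : seq J) (P : pred J) (F : J -> R[i]) :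
  Im (\sum_(j <- r | P j) F j) = \sum_(j <- r | P j) Im (F j).
Proof. by elim/big_rec2: _ => [|j x y _ <-]; rewrite ?Im_add. Qed.

Lemma complexP R (x y : R[i]) : Re x = Re y -> Im x = Im y -> x = y.
Proof. by case: x => a b; case: y => c d /= -> ->. Qed.

Definition cmod R (z : R[i]) : R := Num.sqrt (Re z ^+ 2 + Im z ^+ 2).

Lemma cmod_ge0 R (z : R[i]) : 0 <= cmod z.
Proof. exact: sqrtr_ge0. Qed.

Lemma sqr_cmod R (z : R[i]) : cmod z ^+ 2 = Re z ^+ 2 + Im z ^+ 2.
Proof. by rewrite sqr_sqrtr// addr_ge0// sqr_ge0. Qed.

Lemma cmodM R (x y : R[i]) : cmod (x * y) = cmod x * cmod y.
Proof. by rewrite /cmod; case: x => a b; case: y => c d; have := Normc.normcM (Complex a b) (Complex c d). Qed.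

Lemma Re_le_cmod R (z : R[i]) : `|Re z| <= cmod z.
Proof.
rewrite -(@ler_pXn2r _ 2)// ?nnegrE ?cmod_ge0// real_normK ?num_real// sqr_cmod.
by rewrite lerDl sqr_ge0.
Qed.

Lemma Im_le_cmod R (z : R[i]) : `|Im z| <= cmod z.
Proof.
rewrite -(@ler_pXn2r _ 2)// ?nnegrE ?cmod_ge0// real_normK ?num_real// sqr_cmod.
by rewrite lerDr sqr_ge0.
Qed.

Lemma cmod_le R (z : R[i]) : cmod z <= `|Re z| + `|Im z|.
Proof.
rewrite -(@ler_pXn2r _ 2)// ?nnegrE ?cmod_ge0 ?addr_ge0// sqr_cmod sqrrD.
rewrite !real_normK ?num_real//; have := mulr_ge0 (normr_ge0 (Re z)) (normr_ge0 (Im z)).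
by rewrite mulr2n; lra.
Qed.

(** The constant 2 is not sharp; only summability is drawn from it. *)
Lemma cmodD R (x y : R[i]) : cmod (x + y) <= 2 * (cmod x + cmod y).
Proof.
apply: le_trans (cmod_le _) _; rewrite Re_add Im_add.
have := ler_normD (Re x) (Re y); have := ler_normD (Im x) (Im y).
have := Re_le_cmod x; have := Im_le_cmod x; have := Re_le_cmod y; have := Im_le_cmod y.
by lra.
Qed.

Lemma cmodN R (x : R[i]) : cmod (- x) = cmod x.
Proof. by rewrite /cmod Re_opp Im_opp !sqrrN. Qed.

Lemma cmod_real R (a : R) : cmod (a%:C) = `|a|.
Proof. by rewrite /cmod /= expr0n addr0 sqrtr_sqr. Qed.

Lemma cmod_i R : cmod ('i%C : R[i]) = 1.
Proof. by rewrite /cmod /= expr0n expr1n add0r sqrtr1. Qed.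

Lemma cmod_expi R (a : R) : cmod (expi a) = 1.
Proof. by rewrite /cmod /= cos2Dsin2 sqrtr1. Qed.

Lemma expiD R (a b : R) : expi (a + b) = expi a * expi b.
Proof. by apply: complexP; rewrite ?Re_mul ?Im_mul /= ?cosD ?sinD// addrC. Qed.

Lemma expi0 R : expi (0 : R) = 1.
Proof. by rewrite /expi cos0 sin0. Qed.

Lemma expiN R (a : R) : expi (- a) = (expi a)^*.
Proof. by rewrite /expi cosN sinN. Qed.

Definition summC R I (c : I -> R[i]) : Prop :=
  summ (fun k => cmod (c k)).

Lemma summC_Re R I (c : I -> R[i]) :
  summC c -> summ (fun k => Re (c k)).
Proof. by apply: summ_le => k; exact: Re_le_cmod. Qed.

Lemma summC_Im R I (c : I -> R[i]) :
  summC c -> summ (fun k => Im (c k)).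
Proof. by apply: summ_le => k; exact: Im_le_cmod. Qed.

Lemma summC_le R I (c : I -> R[i]) (b : I -> R) :
  (forall k, cmod (c k) <= b k) -> summ b -> summC c.
Proof. by move=> h; apply: summ_le => k; rewrite ger0_norm ?cmod_ge0. Qed.

Lemma summCD R I (c d : I -> R[i]) :
  summC c -> summC d -> summC (fun k => c k + d k).
Proof.
move=> sc sd; apply: (@summC_le _ _ _ (fun k => 2 * (cmod (c k) + cmod (d k)))).
  by move=> k; exact: cmodD.
by apply: summZ; exact: summD.
Qed.

Lemma summCN R I (c : I -> R[i]) :
  summC c -> summC (fun k => - c k).
Proof. by apply: summC_le => k; rewrite cmodN. Qed.

Definition csum R I (c : I -> R[i]) : R[i] :=
  rsum (fun k => Re (c k)) +i* rsum (fun k => Im (c k)).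

(** The j-th component of a field has this value, by conversion, when c is the
    family of its j-th coefficients. *)
Definition fseries R (c : Z3 -> R[i]) (x : 'rV[R]_3) : R :=
  rsum (fun k => Re (c k * expi (phase k x))).

Lemma summ_fseries R (c : Z3 -> R[i]) (x : 'rV[R]_3) :
  summC c -> summ (fun k => Re (c k * expi (phase k x))).
Proof. by apply: summ_le => k; apply: le_trans (Re_le_cmod _) _; rewrite cmodM cmod_expi mulr1. Qed.

Lemma fseriesD R (c d : Z3 -> R[i]) (x : 'rV[R]_3) :
  summC c -> summC d -> fseries (fun k => c k + d k) x = fseries c x + fseries d x.
Proof.
move=> sc sd; rewrite -rsumD; [|exact: summ_fseries..].
by apply: eq_rsum => k; rewrite mulrDl Re_add.
Qed.

Lemma fseriesN R (c : Z3 -> R[i]) (x : 'rV[R]_3) :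
  summC c -> fseries (fun k => - c k) x = - fseries c x.
Proof.
move=> sc; rewrite -rsumN; last exact: summ_fseries.
by apply: eq_rsum => k; rewrite mulNr Re_opp.
Qed.

Lemma fseriesZ R (a : R) (c : Z3 -> R[i]) (x : 'rV[R]_3) :
  summC c -> fseries (fun k => a%:C * c k) x = a * fseries c x.
Proof.
move=> sc; rewrite -rsumZ; last exact: summ_fseries.
by apply: eq_rsum => k; rewrite -mulrA Re_mul mul0r subr0.
Qed.

Lemma fseries_le R (c : Z3 -> R[i]) (x : 'rV[R]_3) :
  summC c -> `|fseries c x| <= rsum (fun k => cmod (c k)).
Proof.
move=> sc; apply: ler_norm_rsum => // k.
by apply: le_trans (Re_le_cmod _) _; rewrite cmodM cmod_expi mulr1.
Qed.

Lemma norm_sin_le R (x : R) : `|sin x| <= `|x|.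
Proof.
wlog x0 : x / 0 <= x.
  move=> h; have [|x0] := leP 0 x; first exact: h.
  by rewrite -[`|sin x|]normrN -sinN -[`|x|]normrN h// oppr_ge0 ltW.
have [->|xn0] := eqVneq x 0; first by rewrite sin0.
have xgt : 0 < x by rewrite lt_neqAle eq_sym xn0.
have [c _] := @MVT R sin cos 0 x xgt (fun y _ => is_derive_sin y)
  (continuous_subspaceT (@continuous_sin R)).
rewrite sin0 !subr0 => ->; rewrite normrM ler_piMl//; exact: cos_max.
Qed.

Lemma norm_cosB1_le R (x : R) : `|cos x - 1| <= `|x|.
Proof.
wlog x0 : x / 0 <= x.
  move=> h; have [|x0] := leP 0 x; first exact: h.
  by rewrite -cosN -[`|x|]normrN h// oppr_ge0 ltW.
have [->|xn0] := eqVneq x 0; first by rewrite cos0 subrr.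
have xgt : 0 < x by rewrite lt_neqAle eq_sym xn0.
have [c _] := @MVT R cos (fun x => - sin x) 0 x xgt (fun y _ => is_derive_cos y)
  (continuous_subspaceT (@continuous_cos R)).
rewrite cos0 !subr0 => ->; rewrite normrM normrN ler_piMl//; exact: sin_max.
Qed.

(** The difference quotients of cos and sin are bounded by |n|, so the family
    |n| (|A| + |B|) dominates those of the series. *)
Lemma trig_series_derive R I (A B n : I -> R) :
  summ A -> summ B -> summ (fun k => `|n k| * (`|A k| + `|B k|)) ->
  h^-1 *: (rsum (fun k => A k * cos (h * n k) - B k * sin (h * n k)) - rsum A)
    @[h --> (0 : R)^'] --> rsum (fun k => - B k * n k).
Proof.
move=> sA sB sn.
pose q (h : R) k := h^-1 * (A k * (cos (h * n k) - 1) - B k * sin (h * n k)).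
have sq h : summ (fun k => A k * cos (h * n k) - B k * sin (h * n k)).
  apply: summB; [apply: summ_le (summ_norm sA)|apply: summ_le (summ_norm sB)] => k;
    by rewrite normrM ler_piMr// ?cos_max ?sin_max.
have E h : h^-1 *: (rsum (fun k => A k * cos (h * n k) - B k * sin (h * n k)) - rsum A)
    = rsum (q h).
  rewrite -rsumB// [LHS]/GRing.scale/= -rsumZ; last exact: summB.
  by apply: eq_rsum => k; rewrite /q; ring.
under eq_fun do rewrite E.
apply: (proj2 (rsum_cvg _ _ sn _)).
  near=> h => k; have h0 : h != 0 by near: h; exact: nbhs_dnbhs_neq.
  rewrite /q normrM normfV ler_pdivrMl ?normr_gt0//.
  apply: le_trans (ler_normB _ _) _; rewrite !normrM.
  have -> : `|h| * (`|n k| * (`|A k| + `|B k|)) = `|A k| * `|h * n k| + `|B k| * `|h * n k|.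
    by rewrite normrM; ring.
  by apply: lerD; rewrite ler_wpM2l//; [exact: norm_cosB1_le|exact: norm_sin_le].
move=> k.
have D : is_derive (0 : R) 1 (fun h : R => A k * cos (h * n k) - B k * sin (h * n k))
    (- B k * n k).
  have dl : is_derive (0 : R) 1 (fun h : R => h * n k) (n k).
    have -> : (fun h : R => h * n k) = n k \*: id.
      by apply/funext => h; rewrite /GRing.scale/= mulrC.
    by apply: is_derive_eq; rewrite /GRing.scale/= mulr1.
  have dc := @is_derive1_comp R cos (fun h : R => h * n k) 0 _ _ (is_derive_cos _) dl.
  have ds := @is_derive1_comp R sin (fun h : R => h * n k) 0 _ _ (is_derive_sin _) dl.
  have := is_deriveB (is_deriveZ (A k) dc) (is_deriveZ (B k) ds).
  rewrite mul0r sin0 cos0 oppr0 => H; apply: is_derive_eq H _.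
  by rewrite /GRing.scale/=; ring.
have [dv de] := D.
have := dv; rewrite /derivable -/(derive _ _ _) => /cvg_ex[l hl].
have le : l = - B k * n k by rewrite -de; apply/esym/cvg_lim.
rewrite -le; apply: cvg_trans hl; apply: near_eq_cvg; near=> h.
rewrite /q /GRing.scale/= mulr1 addr0 mul0r cos0 sin0; ring.
Unshelve. all: by end_near. Qed.

(** * Derivatives and products of Fourier series *)

Lemma phaseD R (k l : Z3) (x : 'rV[R]_3) :
  phase (k + l) x = phase k x + phase l x.
Proof.
by rewrite /phase -big_split/=; apply: eq_bigr => j _; rewrite mxE intrD mulrDl.
Qed.

Lemma phaseN R (k : Z3) (x : 'rV[R]_3) :
  phase (- k) x = - phase k x.
Proof.
by rewrite /phase -sumrN; apply: eq_bigr => j _; rewrite mxE mulrNz mulNr.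
Qed.

Lemma phase0 R (x : 'rV[R]_3) : phase 0 x = 0.
Proof. by rewrite /phase big1// => j _; rewrite mxE mulr0z mul0r. Qed.

Lemma phase_shift R (k : Z3) (l : 'I_3) (h : R) (x : 'rV[R]_3) :
  phase k (h *: delta_mx 0 l + x) = phase k x + h * (k 0 l)%:~R.
Proof.
rewrite /phase (bigD1 l)//= [X in _ = X + _](bigD1 l)//= !mxE !eqxx /= mulr1.
rewrite [X in _ + X = _](eq_bigr (fun j => (k 0 j)%:~R * x 0 j)); first by ring.
by move=> j jl; rewrite !mxE (negbTE jl) andbF mulr0 add0r.
Qed.

(** The coefficients of the derivative of a Fourier series in direction l. *)
Definition dcoef R (l : 'I_3) (c : Z3 -> R[i]) :
    Z3 -> R[i] :=
  fun k => 'i%C * (((k 0 l)%:~R)%:C * c k).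

Lemma cmod_dcoef R l (c : Z3 -> R[i]) k :
  cmod (dcoef l c k) <= freq R k * cmod (c k).
Proof.
by rewrite /dcoef !cmodM cmod_i mul1r cmod_real ler_wpM2r ?cmod_ge0// comp_le_freq.
Qed.

Lemma partial_fseries R (c : Z3 -> R[i]) (l : 'I_3) (x : 'rV[R]_3) :
  summC c -> summ (fun k => freq R k * cmod (c k)) ->
  partial l (fseries c) x = fseries (dcoef l c) x.
Proof.
move=> sc sd; pose d k := c k * expi (phase k x).
have sA : summ (fun k => Re (d k)) by exact: summ_fseries.
have dc k : cmod (d k) = cmod (c k) by rewrite cmodM cmod_expi mulr1.
have sB : summ (fun k => Im (d k)).
  by apply: summ_le sc => k; rewrite -dc Im_le_cmod.
have sn : summ (fun k : Z3 => `|(k 0 l)%:~R| * (`|Re (d k)| + `|Im (d k)|) : R).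
  apply: summ_le (summZ 2 sd) => k; rewrite normrM ger0_norm// ger0_norm ?addr_ge0//.
  rewrite mulrCA ler_pM ?addr_ge0//; first exact: comp_le_freq.
  by have := Re_le_cmod (d k); have := Im_le_cmod (d k); rewrite dc; lra.
have E h : fseries c (h *: delta_mx 0 l + x) =
    rsum (fun k => Re (d k) * cos (h * (k 0 l)%:~R) - Im (d k) * sin (h * (k 0 l)%:~R)).
  by apply: eq_rsum => k; rewrite phase_shift expiD (mulrA (c k)) -/(d k) Re_mul.
have := trig_series_derive sA sB sn.
rewrite /partial /derive => H; apply: cvg_lim => //.
have -> : fseries (dcoef l c) x = rsum (fun k => - Im (d k) * (k 0 l)%:~R).
  apply: eq_rsum => k; rewrite /dcoef -!mulrA -/(d k) Re_mul /= mul0r sub0r mul1r.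
  by rewrite Im_mul /= mul0r addr0 mulrC mulNr.
apply: cvg_trans H; apply: near_eq_cvg; near=> h.
by rewrite /= E.
Unshelve. all: by end_near. Qed.

Lemma laplacian_fseries R (c : Z3 -> R[i]) (x : 'rV[R]_3) :
  summC c -> summ (fun k => freq R k * cmod (c k)) ->
  summ (fun k => freq2 R k * cmod (c k)) ->
  laplacian (fseries c) x = - fseries (fun k => (freq2 R k)%:C * c k) x.
Proof.
move=> sc sd s2.
have sdc l : summC (dcoef l c) by apply: summC_le sd => k; exact: cmod_dcoef.
have s2c l : summ (fun k => freq R k * cmod (dcoef l c k)).
  apply: summ_le s2 => k; rewrite ger0_norm ?mulr_ge0 ?freq_ge0 ?cmod_ge0//.
  by rewrite -sqr_freq expr2 -mulrA ler_wpM2l ?freq_ge0// cmod_dcoef.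
have sdd l : summC (dcoef l (dcoef l c)).
  by apply: summC_le (s2c l) => k; exact: cmod_dcoef.
have s2' : summC (fun k => (freq2 R k)%:C * c k).
  by apply: summC_le s2 => k; rewrite cmodM cmod_real ger0_norm// freq2_ge0.
rewrite -fseriesN// /laplacian.
transitivity (\sum_(l < 3) fseries (dcoef l (dcoef l c)) x).
  apply: eq_bigr => l _; rewrite -partial_fseries//; congr (partial l _ x).
  by apply/funext => y; rewrite partial_fseries.
rewrite /fseries -rsum_sum; last by move=> l; exact: summ_fseries.
apply: eq_rsum => k; rewrite -Re_sum -mulr_suml; congr (Re (_ * _)).
rewrite -mulNr /freq2 rmorph_sum/= -sumrN mulr_suml; apply: eq_bigr => l _.
rewrite /dcoef; set n : R := (k 0 l)%:~R.
have -> : 'i%C * (n%:C * ('i%C * (n%:C * c k))) = ('i%C * 'i%C) * (n%:C * n%:C) * c k by ring.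
congr (_ * _); rewrite -rmorphM/=; apply: complexP; rewrite ?Re_mul ?Im_mul ?Re_opp ?Im_opp /=; ring.
Qed.

(** The symmetry of the coefficients of a real-valued function. *)
Definition real_coef R (c : Z3 -> R[i]) : Prop :=
  forall k, c (- k) = (c k)^*.

Lemma oppr_bij (G : zmodType) : bijective (fun k : G => - k).
Proof. by exists (fun k => - k) => k; rewrite opprK. Qed.

Lemma rsum_odd R (G : zmodType) (a : G -> R) :
  summ a -> (forall k, a (- k) = - a k) -> rsum a = 0.
Proof.
move=> sa h; have := rsum_reindex a (oppr_bij G).
by rewrite (@eq_rsum _ _ _ (fun k => - a k))// rsumN//; lra.
Qed.

Lemma real_coef_phase R (c : Z3 -> R[i]) (x : 'rV[R]_3) :
  real_coef c -> real_coef (fun k => c k * expi (phase k x)).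
Proof. by move=> h k; rewrite h phaseN expiN rmorphM. Qed.

(** The imaginary part of the k-th term is odd in k. *)
Lemma real_coef_imag R (c : Z3 -> R[i]) (x : 'rV[R]_3) :
  summC c -> real_coef c -> rsum (fun k => Im (c k * expi (phase k x))) = 0.
Proof.
move=> sc /(real_coef_phase x) h; apply: rsum_odd.
  by apply: summ_le sc => k; apply: le_trans (Im_le_cmod _) _; rewrite cmodM cmod_expi mulr1.
by move=> k; rewrite h Im_conjc.
Qed.

Definition fconv R (a b : Z3 -> R[i]) : Z3 -> R[i] :=
  fun k => csum (fun l => a (k - l) * b l).

Lemma summC_fconv_pair R (a b : Z3 -> R[i]) :
  summC a -> summC b ->
  summC (fun p : Z3 * Z3 => a (p.1 - p.2) * b p.2).
Proof.
move=> sa sb; have [s _] := rsum_prod sa sb.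
pose e (p : Z3 * Z3) : Z3 * Z3 := (p.1 - p.2, p.2).
have be : bijective e.
  by exists (fun p => (p.1 + p.2, p.2)) => -[k l]; rewrite /e /= ?subrK ?addrK.
by apply: eq_summ (summ_reindex be s) => p; rewrite /= cmodM.
Qed.

Lemma summC_fconv_row R (a b : Z3 -> R[i]) k :
  summC a -> summC b -> summC (fun l => a (k - l) * b l).
Proof. by move=> sa sb; have [+ _] := summ_pair_row (summC_fconv_pair sa sb); apply. Qed.

Lemma summC_fconv R (a b : Z3 -> R[i]) :
  summC a -> summC b -> summC (fconv a b).
Proof.
move=> sa sb; have s := summC_fconv_pair sa sb; have [srow ssum] := summ_pair_row s.
apply: summC_le (summZ 2 ssum) => k; apply: le_trans (cmod_le _) _ => /=.
have s1 := srow k.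
have h1 : `|rsum (fun l => Re (a (k - l) * b l))| <= rsum (fun l => `|cmod (a (k - l) * b l)|).
  apply: ler_norm_rsum; first exact: summ_norm.
  by move=> l; rewrite [leRHS]ger0_norm ?cmod_ge0//; exact: Re_le_cmod.
have h2 : `|rsum (fun l => Im (a (k - l) * b l))| <= rsum (fun l => `|cmod (a (k - l) * b l)|).
  apply: ler_norm_rsum; first exact: summ_norm.
  by move=> l; rewrite [leRHS]ger0_norm ?cmod_ge0//; exact: Im_le_cmod.
by move: h1 h2; lra.
Qed.

Lemma real_coef_fconv R (a b : Z3 -> R[i]) :
  real_coef a -> real_coef b -> summC a -> summC b -> real_coef (fconv a b).
Proof.
move=> ha hb sa sb k; rewrite /fconv /csum.
have b0 := @oppr_bij Z3.
apply: complexP => /=.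
  rewrite -(rsum_reindex _ b0); apply: eq_rsum => l.
  by rewrite -opprD ha hb -rmorphM Re_conjc.
rewrite -rsumN; last exact: summC_Im (summC_fconv_row k sa sb).
rewrite -(rsum_reindex _ b0); apply: eq_rsum => l.
by rewrite -opprD ha hb -rmorphM Im_conjc.
Qed.

(** A product of real-valued Fourier series has the convolution of the
    coefficients: both imaginary parts vanish, so the product of the real parts
    is the real part of the product. *)
Lemma fseries_mul R (a b : Z3 -> R[i]) (x : 'rV[R]_3) :
  real_coef a -> real_coef b -> summC a -> summC b ->
  fseries a x * fseries b x = fseries (fconv a b) x.
Proof.
move=> ha hb sa sb.
pose A k := a k * expi (phase k x); pose B k := b k * expi (phase k x).
have sA : summC A by apply: summC_le sa => k; rewrite cmodM cmod_expi mulr1.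
have sB : summC B by apply: summC_le sb => k; rewrite cmodM cmod_expi mulr1.
have [s1 p1] := rsum_prod (summC_Re sA) (summC_Re sB).
have [s2 p2] := rsum_prod (summC_Im sA) (summC_Im sB).
have iA : rsum (fun k => Im (A k)) = 0 by exact: real_coef_imag.
rewrite iA mul0r in p2.
have -> : fseries a x * fseries b x = rsum (fun p : Z3 * Z3 => Re (A p.1 * B p.2)).
  rewrite (_ : fseries a x * fseries b x = rsum (fun k => Re (A k)) * rsum (fun k => Re (B k)))//.
  (* The product of the imaginary parts is subtracted although it is zero. *)
  rewrite -p1 -[LHS]subr0 -p2 -rsumB//; apply: eq_rsum => p.
  by rewrite Re_mul.
pose e (p : Z3 * Z3) : Z3 * Z3 := (p.1 - p.2, p.2).
have be : bijective e.
  by exists (fun p => (p.1 + p.2, p.2)) => -[k l]; rewrite /e /= ?subrK ?addrK.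
rewrite -(rsum_reindex _ be).
have E p : Re (A (e p).1 * B (e p).2) = Re (a (p.1 - p.2) * b p.2 * expi (phase p.1 x)).
  congr Re; rewrite /A /B /e /=.
  have -> : expi (phase p.1 x) = expi (phase (p.1 - p.2) x) * expi (phase p.2 x).
    by rewrite -expiD -phaseD subrK.
  by ring.
rewrite (eq_rsum E) (proj2 (rsum_pair _)); last first.
  have s := summC_fconv_pair sa sb.
  by apply: summ_le s => p; apply: le_trans (Re_le_cmod _) _; rewrite cmodM cmod_expi mulr1.
apply: eq_rsum => k; rewrite /=.
have sr := summC_fconv_row k sa sb.
rewrite [in RHS]mulrC [X in _ - X]mulrC -!rsumZ; [|exact: summC_Im|exact: summC_Re].
rewrite -rsumB; [|exact/summZ/summC_Re|exact/summZ/summC_Im].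
by apply: eq_rsum => l; rewrite [LHS]Re_mul /= mulrC [X in _ - X]mulrC.
Qed.

(** * Uniqueness of Fourier coefficients *)

Lemma rsum_single R I (m : I) (v : R) :
  rsum (fun k => if k == m then v else 0) = v.
Proof.
pose d k : R := if k == m then 1 else 0.
have d0 k : 0 <= d k by rewrite /d; case: ifP.
have [sd rd] : summ d /\ rsum d <= 1.
  apply: rsum_le_bound => // s us; rewrite /d -big_mkcond/= -big_filter.
  have -> : [seq k <- s | k == m] = if m \in s then [:: m] else [::].
    elim: s us => //= a s IH /andP[ans us]; rewrite IH// inE [m == a]eq_sym.
    by have [<-|] := eqVneq a m => //=; rewrite (negbTE ans).
  by case: ifP => _; rewrite ?big_seq1 ?big_nil.
have {rd} rd : rsum d = 1.
  apply/eqP; rewrite eq_le rd/=; apply: le_trans (le_rsum_pt m d0 sd).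
  by rewrite /d eqxx.
rewrite -[RHS]mulr1 -rd -rsumZ//; apply: eq_rsum => k; rewrite /d.
by case: ifP; rewrite ?mulr1 ?mulr0.
Qed.

Lemma expi_natmul R (a : R) (n : nat) : expi (n%:R * a) = expi a ^+ n.
Proof.
elim: n => [|n IH]; first by rewrite mul0r expi0 expr0.
by rewrite exprS -IH -natr1 mulrDl mul1r addrC expiD.
Qed.

Lemma expi_2pi_int R (n : int) : expi (n%:~R * (pi *+ 2)) = 1 :> R[i].
Proof.
have h (p : nat) : expi (p%:R * (pi *+ 2)) = 1 :> R[i].
  by rewrite expi_natmul /expi cos2pi sin2pi expr1n.
case: n => p; first exact: h.
rewrite NegzE mulrNz mulNr expiN h; exact: rmorph1.
Qed.

Lemma expi_neq1 R (a : R) : 0 < `|a| < pi *+ 2 -> expi a != 1.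
Proof.
move=> /andP[a0 a1]; apply/eqP => h.
have c1 : cos a = 1 by have := congr1 (@complex.Re R) h.
have : cos (`|a| / 2 *+ 2) = 1 by rewrite -mulr_natr divfK// cos_norm.
rewrite cos_mulr2n cos2sin2 => e.
have s0 : 0 < sin (`|a| / 2).
  apply: sin_gt0_pi; rewrite divr_gt0//= ltr_pdivrMr//.
  by rewrite mulr_natr.
have := mulr_gt0 s0 s0; move: e; rewrite -expr2 mulr2n; lra.
Qed.

(** The sum of the P-th roots of unity, each raised to a power that P does not
    divide. *)
Lemma expi_geometric_sum R (P : nat) (M : int) :
  (0 < `|M| < P)%N ->
  \sum_(n < P) expi (n%:R * (M%:~R * (pi *+ 2) / P%:R)) = 0 :> R[i].
Proof.
move=> /andP[M0 MP]; have P0 : (P%:R : R) != 0 by rewrite pnatr_eq0; lia.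
set a := _ / _ : R; under eq_bigr do rewrite expi_natmul.
have a1 : expi a != 1.
  apply: expi_neq1; have pg : 0 < pi *+ 2 :> R by rewrite pmulrn_lgt0// pi_gt0.
  have Pg : 0 < P%:R :> R by rewrite ltr0n; lia.
  rewrite /a !normrM normfV (gtr0_norm pg) (gtr0_norm Pg) -intr_norm -natr_absz.
  apply/andP; split; first by apply: divr_gt0 => //; apply: mulr_gt0 => //; rewrite ltr0n.
  by rewrite ltr_pdivrMr// mulrC ltr_pM2l// ltr_nat.
apply/eqP; have a2 : expi a - 1 != 0 by rewrite subr_eq0.
rewrite -(mulrI_eq0 _ (mulfI a2)).
rewrite -subrX1 -expi_natmul /a mulrC divfK//.
by rewrite expi_2pi_int subrr.
Qed.

(** Along the points 2 pi n (1, Q, Q^2) / Q^3 the phase of k is n times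
    2 pi / Q^3 times the number with base-Q digits k.  This samples the torus
    with a single index, so that one geometric sum replaces an average over
    three variables. *)
Definition digits (Q : nat) (k : Z3) : int :=
  k 0 0 + Q%:Z * k 0 1 + Q%:Z * Q%:Z * k 0 2%:R.

Definition sample R (Q n : nat) : 'rV[R]_3 :=
  \row_(j < 3) (n%:R * ((Q ^ j)%N%:R * (pi *+ 2) / (Q ^ 3)%N%:R)).

Lemma phase_sample R (Q n : nat) (k : Z3) :
  phase k (sample R Q n) = n%:R * ((digits Q k)%:~R * (pi *+ 2) / (Q ^ 3)%N%:R).
Proof.
rewrite /phase !big_ord_recl big_ord0 /sample !mxE /digits !rmorphD !rmorphM /=.
have -> : lift ord0 ord0 = 1 :> 'I_3 by exact: val_inj.
have -> : lift ord0 (lift ord0 ord0) = 2%:R :> 'I_3 by exact: val_inj.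
have -> : ord0 = 0 :> 'I_3 by exact: val_inj.
rewrite !natrX /bump/=; set q : R := Q%:R; set p := pi *+ 2.
rewrite -[Q%:~R]/q expr0 expr1; ring.
Qed.

(** A nonzero frequency with components small against Q has a nonzero number,
    smaller than Q^3, as in the uniqueness of balanced base-Q expansions. *)
Lemma digits_small (B Q : nat) (k : Z3) : k != 0 ->
  (forall j, (`|k 0%R j| <= B)%N) -> (B.*2.+2 <= Q)%N -> (0 < `|digits Q k| < Q ^ 3)%N.
Proof.
move=> k0 kB BQ; rewrite /digits.
have h0 := kB 0; have h1 := kB 1; have h2 := kB 2%:R.
have : ~ (k 0 0 = 0 /\ k 0 1 = 0 /\ k 0 2%:R = 0).
  move=> [e0 [e1 e2]]; move/eqP: k0; apply; apply/rowP => j; rewrite mxE.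
  case: j => -[|[|[|//]]] h.
  - by rewrite -[RHS]e0; congr (k 0 _); exact: val_inj.
  - by rewrite -[RHS]e1; congr (k 0 _); exact: val_inj.
  - by rewrite -[RHS]e2; congr (k 0 _); exact: val_inj.
move: (k 0 0) (k 0 1) (k 0 2%:R) h0 h1 h2 => a b c ha hb hc nz.
apply/andP; split.
  rewrite lt0n absz_eq0; apply/eqP => e; apply: nz.
  have a0 : a = 0.
    have ea : a = - (Q%:Z * (b + Q%:Z * c)) by lia.
    have [z|z] := eqVneq (b + Q%:Z * c) 0; first by rewrite ea z mulr0 oppr0.
    exfalso; have : (Q <= `|a|)%N by rewrite ea abszN abszM leq_pmulr// absz_gt0.
    by lia.
  have b0 : b = 0.
    have : Q%:Z * (b + Q%:Z * c) = 0 by lia.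
    move/eqP; rewrite mulf_eq0 => /orP[/eqP|/eqP eb]; first by lia.
    have [z|z] := eqVneq c 0; first by move: eb; rewrite z; lia.
    exfalso; have : (Q <= `|b|)%N.
      have -> : b = - (Q%:Z * c) by lia.
      by rewrite abszN abszM leq_pmulr// absz_gt0.
    by lia.
  split => //; split => //.
  move: e; rewrite a0 b0 mulr0 !add0r => /eqP; rewrite !mulf_eq0 => /orP[|/eqP//].
  by move=> /orP[]/eqP; lia.
rewrite !expnS expn0 muln1.
have : (absz (a + Q%:Z * b + Q%:Z * Q%:Z * c)%R <= B + Q * B + Q * Q * B)%N.
  have : (absz (Q%:Z * b)%R <= Q * B)%N by rewrite abszM leq_mul.
  have : (absz (Q%:Z * Q%:Z * c)%R <= Q * Q * B)%N by rewrite !abszM leq_mul.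
  by move: (Q%:Z * b) (Q%:Z * Q%:Z * c) (Q * B)%N (Q * Q * B)%N => *; lia.
by move=> h; apply: leq_ltn_trans h _; nia.
Qed.

(** The averages of exp(i (k - m) . x) over samples of increasing resolution
    tend to 0 unless k = m, and dominated convergence lets them pass the sum.
    The factor z stands for the phase exp(- i m . x). *)
Lemma fseries_eq0_Re R (c : Z3 -> R[i]) :
  summC c ->
  (forall z x, rsum (fun k => Re (z * (c k * expi (phase k x)))) = 0) ->
  forall m, Re (c m) = 0.
Proof.
move=> sc h m.
pose av (Q : nat) k := ((Q.+1 ^ 3)%N%:R)^-1 *
  \sum_(n < Q.+1 ^ 3) Re (c k * expi (phase (k - m) (sample R Q.+1 n))).
have nz Q : ((Q.+1 ^ 3)%N%:R : R) != 0 by rewrite pnatr_eq0 expn_eq0.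
have sav Q n : summ (fun k => Re (c k * expi (phase (k - m) (sample R Q n)))).
  by apply: summ_le sc => k; apply: le_trans (Re_le_cmod _) _; rewrite cmodM cmod_expi mulr1.
have av0 Q : rsum (av Q) = 0.
  rewrite /av rsumZ; last by apply: summ_sum => n; exact: sav.
  rewrite rsum_sum; last by move=> n; exact: sav.
  rewrite big1 ?mulr0// => n _.
  rewrite -[RHS](h (expi (phase (- m) (sample R Q.+1 n))) (sample R Q.+1 n)).
  by apply: eq_rsum => k; rewrite phaseD expiD; congr Re; ring.
have lim : rsum (av Q) @[Q --> \oo] --> rsum (fun k => if k == m then Re (c m) else 0).
  apply: (proj2 (rsum_cvg _ _ sc _)).
    near=> Q => k; rewrite /av normrM normfV (ger0_norm (ler0n _ (Q.+1 ^ 3))).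
    rewrite ler_pdivrMl; last by rewrite ltr0n expn_gt0.
    apply: le_trans (ler_norm_sum _ _ _) _.
    apply: (@le_trans _ _ (\sum_(n < Q.+1 ^ 3) cmod (c k))).
      apply: ler_sum => n _; apply: le_trans (Re_le_cmod _) _.
      by rewrite cmodM cmod_expi mulr1.
    by rewrite sumr_const card_ord mulr_natl.
  move=> k; case: eqVneq => [->|km].
    rewrite (_ : (fun Q => av Q m) = cst (Re (c m))); first exact: cvg_cst.
    apply/funext => Q; rewrite /av subrr.
    under eq_bigr do rewrite phase0 expi0 mulr1.
    by rewrite sumr_const card_ord -[X in _ * X]mulr_natl mulKf.
  have kB : exists B, forall j, (`|(k - m)%R 0%R j| <= B)%N.
    by exists (\sum_j `|(k - m)%R 0%R j|)%N => j; rewrite (bigD1 j)//= leq_addr.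
  have {kB} [B kB] := kB.
  apply: cvg_near_cst; near=> Q; rewrite /av.
  have dq : (0 < `|digits Q.+1 (k - m)| < Q.+1 ^ 3)%N.
    apply: (digits_small (B := B)) => //; first by rewrite subr_eq0.
    by have : (B.*2.+1 <= Q)%N by near: Q; exact: nbhs_infty_ge.
  rewrite -Re_sum -mulr_sumr.
  under eq_bigr do rewrite phase_sample.
  by rewrite expi_geometric_sum// mulr0 mulr0.
have := lim; rewrite rsum_single (_ : (fun Q => rsum (av Q)) = cst 0); last first.
  by apply/funext => Q; rewrite av0.
by move=> /(cvg_lim (@norm_hausdorff _ _)) <-; rewrite lim_cst.
Unshelve. all: by end_near. Qed.

(** By the symmetry of the coefficients the imaginary part of the series is zero
    as well, so the series vanishes after multiplication by any complex z; the
    families c and - i c yield the two parts of each coefficient. *)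
Lemma fseries_eq0 R (c : Z3 -> R[i]) :
  summC c -> real_coef c -> (forall x, fseries c x = 0) -> forall m, c m = 0.
Proof.
move=> sc hc h.
have hz z x : rsum (fun k => Re (z * (c k * expi (phase k x)))) = 0.
  have sr : summ (fun k => Re (c k * expi (phase k x))) by exact: summ_fseries.
  have si : summ (fun k => Im (c k * expi (phase k x))).
    by apply: summ_le sc => k; apply: le_trans (Im_le_cmod _) _; rewrite cmodM cmod_expi mulr1.
  under eq_rsum do rewrite Re_mul.
  by rewrite rsumB ?rsumZ//; [rewrite (real_coef_imag x sc hc) -/(fseries c x) h; ring|exact: summZ..].
move=> m; apply: complexP; first exact: fseries_eq0_Re sc hz m.
have := @fseries_eq0_Re R (fun k => - 'i%C * c k) _ _ m.
rewrite Re_mul /= oppr0 mul0r sub0r mulN1r opprK; apply.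
  by apply: summC_le sc => k; rewrite cmodM cmodN cmod_i mul1r.
by move=> z x; rewrite -[RHS](hz (z * - 'i%C) x); apply: eq_rsum => k; congr Re; ring.
Qed.

(** * Weighted spaces of fields and paths in them *)

Lemma l2norm_triangle R I (a b : I -> R) :
  l2 a -> l2 b ->
  l2 (fun i => a i + b i) /\ l2norm (fun i => a i + b i) <= l2norm a + l2norm b.
Proof.
move=> sa sb; have [s le] := cauchy_schwarz sa sb.
have E : (fun i => (a i + b i) ^+ 2) = (fun i => (a i ^+ 2 + 2 * (a i * b i)) + b i ^+ 2).
  by apply/funext => i; ring.
have s1 : summ (fun i => a i ^+ 2 + 2 * (a i * b i)) by apply: summD => //; exact: summZ.
split; first by rewrite /l2 E; exact: summD.
rewrite -(@ler_pXn2r _ 2)// ?nnegrE ?addr_ge0 ?l2norm_ge0// sqr_l2norm E.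
rewrite rsumD// rsumD//; last exact: summZ.
rewrite rsumZ// sqrrD !sqr_l2norm lerD2r lerD2l -[leRHS]mulr_natl ler_wpM2l//.
apply: le_trans le; apply: ler_rsum => //; first exact: summ_norm.
by move=> i; exact: ler_norm.
Qed.

(** Real, since an energy is differentiated over the reals. *)
Definition ip R m (c d : 'rV[R[i]]_m) : R :=
  \sum_(j < m) (Re (c 0 j) * Re (d 0 j) + Im (c 0 j) * Im (d 0 j)).

Definition mag R m (c : 'rV[R[i]]_m) : R :=
  Num.sqrt (coef_norm2 c).

Lemma coef_norm2_ge0 R m (c : 'rV[R[i]]_m) : 0 <= coef_norm2 c.
Proof. by apply: sumr_ge0 => j _; rewrite addr_ge0// sqr_ge0. Qed.

Lemma mag_ge0 R m (c : 'rV[R[i]]_m) : 0 <= mag c.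
Proof. exact: sqrtr_ge0. Qed.

Lemma sqr_mag R m (c : 'rV[R[i]]_m) : mag c ^+ 2 = coef_norm2 c.
Proof. by rewrite sqr_sqrtr// coef_norm2_ge0. Qed.

Lemma ipxx R m (c : 'rV[R[i]]_m) : ip c c = mag c ^+ 2.
Proof. by rewrite sqr_mag; apply: eq_bigr => j _; rewrite !expr2. Qed.

Lemma ipC R m (c d : 'rV[R[i]]_m) : ip c d = ip d c.
Proof. by apply: eq_bigr => j _; rewrite mulrC [X in _ + X]mulrC. Qed.

Lemma ipDl R m (c d e : 'rV[R[i]]_m) : ip (c + d) e = ip c e + ip d e.
Proof.
by rewrite /ip -big_split/=; apply: eq_bigr => j _; rewrite !mxE Re_add Im_add; ring.
Qed.

Lemma ipZl R m (a : R) (c d : 'rV[R[i]]_m) :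
  ip (a%:C *: c) d = a * ip c d.
Proof.
rewrite /ip mulr_sumr; apply: eq_bigr => j _; rewrite !mxE Re_mul Im_mul /=; ring.
Qed.

Lemma ipNl R m (c d : 'rV[R[i]]_m) : ip (- c) d = - ip c d.
Proof.
by rewrite /ip -sumrN; apply: eq_bigr => j _; rewrite !mxE Re_opp Im_opp; ring.
Qed.

Lemma ipBl R m (c d e : 'rV[R[i]]_m) : ip (c - d) e = ip c e - ip d e.
Proof. by rewrite ipDl ipNl. Qed.

Lemma ip_le R m (c d : 'rV[R[i]]_m) : `|ip c d| <= mag c * mag d.
Proof.
rewrite -(@ler_pXn2r _ 2)// ?nnegrE ?mulr_ge0 ?mag_ge0// real_normK ?num_real//.
rewrite exprMn; apply: discriminant_le; first exact: sqr_ge0.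
move=> t; rewrite -!ipxx.
have -> : t ^+ 2 * ip c c - 2 * t * ip c d + ip d d = ip (t%:C *: c - d) (t%:C *: c - d).
  by rewrite ipBl ipZl ![ip _ (_ - _)]ipC !ipBl !ipZl [ip d c]ipC; ring.
by rewrite ipxx sqr_ge0.
Qed.

Lemma magD R m (c d : 'rV[R[i]]_m) : mag (c + d) <= mag c + mag d.
Proof.
rewrite -(@ler_pXn2r _ 2)// ?nnegrE ?addr_ge0 ?mag_ge0// sqrrD -!ipxx.
rewrite ipDl ![ip _ (_ + _)]ipC !ipDl [ip d c]ipC.
have := le_trans (ler_norm _) (ip_le c d); rewrite mulr2n; lra.
Qed.

Lemma magN R m (c : 'rV[R[i]]_m) : mag (- c) = mag c.
Proof.
by congr Num.sqrt; apply: eq_bigr => j _; rewrite !mxE Re_opp Im_opp !sqrrN.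
Qed.

Lemma magB R m (c d : 'rV[R[i]]_m) : mag (c - d) <= mag c + mag d.
Proof. by rewrite -[mag d]magN magD. Qed.

Lemma magZ R m (a : R) (c : 'rV[R[i]]_m) :
  mag (a%:C *: c) = `|a| * mag c.
Proof.
apply/eqP; rewrite -(@eqrXn2 _ 2)// ?mulr_ge0 ?mag_ge0//; apply/eqP.
by rewrite exprMn real_normK ?num_real// -!ipxx ipZl ipC ipZl; ring.
Qed.

Lemma mag0 R m : mag (0 : 'rV[R[i]]_m) = 0.
Proof. by rewrite -(scale0r (0 : 'rV[R[i]]_m)) -[0 in LHS]/(0%:C) magZ normr0 mul0r. Qed.

Lemma cmod_le_mag R m (c : 'rV[R[i]]_m) j : cmod (c 0 j) <= mag c.
Proof.
rewrite ler_sqrt ?coef_norm2_ge0// /coef_norm2 (bigD1 j)//= lerDl sumr_ge0// => i _.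
by rewrite addr_ge0// sqr_ge0.
Qed.

(** A norm with an arbitrary weight [om] on the frequencies: the weight |k|^s
    gives the H^s norm, and the Voigt factor is absorbed in it. *)
Definition wseq R m (om : Z3 -> R) (w : pfield R m) :
  Z3 -> R := fun k => om k * mag (w k).

Definition wnorm R m (om : Z3 -> R) (w : pfield R m) : R :=
  l2norm (wseq om w).

Definition inw R m (om : Z3 -> R) (w : pfield R m) : Prop :=
  l2 (wseq om w).

Definition fpow R (s : nat) : Z3 -> R := fun k => freq R k ^+ s.

Lemma fpow_ge0 R s k : 0 <= fpow R s k.
Proof. by rewrite exprn_ge0// freq_ge0. Qed.

(** A positive power of |k| vanishes at k = 0, so that the exclusion of k = 0
    from the Sobolev norm can be dropped. *)
Lemma esum_Hnorm R m s (w : pfield R m) :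
  (\esum_(k in [set k : Z3 | (k != 0)%R])
           ((freq2 R k `^ s.+1%:R) * coef_norm2 (w k))%R%:E =
   \esum_(k in [set: Z3]) (wseq (fpow R s.+1) w k ^+ 2)%R%:E)%E.
Proof.
rewrite esum_mkcond; apply: eq_esum => k _; rewrite /wseq /fpow exprMn sqr_mag.
rewrite -exprM mulnC exprM sqr_freq powR_mulrn ?freq2_ge0//.
have [->|k0] := eqVneq k 0.
  by rewrite freq2_0 expr0n mul0r; case: ifP.
by rewrite ifT// inE.
Qed.

Lemma inw_Hnorm R m s (w : pfield R m) :
  inw (fpow R s.+1) w -> Hnorm s.+1%:R w = (wnorm (fpow R s.+1) w)%:E.
Proof.
move=> h; rewrite /Hnorm esum_Hnorm -ge0_rsumE//; by move=> k; exact: sqr_ge0.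
Qed.

Lemma Hnorm_inw R m s (w : pfield R m) :
  (Hnorm s.+1%:R w < +oo)%E -> inw (fpow R s.+1) w.
Proof.
rewrite /Hnorm esum_Hnorm => h.
have : (\esum_(k in [set: Z3]) (wseq (fpow R s.+1) w k ^+ 2)%:E < +oo)%E.
  by move: h; case: (esum _ _) => [r| |]; rewrite /= ?ltry ?ltNyy.
apply: le_lt_trans; apply: le_esum => k _.
by rewrite lee_fin ger0_norm ?sqr_ge0.
Qed.

Lemma inw_le R m (C : R) (om om' : Z3 -> R) (w : pfield R m) :
  0 <= C -> (forall k, `|om' k| <= C * `|om k|) -> inw om w ->
  inw om' w /\ wnorm om' w <= C * wnorm om w.
Proof.
move=> C0 h sw; have [sC nC] := l2Z C sw.
have b k : `|wseq om' w k| <= `|C * wseq om w k|.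
  by rewrite /wseq !normrM (ger0_norm C0) mulrA ler_wpM2r.
have [s le] := l2_le b sC.
by split => //; apply: le_trans le _; rewrite nC (ger0_norm C0).
Qed.

(** Stated for a field dominated pointwise, since the sum may be a difference or
    a truncated difference. *)
Lemma inwD_gen R (m m' m'' : nat) (om : Z3 -> R)
    (x : pfield R m) (y : pfield R m') (z : pfield R m'') :
  (forall k, mag (z k) <= mag (x k) + mag (y k)) -> inw om x -> inw om y ->
  inw om z /\ wnorm om z <= wnorm om x + wnorm om y.
Proof.
move=> h sx sy.
have nx : l2 (fun k => `|wseq om x k|) /\ l2norm (fun k => `|wseq om x k|) <= wnorm om x.
  by apply: l2_le => // k; rewrite normr_id.
have ny : l2 (fun k => `|wseq om y k|) /\ l2norm (fun k => `|wseq om y k|) <= wnorm om y.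
  by apply: l2_le => // k; rewrite normr_id.
have [s le] := l2norm_triangle nx.1 ny.1.
have b k : `|wseq om z k| <= `|(`|wseq om x k| + `|wseq om y k|)|.
  rewrite [leRHS]ger0_norm ?addr_ge0// /wseq !normrM -mulrDr ler_wpM2l//.
  by rewrite !(ger0_norm (mag_ge0 _)).
have [sz lz] := l2_le b s; split => //.
by apply: le_trans lz _; apply: le_trans le _; rewrite lerD ?nx.2 ?ny.2.
Qed.

Lemma inwB R m (om : Z3 -> R) (x y : pfield R m) :
  inw om x -> inw om y ->
  inw om (fsub x y) /\ wnorm om (fsub x y) <= wnorm om x + wnorm om y.
Proof. by move=> sx sy; apply: inwD_gen => // k; exact: magB. Qed.

Definition fmul R m (phi : Z3 -> R) (w : pfield R m) : pfield R m :=
  fun k => (phi k)%:C *: w k.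

Lemma inw_fmul R m (C : R) (om om' phi : Z3 -> R) (w : pfield R m) :
  0 <= C -> (forall k, `|om' k * phi k| <= C * `|om k|) -> inw om w ->
  inw om' (fmul phi w) /\ wnorm om' (fmul phi w) <= C * wnorm om w.
Proof.
move=> C0 h sw; have [s1 l1] := inw_le C0 h sw.
have b k : `|wseq om' (fmul phi w) k| <= `|wseq (fun k => om' k * phi k) w k|.
  by rewrite /wseq /fmul magZ !normrM normr_id mulrA.
by have [s l] := l2_le b s1; split => //; exact: le_trans l1.
Qed.

(** Continuous and continuously differentiable paths, with finite real norms in
    place of extended ones. *)
Definition C0w R m (T : R) (om : Z3 -> R)
    (w : R -> pfield R m) : Prop :=
  (forall t, t \in `[0, T] -> inw om (w t)) /\
  (forall t, t \in `[0, T] ->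
     wnorm om (fsub (w r) (w t)) @[r --> within `[0, T] (nbhs t)] --> 0).

Definition C1w R m (T : R) (om : Z3 -> R)
    (w dw : R -> pfield R m) : Prop :=
  [/\ C0w T om w, C0w T om dw &
    forall t, t \in `[0, T] ->
      wnorm om (fsub (diffquot w t h) (dw t))
        @[h --> within [set h | t + h \in `[0, T]] 0^'] --> 0].

Lemma near_within (T : Type) (F : set_system T) (FF : Filter F) (D : set T) :
  \forall x \near within D F, D x.
Proof. exact: withinT. Qed.

Lemma inw_diffquot R m (T : R) (om : Z3 -> R)
    (w : R -> pfield R m) (t h : R) :
  (forall t, t \in `[0, T] -> inw om (w t)) -> t \in `[0, T] -> t + h \in `[0, T] ->
  inw om (diffquot w t h).
Proof.
move=> hw tT thT; have [s _] := inwB (hw _ thT) (hw _ tT).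
have -> : diffquot w t h = fmul (fun=> h^-1) (fsub (w (t + h)) (w t)) by [].
by apply: (proj1 (inw_fmul (C := `|h^-1|) _ _ s)) => // k; rewrite normrM mulrC.
Qed.

Lemma C0path_C0w R m s (T : R) (X : set (pfield R m)) (w : R -> pfield R m) :
  (forall v, X v -> (Hnorm s.+1%:R v < +oo)%E) ->
  C0path T s.+1%:R X w -> C0w T (fpow R s.+1) w.
Proof.
move=> hX [h1 h2].
have h t : t \in `[0, T] -> inw (fpow R s.+1) (w t) by move=> /h1/hX/Hnorm_inw.
split => // t tT; apply: cvg_trans (fine_cvg (h2 t tT)).
apply: near_eq_cvg; near=> r; have rT : r \in `[0, T].
  by near: r; exact: near_within.
by rewrite /= inw_Hnorm//; apply: (proj1 (inwB _ _)); exact: h.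
Unshelve. all: by end_near. Qed.

(** The derivative of a path of class C^1 is only asserted to exist; it is
    named here once and for all. *)
Lemma C1path_C1w R m s (T : R) (X : set (pfield R m)) (w : R -> pfield R m) :
  (forall v, X v -> (Hnorm s.+1%:R v < +oo)%E) ->
  C1path T s.+1%:R X w ->
  exists2 dw, C1w T (fpow R s.+1) w dw & (forall t, t \in `[0, T] -> X (dw t)).
Proof.
move=> hX [cw [dw cdw h]].
have cw' := C0path_C0w hX cw; have cdw' := C0path_C0w hX cdw.
exists dw; last by case: cdw.
split => // t tT; apply: cvg_trans (fine_cvg (h t tT)).
apply: near_eq_cvg; near=> r; have rT : t + r \in `[0, T].
  by near: r; exact: near_within.
rewrite /= inw_Hnorm//; apply: (proj1 (inwB _ _)); last by exact: (proj1 cdw').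
by apply: inw_diffquot rT => //; case: cw'.
Unshelve. all: by end_near. Qed.

Lemma squeeze0 R (T : Type) (F : set_system T) (FF : Filter F) (f g : T -> R) (C : R) :
  (\forall t \near F, 0 <= f t <= C * g t) -> g t @[t --> F] --> 0 -> f t @[t --> F] --> 0.
Proof.
move=> h hg; apply: (squeeze_cvgr h); first exact: cvg_cst.
by rewrite -[X in _ --> X](mulr0 C); apply: cvgM => //; exact: cvg_cst.
Qed.

(** A multiplier may also change the weight: a cutoff gains powers of |k| at
    the price of powers of N. *)
Lemma C0w_fmul R m (T C : R) (om om' phi : Z3 -> R)
    (w : R -> pfield R m) : 0 <= C -> (forall k, `|om' k * phi k| <= C * `|om k|) ->
  C0w T om w -> C0w T om' (fun t => fmul phi (w t)).
Proof.
move=> C0 h [h1 h2]; split; first by move=> t /h1; exact: (fun s => proj1 (inw_fmul C0 h s)).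
move=> t tT; apply: squeeze0 (h2 t tT); near=> r.
have rT : r \in `[0, T] by near: r; exact: near_within.
rewrite l2norm_ge0/=.
have -> : fsub (fmul phi (w r)) (fmul phi (w t)) = fmul phi (fsub (w r) (w t)).
  by apply/funext => k; rewrite /fsub /fmul scalerBr.
by apply: (proj2 (inw_fmul C0 h _)); apply: (proj1 (inwB _ _)); exact: h1.
Unshelve. all: by end_near. Qed.

Lemma C1w_fmul R m (T C : R) (om om' phi : Z3 -> R)
    (w dw : R -> pfield R m) : 0 <= C -> (forall k, `|om' k * phi k| <= C * `|om k|) ->
  C1w T om w dw -> C1w T om' (fun t => fmul phi (w t)) (fun t => fmul phi (dw t)).
Proof.
move=> C0 h [cw cdw hd]; split; [exact: (C0w_fmul C0 h cw)|exact: (C0w_fmul C0 h cdw)|].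
move=> t tT; apply: squeeze0 (hd t tT); near=> r.
have rT : t + r \in `[0, T] by near: r; exact: near_within.
rewrite l2norm_ge0/=.
have -> : fsub (diffquot (fun t => fmul phi (w t)) t r) (fmul phi (dw t)) =
          fmul phi (fsub (diffquot w t r) (dw t)).
  apply/funext => k; rewrite /fsub /fmul /diffquot -scalerBr [in RHS]scalerBr !scalerA.
  by rewrite mulrC.
apply: (proj2 (inw_fmul C0 h _)); apply: (proj1 (inwB _ _)); last by case: cdw => + _; apply.
by apply: inw_diffquot rT => //; case: cw.
Unshelve. all: by end_near. Qed.

Lemma sub_interchange (V : zmodType) (a b c d : V) : a - b - (c - d) = a - c - (b - d).
Proof. by rewrite !opprB addrACA [RHS]addrACA [- b - c]addrC. Qed.

Lemma C0w_sub R m (T : R) (om : Z3 -> R) (v w : R -> pfield R m) :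
  C0w T om v -> C0w T om w -> C0w T om (fun t => fsub (v t) (w t)).
Proof.
move=> [v1 v2] [w1 w2]; split.
  by move=> t tT; apply: (proj1 (inwB _ _)); [exact: v1|exact: w1].
move=> t tT; have := cvgD (v2 t tT) (w2 t tT); rewrite addr0.
move=> /(_ _) hc; apply: (@squeeze0 _ _ _ _ _ _ 1 _ hc); near=> r.
have rT : r \in `[0, T] by near: r; exact: near_within.
rewrite l2norm_ge0/= mul1r.
apply: (proj2 (inwD_gen _ (proj1 (inwB (v1 r rT) (v1 t tT))) (proj1 (inwB (w1 r rT) (w1 t tT))))).
by move=> k; rewrite /fsub sub_interchange; exact: magB.
Unshelve. all: by end_near. Qed.

Lemma C1w_sub R m (T : R) (om : Z3 -> R)
    (v dv w dw : R -> pfield R m) :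
  C1w T om v dv -> C1w T om w dw ->
  C1w T om (fun t => fsub (v t) (w t)) (fun t => fsub (dv t) (dw t)).
Proof.
move=> [cv cdv hv] [cw cdw hw]; split; [exact: C0w_sub|exact: C0w_sub|].
move=> t tT; have := cvgD (hv t tT) (hw t tT); rewrite addr0.
move=> /(_ _) hc; apply: (@squeeze0 _ _ _ _ _ _ 1 _ hc); near=> r.
have rT : t + r \in `[0, T] by near: r; exact: near_within.
rewrite l2norm_ge0/= mul1r.
have sv := inw_diffquot (proj1 cv) tT rT; have sw := inw_diffquot (proj1 cw) tT rT.
apply: (proj2 (inwD_gen _ (proj1 (inwB sv (proj1 cdv t tT))) (proj1 (inwB sw (proj1 cdw t tT))))).
by move=> k; rewrite /fsub /diffquot sub_interchange scalerBr sub_interchange; exact: magB.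
Unshelve. all: by end_near. Qed.

(** * Time derivatives of Fourier series *)

(** Fields in the weighted space have absolutely convergent series after
    multiplication by any symbol that leaves two powers of |k| to spare. *)
Lemma l1_embedding_mul R m (mu om : Z3 -> R) (z : pfield R m) :
  z 0 = 0 -> (forall k, freq2 R k * `|mu k| <= `|om k|) -> inw om z ->
  summ (fun k => `|mu k| * mag (z k)) /\
  rsum (fun k => `|mu k| * mag (z k)) <= sob R * wnorm om z.
Proof.
move=> z0 h sz; pose x k := `|mu k| * mag (z k).
have b k : `|freq2 R k * x k| <= `|wseq om z k|.
  rewrite /x /wseq mulrA !normrM !(ger0_norm (mag_ge0 _)) ler_wpM2r ?mag_ge0//.
  by rewrite normr_id (ger0_norm (freq2_ge0 _ _)).
have [s l] := l2_le b sz.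
have x0 k : 0 <= x k by rewrite mulr_ge0// mag_ge0.
have xz : x 0 = 0 by rewrite /x z0 mag0 mulr0.
have [s' l'] := l1_embedding x0 xz s; split => //.
by apply: le_trans l' _; rewrite ler_wpM2l// l2norm_ge0.
Qed.

Lemma summC_comp R m (mu : Z3 -> R) (z : pfield R m) j :
  summ (fun k => `|mu k| * mag (z k)) -> summC (fun k => (mu k)%:C * z k 0 j).
Proof.
by apply: summC_le => k; rewrite cmodM cmod_real ler_wpM2l// cmod_le_mag.
Qed.

Lemma cvg_within_drop (T : Type) (U : topologicalType) (F : set_system T)
    (FF : Filter F) (D : set T) (f : T -> U) (l : U) :
  (\forall x \near F, D x) -> f x @[x --> within D F] --> l -> f x @[x --> F] --> l.
Proof.
move=> nD h A lA; have := h A lA; rewrite /nbhs/= /fmap /within/= => hA.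
by apply: filterS2 nD hA => x Dx; apply.
Qed.

Lemma near_itv_shift R (T t : R) : t \in `]0, T[ ->
  \forall h \near (0 : R)^', t + h \in `[0, T].
Proof.
rewrite in_itv/= => /andP[t0 tT].
have m0 : 0 < Num.min t (T - t) by rewrite lt_min t0 subr_gt0.
near=> h.
have : `|h| < Num.min t (T - t) by near: h; exact: dnbhs0_lt.
rewrite lt_min => /andP[]; rewrite !ltr_norml => /andP[? _] /andP[_ ?].
by rewrite in_itv/=; apply/andP; split; lra.
Unshelve. all: by end_near. Qed.

Lemma summCZ R I (a : R) (c : I -> R[i]) :
  summC c -> summC (fun k => a%:C * c k).
Proof. by move=> sc; apply: summC_le (summZ `|a| sc) => k; rewrite cmodM cmod_real. Qed.

Lemma summCB R I (c d : I -> R[i]) :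
  summC c -> summC d -> summC (fun k => c k - d k).
Proof. by move=> sc sd; apply: summCD => //; exact: summCN. Qed.

Lemma fseriesB R (c d : Z3 -> R[i]) (x : 'rV[R]_3) :
  summC c -> summC d -> fseries (fun k => c k - d k) x = fseries c x - fseries d x.
Proof. by move=> sc sd; rewrite -fseriesN// -fseriesD//; exact: summCN. Qed.

(** The difference quotient converges in the weighted norm, which controls the
    absolute sum of the coefficients.  The multiplier allows for the Laplacian in
    the Voigt term. *)
Lemma fseries_time_derive R m (T : R) (mu om : Z3 -> R)
    (w dw : R -> pfield R m) (g : R -> R) (j : 'I_m) (x : 'rV[R]_3) (t : R) :
  (forall k, freq2 R k * `|mu k| <= `|om k|) -> C1w T om w dw ->
  (forall t, t \in `[0, T] -> w t 0 = 0) -> (forall t, t \in `[0, T] -> dw t 0 = 0) ->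
  (forall r, r \in `[0, T] -> g r = fseries (fun k => (mu k)%:C * w r k 0 j) x) ->
  t \in `]0, T[ ->
  derive1 g t = fseries (fun k => (mu k)%:C * dw t k 0 j) x.
Proof.
move=> hmu [cw cdw hd] w0 dw0 hg tT.
have tT' : t \in `[0, T] by apply: subset_itv_oo_cc.
have nT := near_itv_shift tT.
have hd' := cvg_within_drop _ nT (hd t tT').
have s0 : 0 <= sob R by exact: l2norm_ge0.
suff cv : h^-1 *: (g (h + t) - g t) @[h --> (0 : R)^'] -->
    fseries (fun k => (mu k)%:C * dw t k 0 j) x by exact: (cvg_lim _ cv).
apply/cvgrPdist_le => e e0.
have e1 : 0 < e / (sob R + 1) by rewrite divr_gt0// ltr_wpDl.
move: hd' => /(_ _)/cvgrPdist_le/(_ _ e1) hd'; near=> h.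
have hT : t + h \in `[0, T] by near: h.
have h0 : h != 0 by near: h; exact: nbhs_dnbhs_neq.
have : wnorm om (fsub (diffquot w t h) (dw t)) <= e / (sob R + 1).
  have : `|0 - wnorm om (fsub (diffquot w t h) (dw t))| <= e / (sob R + 1) by near: h.
  by rewrite sub0r normrN ger0_norm ?l2norm_ge0.
have sq : inw om (diffquot w t h) by apply: inw_diffquot hT => //; case: cw.
have sd : inw om (dw t) by case: cdw => + _; apply.
set z := fsub _ _ => hz.
have z0 : z 0 = 0 by rewrite /z /fsub /diffquot !w0// dw0// subrr scaler0 subrr.
have [sz lz] := l1_embedding_mul z0 hmu (proj1 (inwB sq sd)).
pose W r (k : Z3) := (mu k)%:C * w r k 0 j.
pose D (k : Z3) := (mu k)%:C * dw t k 0 j.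
pose Z (k : Z3) := (mu k)%:C * z k 0 j.
have sumw r : r \in `[0, T] -> summC (W r).
  move=> rT; apply: summC_comp; apply: (proj1 (l1_embedding_mul (w0 r rT) hmu _)).
  by case: cw => + _; apply.
have sumd : summC D.
  by apply: summC_comp; apply: (proj1 (l1_embedding_mul (dw0 t tT') hmu _)).
have szj : summC Z by exact: summC_comp.
have -> : fseries D x - h^-1 *: (g (h + t) - g t) = - fseries Z x.
  pose dW (k : Z3) := W (t + h) k - W t k.
  have sdiff : summC dW := summCB (sumw _ hT) (sumw _ tT').
  have Eg : g (h + t) - g t = fseries dW x.
    by rewrite [h + t]addrC (hg _ hT) (hg _ tT') (fseriesB _ (sumw _ hT) (sumw _ tT')).
  pose hW (k : Z3) := h^-1%:C * dW k.
  have shW : summC hW := summCZ h^-1 sdiff.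
  have -> : h^-1 *: (g (h + t) - g t) = fseries hW x.
    by rewrite Eg (fseriesZ _ _ sdiff).
  rewrite -(fseriesN _ szj) -(fseriesB _ sumd shW).
  apply: eq_rsum => k; congr (Re (_ * _)).
  rewrite /D /hW /dW /W /Z /z /fsub /diffquot !mxE; ring.
rewrite normrN; apply: le_trans (fseries_le _ szj) _.
apply: (@le_trans _ _ (sob R * wnorm om z)).
  apply: le_trans lz; apply: ler_rsum => // k.
  by rewrite cmodM cmod_real ler_wpM2l// cmod_le_mag.
apply: (@le_trans _ _ (sob R * (e / (sob R + 1)))); first by rewrite ler_wpM2l.
by rewrite mulrCA; apply: ler_piMr; [exact: ltW|rewrite ler_pdivrMr ?ltr_wpDl// mul1r lerDl].
Unshelve. all: by end_near. Qed.

(** * The trilinear form of the advection term *)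

(** [adv l a] is the symbol i (a . l) of the operator a . grad at frequency l. *)
Definition adv R (l : Z3) (a : 'rV[R[i]]_3) : R[i] :=
  \sum_(m < 3) 'i%C * (((l 0 m)%:~R)%:C * a 0 m).

(** The term in which the frequencies of a and c add up to that of the test
    vector d. *)
Definition tri R (l : Z3) (a c d : 'rV[R[i]]_3) : R :=
  ip (adv l a *: c) d.

Lemma advD R (l : Z3) (a b : 'rV[R[i]]_3) :
  adv l (a + b) = adv l a + adv l b.
Proof. by rewrite /adv -big_split/=; apply: eq_bigr => m _; rewrite mxE !mulrDr. Qed.

Lemma advN R (l : Z3) (a : 'rV[R[i]]_3) : adv l (- a) = - adv l a.
Proof. by rewrite /adv -sumrN; apply: eq_bigr => m _; rewrite mxE !mulrN. Qed.

Lemma advB R (l : Z3) (a b : 'rV[R[i]]_3) :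
  adv l (a - b) = adv l a - adv l b.
Proof. by rewrite advD advN. Qed.

Lemma triBl R (l : Z3) (a b c d : 'rV[R[i]]_3) :
  tri l (a - b) c d = tri l a c d - tri l b c d.
Proof. by rewrite /tri advB scalerBl ipBl. Qed.

Lemma triBr R (l : Z3) (a b c d : 'rV[R[i]]_3) :
  tri l a (b - c) d = tri l a b d - tri l a c d.
Proof. by rewrite /tri scalerBr ipBl. Qed.

Lemma triZr R (r : R) (l : Z3) (a c d : 'rV[R[i]]_3) :
  tri l a (r%:C *: c) d = r * tri l a c d.
Proof. by rewrite /tri scalerA mulrC -scalerA ipZl. Qed.

Lemma magZC R m (z : R[i]) (c : 'rV[R[i]]_m) :
  mag (z *: c) = cmod z * mag c.
Proof.
rewrite /mag /cmod -sqrtrM ?addr_ge0 ?sqr_ge0//; congr Num.sqrt.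
rewrite /coef_norm2 mulr_sumr; apply: eq_bigr => j _; rewrite mxE Re_mul Im_mul; ring.
Qed.

Lemma cmod_adv R (l : Z3) (a : 'rV[R[i]]_3) :
  cmod (adv l a) <= freq R l * mag a.
Proof.
rewrite -(@ler_pXn2r _ 2)// ?nnegrE ?mulr_ge0 ?freq_ge0 ?mag_ge0 ?cmod_ge0//.
rewrite exprMn sqr_mag sqr_freq sqr_cmod /adv Re_sum Im_sum.
under eq_bigr do rewrite Re_mul Im_mul /= !mul0r mul1r sub0r addr0.
under [X in _ + X ^+ 2]eq_bigr do rewrite Im_mul Re_mul /= !mul0r mul1r add0r subr0.
rewrite sumrN sqrrN /coef_norm2 big_split/= mulrDr addrC.
by apply: lerD; exact: cauchy_schwarz_fin.
Qed.

Lemma tri_le R (l : Z3) (a c d : 'rV[R[i]]_3) :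
  `|tri l a c d| <= freq R l * mag a * mag c * mag d.
Proof.
apply: le_trans (ip_le _ _) _; rewrite magZC; apply: ler_wpM2r; first exact: mag_ge0.
by apply: ler_wpM2r; [exact: mag_ge0|exact: cmod_adv].
Qed.

Lemma ip_conjZ R m (z : R[i]) (c d : 'rV[R[i]]_m) :
  ip (z^* *: c) d = ip (z *: d) c.
Proof.
apply: eq_bigr => j _; rewrite !mxE !Re_mul !Im_mul Re_conjc Im_conjc; ring.
Qed.

(** The symbol a . l equals a . k because a(k - l) is orthogonal to k - l, and
    the reality of a conjugates it when the two frequencies are exchanged. *)
Lemma tri_antisym R (a : pfield R 3) (k l : Z3) (c d : 'rV[R[i]]_3) :
  (forall k j, a (- k) 0 j = (a k 0 j)^*) ->
  (forall k : Z3, \sum_(j < 3) (k 0 j)%:~R * a k 0 j = 0) ->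
  tri k (a (l - k)) c d = - tri l (a (k - l)) d c.
Proof.
move=> ha div; rewrite /tri.
suff -> : adv k (a (l - k)) = - (adv l (a (k - l)))^*.
  by rewrite scaleNr ipNl ip_conjZ.
have E : adv k (a (k - l)) = adv l (a (k - l)).
  apply/eqP; rewrite -subr_eq0 /adv -sumrB; apply/eqP.
  rewrite -[RHS](mulr0 'i%C) -[in RHS](div (k - l)) mulr_sumr; apply: eq_bigr => j _.
  by rewrite !mxE complex_intr intrB rmorphB/=; ring.
rewrite -E /adv rmorph_sum -sumrN; apply: eq_bigr => j _.
rewrite -opprB ha; apply: complexP; rewrite ?Re_opp ?Im_opp ?Re_conjc ?Im_conjc;
  rewrite !(Re_mul, Im_mul) /= ?Re_conjc ?Im_conjc; ring.
Qed.

Lemma summ_mag_comp R m (w : pfield R m) j :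
  summ (fun k => mag (w k)) -> summC (fun k => w k 0 j).
Proof. by apply: summC_le => k; exact: cmod_le_mag. Qed.

Lemma summ_freqmag_comp R m (w : pfield R m) j :
  summ (fun k => freq R k * mag (w k)) -> summ (fun k => freq R k * cmod (w k 0 j)).
Proof.
apply: summ_le => k; rewrite ger0_norm ?mulr_ge0 ?freq_ge0 ?cmod_ge0//.
by rewrite ler_wpM2l ?freq_ge0// cmod_le_mag.
Qed.

Lemma summC_dcoef R l (c : Z3 -> R[i]) :
  summ (fun k => freq R k * cmod (c k)) -> summC (dcoef l c).
Proof. by apply: summC_le => k; exact: cmod_dcoef. Qed.

Lemma real_coef_dcoef R l (c : Z3 -> R[i]) :
  real_coef c -> real_coef (dcoef l c).
Proof.
move=> h k; rewrite /dcoef h mxE mulrNz; apply: complexP;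
  rewrite ?Re_conjc ?Im_conjc !(Re_mul, Im_mul) /= ?Re_conjc ?Im_conjc; ring.
Qed.

Lemma summC_sum R I (n : nat) (c : 'I_n -> I -> R[i]) :
  (forall l, summC (c l)) -> summC (fun k => \sum_l c l k).
Proof.
move=> h; apply: (@summC_le _ _ _ (fun k => \sum_l (`|Re (c l k)| + `|Im (c l k)|))).
  move=> k; apply: le_trans (cmod_le _) _; rewrite Re_sum Im_sum big_split/=.
  by apply: lerD; exact: ler_norm_sum.
by apply: summ_sum => l; apply: summD; apply: summ_norm; [exact: summC_Re|exact: summC_Im].
Qed.

Definition advconv R (a : pfield R 3) (j : 'I_3) : Z3 -> R[i] :=
  fun k => \sum_(l < 3) fconv (fun k => a k 0 l) (dcoef l (fun k => a k 0 j)) k.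

Lemma advection_fseries R (a : pfield R 3) (j : 'I_3) (x : 'rV[R]_3) :
  (forall k j, a (- k) 0 j = (a k 0 j)^*) ->
  summ (fun k => mag (a k)) -> summ (fun k => freq R k * mag (a k)) ->
  advection a j x = fseries (advconv a j) x.
Proof.
move=> ha s0 s1.
have sc l := summ_mag_comp l s0; have sd l := summ_freqmag_comp l s1.
have sdc l i := summC_dcoef l (sd i).
have hc l : real_coef (fun k => a k 0 l) by move=> k; exact: ha.
transitivity (\sum_(l < 3) fseries (fconv (fun k => a k 0 l) (dcoef l (fun k => a k 0 j))) x).
  apply: eq_bigr => l _.
  have -> : partial l (value a j) x = fseries (dcoef l (fun k => a k 0 j)) x.
    by rewrite -partial_fseries//.
  by rewrite -fseries_mul//; exact: real_coef_dcoef.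
rewrite /fseries -rsum_sum; last by move=> l; apply: summ_fseries; exact: summC_fconv.
by apply: eq_rsum => k; rewrite -Re_sum -mulr_suml.
Qed.

Lemma ip_advconv R (a : pfield R 3) (k : Z3) (d : 'rV[R[i]]_3) :
  summ (fun k => mag (a k)) -> summ (fun k => freq R k * mag (a k)) ->
  ip (\row_j advconv a j k) d = rsum (fun l => tri l (a (k - l)) (a l) d).
Proof.
move=> s0 s1.
have sc l := summ_mag_comp l s0; have sd l := summ_freqmag_comp l s1.
have sdc l i := summC_dcoef l (sd i).
have srow (i j : 'I_3) := summC_fconv_row k (sc i) (sdc i j).
pose F (j i : 'I_3) (l : Z3) : R[i] := a (k - l) 0 i * dcoef i (fun k => a k 0 j) l.
have E l : tri l (a (k - l)) (a l) d = \sum_(j < 3) \sum_(i < 3)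
    (Re (d 0 j) * Re (F j i l) + Im (d 0 j) * Im (F j i l)).
  rewrite /tri /ip; apply: eq_bigr => j _; rewrite !mxE /adv mulr_suml Re_sum Im_sum.
  rewrite big_split/= -!mulr_sumr mulrC [X in _ + X]mulrC; congr (_ * _ + _ * _).
    by apply: eq_bigr => i _; congr Re; rewrite /F /dcoef; cbv beta; ring.
  by apply: eq_bigr => i _; congr Im; rewrite /F /dcoef; cbv beta; ring.
have sF j i : summC (F j i) := srow i j.
have sR j i := summZ (Re (d 0 j)) (summC_Re (sF j i)).
have sI j i := summZ (Im (d 0 j)) (summC_Im (sF j i)).
rewrite (eq_rsum E) rsum_sum; last by move=> j; apply: summ_sum => i; exact: summD.
apply: eq_bigr => j _; rewrite rsum_sum; last by move=> i; exact: summD.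
rewrite !mxE /advconv Re_sum Im_sum !mulr_suml -big_split/=; apply: eq_bigr => i _.
rewrite rsumD// !rsumZ; [|exact: summC_Im|exact: summC_Re].
by rewrite /fconv /csum/= mulrC [X in _ + X]mulrC.
Qed.

(** * The equations on Fourier coefficients *)

Lemma fpow_mono R (s s' : nat) k : (0 < s <= s')%N -> fpow R s k <= fpow R s' k.
Proof.
move=> /andP[s0 ss]; rewrite /fpow; have [->|k0] := eqVneq k 0.
  by rewrite freq0 !expr0n gtn_eqF// gtn_eqF// (leq_trans s0 ss).
by apply: ler_weXn2l => //; exact: freq_ge1.
Qed.

Lemma inw_fpow R (m s s' : nat) (w : pfield R m) :
  (0 < s <= s')%N -> inw (fpow R s') w ->
  inw (fpow R s) w /\ wnorm (fpow R s) w <= wnorm (fpow R s') w.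
Proof.
move=> ss h; rewrite -[X in _ /\ _ <= X]mul1r; apply: inw_le => // k.
by rewrite mul1r !ger0_norm ?fpow_ge0// fpow_mono.
Qed.

Lemma summ_mag_H2 R m (w : pfield R m) :
  w 0 = 0 -> inw (fpow R 2) w ->
  summ (fun k => mag (w k)) /\ rsum (fun k => mag (w k)) <= sob R * wnorm (fpow R 2) w.
Proof.
move=> w0 h.
have E : (fun k => mag (w k)) = (fun k => `|1| * mag (w k)).
  by apply/funext => k; rewrite normr1 mul1r.
rewrite E; apply: l1_embedding_mul => // k.
by rewrite normr1 mulr1 /fpow sqr_freq ler_norm.
Qed.

Lemma summ_freqmag_H3 R m (w : pfield R m) :
  w 0 = 0 -> inw (fpow R 3) w ->
  summ (fun k => freq R k * mag (w k)) /\
  rsum (fun k => freq R k * mag (w k)) <= sob R * wnorm (fpow R 3) w.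
Proof.
move=> w0 h.
have E : (fun k => freq R k * mag (w k)) = (fun k => `|freq R k| * mag (w k)).
  by apply/funext => k; rewrite ger0_norm ?freq_ge0.
rewrite E; apply: l1_embedding_mul => // k.
by rewrite /fpow -sqr_freq !ger0_norm ?exprn_ge0 ?freq_ge0// -exprSr.
Qed.

(** The coefficient of a pressure gradient is parallel to the frequency. *)
Lemma ip_gradient R (k : Z3) (q : R[i]) (d : 'rV[R[i]]_3) :
  \sum_(j < 3) (k 0 j)%:~R * d 0 j = 0 ->
  ip (\row_j ('i%C * (((k 0 j)%:~R)%:C * q))) d = 0.
Proof.
move=> h.
have h1 : \sum_(j < 3) (k 0 j)%:~R * Re (d 0 j) = 0.
  rewrite -[RHS]/(Re (0 : R[i])) -h Re_sum; apply: eq_bigr => j _.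
  by rewrite complex_intr Re_mul/= mul0r subr0.
have h2 : \sum_(j < 3) (k 0 j)%:~R * Im (d 0 j) = 0.
  rewrite -[RHS]/(Im (0 : R[i])) -h Im_sum; apply: eq_bigr => j _.
  by rewrite complex_intr Im_mul/= mul0r addr0.
transitivity (- Im q * (\sum_(j < 3) (k 0 j)%:~R * Re (d 0 j))
   + Re q * (\sum_(j < 3) (k 0 j)%:~R * Im (d 0 j))); last by rewrite h1 h2 !mulr0 addr0.
rewrite !mulr_sumr -big_split/=; apply: eq_bigr => j _.
by rewrite !mxE !(Re_mul, Im_mul)/=; ring.
Qed.

(** Covers both equations: A collects the terms in the time derivative.  Every
    term is a Fourier series, so the coefficients of their sum vanish. *)
Lemma fourier_momentum R (A u f : pfield R 3) (p : pfield R 1)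
    (k : Z3) (d : 'rV[R[i]]_3) :
  summ (fun k => mag (A k)) -> (forall k j, A (- k) 0 j = (A k 0 j)^*) ->
  summ (fun k => mag (u k)) -> summ (fun k => freq R k * mag (u k)) ->
  (forall k j, u (- k) 0 j = (u k 0 j)^*) ->
  summ (fun k => mag (f k)) -> (forall k j, f (- k) 0 j = (f k 0 j)^*) ->
  summ (fun k => mag (p k)) -> summ (fun k => freq R k * mag (p k)) ->
  (forall k j, p (- k) 0 j = (p k 0 j)^*) ->
  (forall j x, fseries (fun k => A k 0 j) x + advection u j x + partial j (value p 0) x
     = value f j x) ->
  \sum_(j < 3) (k 0 j)%:~R * d 0 j = 0 ->
  ip (A k) d = ip (f k) d - rsum (fun l => tri l (u (k - l)) (u l) d).
Proof.
move=> sA rA su su1 ru sf rf sp sp1 rp eqn kd.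
pose pj j := dcoef j (fun k => p k 0 0).
have eqk j : A k 0 j + advconv u j k + pj j k - f k 0 j = 0.
  have s1 : summC (fun k => A k 0 j) by exact: summ_mag_comp.
  have s4 : summC (fun k => f k 0 j) by exact: summ_mag_comp.
  have s3 : summC (pj j) by apply: summC_dcoef; exact: summ_freqmag_comp.
  have s2' l : summC (fconv (fun k => u k 0 l) (dcoef l (fun k => u k 0 j))).
    by apply: summC_fconv; [exact: summ_mag_comp|apply: summC_dcoef; exact: summ_freqmag_comp].
  have s2 : summC (advconv u j) by exact: summC_sum.
  have r3 : real_coef (pj j) by apply: real_coef_dcoef => k'; exact: rp.
  have r2 : real_coef (advconv u j).
    move=> k'; rewrite /advconv rmorph_sum; apply: eq_bigr => l _.
    apply: real_coef_fconv.
    - by move=> k''; exact: ru.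
    - by apply: real_coef_dcoef => k''; exact: ru.
    - exact: summ_mag_comp.
    - by apply: summC_dcoef; exact: summ_freqmag_comp.
  have s12 := summCD s1 s2; have s123 := summCD s12 s3.
  apply: (fseries_eq0 (summCB s123 s4)).
    by move=> k'; rewrite rA r2 r3 rf !rmorphB !rmorphD.
  move=> x; rewrite (fseriesB _ s123 s4) (fseriesD _ s12 s3) (fseriesD _ s1 s2).
  rewrite -(advection_fseries j x ru su su1).
  have -> : fseries (pj j) x = partial j (value p 0) x.
    by rewrite -partial_fseries//; [exact: summ_mag_comp|exact: summ_freqmag_comp].
  by rewrite eqn subrr.
have -> : A k = f k - \row_j advconv u j k - \row_j pj j k.
  apply/rowP => j; rewrite !mxE; have := eqk j; move: (A k 0 j) => a e.
  by apply/eqP; rewrite -subr_eq0 -[X in _ == X]e; apply/eqP; ring.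
by rewrite !ipBl ip_advconv// ip_gradient// subr0.
Qed.

Lemma HdivE R (s : nat) (w : pfield R 3) : Hdiv s.+1%:R w ->
  [/\ w 0 = 0, (forall k j, w (- k) 0 j = (w k 0 j)^*), inw (fpow R s.+1) w &
    forall k : Z3, \sum_(j < 3) (k 0 j)%:~R * w k 0 j = 0].
Proof. by move=> [[w0 rw nw] dw]; split => //; exact: Hnorm_inw. Qed.

Lemma HdotE R m s (w : pfield R m) : Hdot m s.+1%:R w ->
  [/\ w 0 = 0, (forall k j, w (- k) 0 j = (w k 0 j)^*) & inw (fpow R s.+1) w].
Proof. by move=> [w0 rw nw]; split => //; exact: Hnorm_inw. Qed.

Lemma euler_fourier R (T : R) (f u du : R -> pfield R 3)
    (p : R -> pfield R 1) (u0 : pfield R 3) :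
  (forall t, t \in `[0, T] -> Hdot 3 2 (f t)) -> euler_solution T f u p u0 ->
  C1w T (fpow R 2) u du -> (forall t, t \in `[0, T] -> Hdiv 2 (du t)) ->
  forall t, t \in `]0, T[ -> forall (k : Z3) (d : 'rV[R[i]]_3), \sum_(j < 3) (k 0 j)%:~R * d 0 j = 0 ->
  ip (du t k) d = ip (f t k) d - rsum (fun l => tri l (u t (k - l)) (u t l) d).
Proof.
move=> hf [[hu _] _ hp _ eqn] c1 hdu t tT k d kd.
have tT' : t \in `[0, T] by apply: subset_itv_oo_cc.
have [u0' ru iu _] := HdivE (hu t tT').
have [p0 rp ip3] := HdotE (hp t tT).
have [du0 rdu idu _] := HdivE (hdu t tT').
have [f0 rf iff] := HdotE (hf t tT').
have [su _] := summ_mag_H2 u0' (proj1 (@inw_fpow R 3 2 3 _ isT iu)).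
have [sp _] := summ_mag_H2 p0 (proj1 (@inw_fpow R 1 2 3 _ isT ip3)).
have [su1 _] := summ_freqmag_H3 u0' iu; have [sp1 _] := summ_freqmag_H3 p0 ip3.
have [sdu _] := summ_mag_H2 du0 idu; have [sf _] := summ_mag_H2 f0 iff.
apply: (@fourier_momentum _ _ (u t) _ (p t)) => // j x.
have [_ /(_ j) <-] := eqn t x tT; congr (_ + _ + _).
have -> := @fseries_time_derive R 3 T (fun=> 1) (fpow R 2) u du
  (fun r => value (u r) j x) j x t _ c1 _ _ _ tT.
- by apply: eq_rsum => k'; rewrite mul1r.
- by move=> k'; rewrite normr1 mulr1 /fpow sqr_freq ler_norm.
- by move=> r /hu /HdivE[].
- by move=> r /hdu /HdivE[].
- by move=> r _; apply: eq_rsum => k'; rewrite mul1r.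
Qed.

(** The Laplacian of the time derivative needs four derivatives of the field,
    which is the regularity assumed of the Voigt solution. *)
Lemma voigt_fourier R (al T : R) (f u du : R -> pfield R 3)
    (p : R -> pfield R 1) (u0 : pfield R 3) :
  (forall t, t \in `[0, T] -> Hdot 3 2 (f t)) -> euler_voigt_solution al T f u p u0 ->
  C1w T (fpow R 4) u du -> (forall t, t \in `[0, T] -> Hdiv 4 (du t)) ->
  forall t, t \in `]0, T[ -> forall (k : Z3) (d : 'rV[R[i]]_3), \sum_(j < 3) (k 0 j)%:~R * d 0 j = 0 ->
  (1 + al ^+ 2 * freq2 R k) * ip (du t k) d
    = ip (f t k) d - rsum (fun l => tri l (u t (k - l)) (u t l) d).
Proof.
move=> hf [[[hu _] _] hp _ eqn] c1 hdu t tT k d kd.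
have tT' : t \in `[0, T] by apply: subset_itv_oo_cc.
have [u0' ru iu _] := HdivE (hu t tT').
have [p0 rp ip3] := HdotE (hp t tT).
have [du0 rdu idu _] := HdivE (hdu t tT').
have [f0 rf iff] := HdotE (hf t tT').
have l1 (w : pfield R 3) : w 0 = 0 -> inw (fpow R 4) w ->
    [/\ summ (fun k => mag (w k)), summ (fun k => freq R k * mag (w k)) &
        summ (fun k => freq2 R k * mag (w k))].
  move=> w0 iw; split.
  - exact: (proj1 (summ_mag_H2 w0 (proj1 (@inw_fpow R 3 2 4 _ isT iw)))).
  - exact: (proj1 (summ_freqmag_H3 w0 (proj1 (@inw_fpow R 3 3 4 _ isT iw)))).
  - have [|s _] := @l1_embedding_mul R 3 (freq2 R) (fpow R 4) w w0 _ iw.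
      move=> k'; rewrite !ger0_norm ?fpow_ge0 ?freq2_ge0//.
      by rewrite /fpow -sqr_freq -exprD.
    by apply: eq_summ s => k'; rewrite ger0_norm// freq2_ge0.
have [sp _] := summ_mag_H2 p0 (proj1 (@inw_fpow R 1 2 3 _ isT ip3)).
have [sp1 _] := summ_freqmag_H3 p0 ip3; have [sf _] := summ_mag_H2 f0 iff.
have [su su1 _] := l1 _ u0' iu; have [sdu _ sdu2] := l1 _ du0 idu.
pose A : pfield R 3 := fun k => (1 + al ^+ 2 * freq2 R k)%:C *: du t k.
have -> : (1 + al ^+ 2 * freq2 R k) * ip (du t k) d = ip (A k) d by rewrite /A ipZl.
have sA : summ (fun k => mag (A k)).
  apply: eq_summ (summD sdu (summZ (al ^+ 2) sdu2)) => k'.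
  rewrite /A magZ ger0_norm; first by ring.
  by rewrite addr_ge0// mulr_ge0 ?sqr_ge0 ?freq2_ge0.
apply: (@fourier_momentum _ _ (u t) _ (p t)) => //.
  move=> k' j; rewrite !mxE rdu rmorphM/=; congr (_ * _).
  by rewrite -!sqr_freq freqN; apply: complexP; rewrite ?Re_conjc ?Im_conjc/= ?oppr0.
move=> j x; have [_ /(_ j) <-] := eqn t x tT; congr (_ + _ + _).
have -> := @fseries_time_derive R 3 T (fun=> 1) (fpow R 4) u du
  (fun r => value (u r) j x) j x t _ c1 _ _ _ tT.
- have -> := @fseries_time_derive R 3 T (fun k => - freq2 R k) (fpow R 4) u du
    (fun r => laplacian (value (u r) j) x) j x t _ c1 _ _ _ tT.
  + have s1 : summC (fun k => du t k 0 j) by exact: summ_mag_comp.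
    have s2 : summC (fun k => (- freq2 R k)%:C * du t k 0 j).
      by apply: summC_comp; apply: eq_summ sdu2 => k'; rewrite normrN ger0_norm// freq2_ge0.
    rewrite -(fseriesZ _ _ s2).
    have -> : fseries (fun k => 1%:C * du t k 0 j) x = fseries (fun k => du t k 0 j) x.
      by apply: eq_rsum => k'; rewrite mul1r.
    rewrite -(fseriesB _ s1 (summCZ _ s2)); apply: eq_rsum => k'; congr (Re (_ * _)).
    by rewrite !mxE; apply: complexP; rewrite !(Re_mul, Im_mul, Re_add, Im_add, Re_opp, Im_opp)/=; ring.
  + move=> k'; rewrite normrN !ger0_norm ?fpow_ge0 ?freq2_ge0//.
    by rewrite /fpow -sqr_freq -exprD.
  + by move=> r /hu /HdivE[].
  + by move=> r /hdu /HdivE[].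
  + move=> r /hu /HdivE[w0 _ iw _]; have [sw sw1 sw2] := l1 _ w0 iw.
    have s2 : summC (fun k => (freq2 R k)%:C * u r k 0 j).
      by apply: summC_comp; apply: eq_summ sw2 => k'; rewrite ger0_norm// freq2_ge0.
    rewrite (laplacian_fseries (c := fun k => u r k 0 j)).
    * rewrite -(fseriesN _ s2); apply: eq_rsum => k'; congr (Re (_ * _)).
      by rewrite rmorphN/= mulNr.
    * exact: summ_mag_comp.
    * exact: summ_freqmag_comp.
    * apply: summ_le sw2 => k'; rewrite ger0_norm ?mulr_ge0 ?freq2_ge0 ?cmod_ge0//.
      by rewrite ler_wpM2l ?freq2_ge0// cmod_le_mag.
- move=> k'; rewrite normr1 mulr1 -sqr_freq ger0_norm ?fpow_ge0//; exact: (@fpow_mono R 2 4).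
- by move=> r /hu /HdivE[].
- by move=> r /hdu /HdivE[].
- by move=> r _; apply: eq_rsum => k'; rewrite mul1r.
Qed.

(** * Differentiation of an energy *)

(** The bilinear form of the squared norm [wnorm]. *)
Definition wip R m (om : Z3 -> R) (v w : pfield R m) : R :=
  rsum (fun k => om k ^+ 2 * ip (v k) (w k)).

Lemma wip_summ R m (om : Z3 -> R) (v w : pfield R m) :
  inw om v -> inw om w ->
  summ (fun k => om k ^+ 2 * ip (v k) (w k)) /\ `|wip om v w| <= wnorm om v * wnorm om w.
Proof.
move=> sv sw; have [s l] := cauchy_schwarz sv sw.
have b k : `|om k ^+ 2 * ip (v k) (w k)| <= `|wseq om v k * wseq om w k|.
  rewrite /wseq !normrM !(ger0_norm (mag_ge0 _)) mulrACA.
  by apply: ler_wpM2l; [exact: mulr_ge0|exact: ip_le].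
have sn := summ_norm s.
split; first exact: summ_le b sn.
by apply: le_trans l; exact: ler_norm_rsum.
Qed.

Lemma wipBl R m (om : Z3 -> R) (u v w : pfield R m) :
  inw om u -> inw om v -> inw om w -> wip om (fsub u v) w = wip om u w - wip om v w.
Proof.
move=> su sv sw; rewrite -rsumB; [|exact: (proj1 (wip_summ su sw))|exact: (proj1 (wip_summ sv sw))].
by apply: eq_rsum => k; rewrite ipBl mulrBr.
Qed.

Lemma wipC R m (om : Z3 -> R) (v w : pfield R m) :
  wip om v w = wip om w v.
Proof. by apply: eq_rsum => k; rewrite ipC. Qed.

Lemma wipBr R m (om : Z3 -> R) (u v w : pfield R m) :
  inw om u -> inw om v -> inw om w -> wip om w (fsub u v) = wip om w u - wip om w v.
Proof. by move=> su sv sw; rewrite ![wip om w _]wipC wipBl. Qed.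

Lemma wipxx R m (om : Z3 -> R) (w : pfield R m) :
  wip om w w = wnorm om w ^+ 2.
Proof. by rewrite /wnorm sqr_l2norm; apply: eq_rsum => k; rewrite ipxx -exprMn. Qed.

Lemma wnorm_ge0 R m (om : Z3 -> R) (w : pfield R m) :
  0 <= wnorm om w.
Proof. exact: l2norm_ge0. Qed.

Lemma cvg_of_le R (T : Type) (F : set_system T) (FF : Filter F)
    (f g : T -> R) (l : R) :
  (\forall t \near F, `|f t - l| <= g t) -> g t @[t --> F] --> 0 -> f t @[t --> F] --> l.
Proof.
move=> h hg; apply/subr_cvg0; apply/norm_cvg0P.
apply: (@squeeze0 R T F FF _ g 1 _ hg); near=> t.
by rewrite normr_ge0 mul1r/=; near: t.
Unshelve. all: by end_near. Qed.

Lemma wip_continuous R m (T : R) (om : Z3 -> R)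
    (v w : R -> pfield R m) :
  C0w T om v -> C0w T om w -> {within `[0, T], continuous (fun t => wip om (v t) (w t))}.
Proof.
move=> [v1 v2] [w1 w2]; apply/subspace_continuousP => t /= tT.
pose Nv r := wnorm om (fsub (v r) (v t)); pose Nw r := wnorm om (fsub (w r) (w t)).
pose V := wnorm om (v t); pose W := wnorm om (w t).
apply: (@cvg_of_le _ _ _ _ _ (fun r => Nv r * (Nw r + W) + V * Nw r)).
  near=> r; have rT : r \in `[0, T] by near: r; exact: near_within.
  have [sv _] := inwB (v1 r rT) (v1 t tT); have [sw _] := inwB (w1 r rT) (w1 t tT).
  have -> : wip om (v r) (w r) - wip om (v t) (w t) =
      wip om (fsub (v r) (v t)) (w r) + wip om (v t) (fsub (w r) (w t)).
    rewrite (wipBl (v1 r rT) (v1 t tT) (w1 r rT)) (wipBr (w1 r rT) (w1 t tT) (v1 t tT)); ring.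
  apply: le_trans (ler_normD _ _) _; apply: lerD; last exact: (proj2 (wip_summ (v1 t tT) sw)).
  apply: le_trans (proj2 (wip_summ sv (w1 r rT))) _; apply: ler_wpM2l; first exact: wnorm_ge0.
  apply: (proj2 (inwD_gen _ sw (w1 t tT))) => k.
  by rewrite -{1}[w r k](subrK (w t k)); exact: magD.
have hv : Nv r @[r --> within `[0, T] (nbhs t)] --> 0 := v2 t tT.
have hw : Nw r @[r --> within `[0, T] (nbhs t)] --> 0 := w2 t tT.
rewrite [X in _ --> X](_ : 0 = 0 * (0 + W) + V * 0); last by rewrite mul0r mulr0 addr0.
apply: cvgD; last by apply: cvgM hw; exact: cvg_cst.
by apply: cvgM hv _; apply: cvgD hw _; exact: cvg_cst.
Unshelve. all: by end_near. Qed.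

(** If q is the difference quotient, that of the squared norm is
    2 <q, w> + h ||q||^2. *)
Lemma energy_derive R m (T : R) (om : Z3 -> R)
    (w dw : R -> pfield R m) (t : R) : C1w T om w dw -> t \in `]0, T[ ->
  is_derive t 1 (fun r => wnorm om (w r) ^+ 2) (2 * wip om (dw t) (w t)).
Proof.
move=> [[w1 _] [dw1 _] hd] tT.
have tT' : t \in `[0, T] by apply: subset_itv_oo_cc.
have nT := near_itv_shift tT.
have hd' := cvg_within_drop _ nT (hd t tT').
pose N h := wnorm om (fsub (diffquot w t h) (dw t)).
have hN : N h @[h --> (0 : R)^'] --> 0 by exact: hd'.
pose W := wnorm om (w t); pose D := wnorm om (dw t).
suff cv : h^-1 *: (wnorm om (w (h *: 1 + t)) ^+ 2 - wnorm om (w t) ^+ 2)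
    @[h --> (0 : R)^'] --> 2 * wip om (dw t) (w t).
  by split; [apply/cvg_ex; eexists; exact: cv|exact: (cvg_lim _ cv)].
apply: (@cvg_of_le _ _ _ _ _ (fun h => 2 * (N h * W) + `|h| * (N h + D) ^+ 2)).
  near=> h; have hT : t + h \in `[0, T] by near: h.
  have h0 : h != 0 by near: h; exact: nbhs_dnbhs_neq.
  have sq := inw_diffquot w1 tT' hT.
  pose q := diffquot w t h.
  have [sn _] := inwB sq (dw1 t tT').
  have -> : h^-1 *: (wnorm om (w (h *: 1 + t)) ^+ 2 - wnorm om (w t) ^+ 2)
      = 2 * wip om q (w t) + h * wnorm om q ^+ 2.
    have -> : h *: 1 + t = t + h by rewrite /GRing.scale/= mulr1 addrC.
    rewrite /GRing.scale/= -!wipxx.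
    have [s1 _] := wip_summ (w1 _ hT) (w1 _ hT); have [s2 _] := wip_summ (w1 _ tT') (w1 _ tT').
    have [s3 _] := wip_summ sq (w1 _ tT'); have [s4 _] := wip_summ sq sq.
    rewrite -rsumB// -!rsumZ//; last exact: summB.
    rewrite -rsumD; [|exact: summZ..]; apply: eq_rsum => k.
    have -> : w (t + h) k = h%:C *: q k + w t k.
      by rewrite /q /diffquot scalerA -rmorphM/= mulfV// scale1r subrK.
    move: (q k) (w t k) => Q c.
    rewrite !ipDl !ipZl ![ip _ (_ *: _ + _)]ipC !ipDl !ipZl [ip c Q]ipC.
    by field.
  have -> : 2 * wip om q (w t) + h * wnorm om q ^+ 2 - 2 * wip om (dw t) (w t) =
     2 * wip om (fsub q (dw t)) (w t) + h * wnorm om q ^+ 2.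
    by rewrite (wipBl sq (dw1 t tT') (w1 t tT')); ring.
  apply: le_trans (ler_normD _ _) _; apply: lerD; rewrite normrM.
    by rewrite ger0_norm// ler_wpM2l//; exact: (proj2 (wip_summ sn (w1 t tT'))).
  rewrite (ger0_norm (exprn_ge0 2 (wnorm_ge0 om q))).
  apply: ler_wpM2l => //; rewrite ler_pXn2r// ?nnegrE ?addr_ge0 ?wnorm_ge0//.
  apply: (proj2 (inwD_gen _ sn (dw1 t tT'))) => k.
  by rewrite -{1}[q k](subrK (dw t k)); exact: magD.
have h0 : `|h| @[h --> (0 : R)^'] --> (0 : R).
  apply/cvgr0Pnorm_lt => e e0; near=> h; rewrite normr_id; near: h; exact: dnbhs0_lt.
rewrite [X in _ --> X](_ : 0 = 2 * (0 * W) + 0 * ((0 + D) * (0 + D))); last first.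
  by rewrite !mul0r mulr0 addr0.
under eq_fun do rewrite expr2.
have hND : N h + D @[h --> (0 : R)^'] --> 0 + D by apply: cvgD => //; exact: cvg_cst.
apply: cvgD; first by apply: cvgM; [exact: cvg_cst|apply: cvgM => //; exact: cvg_cst].
by apply: cvgM => //; exact: cvgM.
Unshelve. all: by end_near. Qed.

(** * Continuation and Gronwall arguments *)

(** At the infimum of the times where the bound fails it holds by the
    assumption on earlier times, and by continuity a little later: a
    contradiction. *)
Lemma barrier R (T eta : R) (E : R -> R) :
  {within `[0, T], continuous E} -> E 0 < eta ->
  (forall t, t \in `]0, T] -> (forall s, s \in `[0, t[ -> E s < eta) -> E t < eta) ->
  forall t, t \in `[0, T] -> E t < eta.
Proof.
move=> cE E0 h t1 t1T; rewrite ltNge; apply/negP => Et1.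
pose S := [set s | s \in `[0, T] /\ eta <= E s].
have S1 : S t1 by [].
have lS : has_lbound S by exists 0 => s [] /=; rewrite in_itv/= => /andP[].
have iS : has_inf S by split => //; exists t1.
pose ts := inf S.
have ts0 : 0 <= ts by apply: lb_le_inf => [|s []]; [exists t1|rewrite in_itv/= => /andP[]].
have ts1 : ts <= t1 by apply: ge_inf.
have tsT : ts \in `[0, T].
  by move: t1T; rewrite !in_itv/= ts0 => /andP[_ /(le_trans ts1)].
have below s : s \in `[0, ts[ -> E s < eta.
  rewrite in_itv/= => /andP[s0 sts]; rewrite ltNge; apply/negP => Es.
  have : ts <= s.
    apply: ge_inf => //; split => //; rewrite in_itv/= s0/=.
    by move: tsT; rewrite in_itv/= => /andP[_]; apply: le_trans; exact: ltW.
  by rewrite leNgt sts.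
have Ets : E ts < eta.
  have [e|tsn] := eqVneq ts 0; first by rewrite e.
  apply: h below; rewrite in_itv/= lt_neqAle eq_sym tsn ts0/=.
  by move: tsT; rewrite in_itv/= => /andP[].
move/subspace_continuousP : cE => /(_ ts tsT) c.
have : \forall s \near within `[0, T] (nbhs ts), E s < eta.
  exact: (cvgr_lt _ c).
rewrite near_withinE => /nbhs_ballP[d /= d0 hd].
have [s [sT Es] std] := inf_adherent d0 iS.
have : E s < eta.
  apply: hd => //; rewrite /ball/= ler0_norm ?opprB ?subr_le0; first by rewrite ltrBlDr addrC.
  by apply: ge_inf.
by rewrite ltNge Es.
Qed.

Local Open Scope ereal_scope.

(** Multiplication by exp(- C s) and integration.  The forcing takes values in
    the extended reals because the H^3 norm of the force may be infinite at some
    times. *)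
Lemma gronwall_integral R (T C kappa c t : R) (E G : R -> R) (h : R -> \bar R) :
  (0 <= C)%R -> (0 <= kappa)%R -> (0 < c)%R -> t \in `]0%R, T] ->
  {within `[0%R, T], continuous E} -> {within `[0%R, T], continuous G} ->
  (forall s, s \in `]0%R, T[ -> is_derive s (1%R : R) E (G s)) ->
  (forall s, (0 <= E s)%R) ->
  (forall s, 0 <= h s) -> lebesgue_measure.-integrable `[0%R, T] h ->
  (forall s, s \in `]0%R, t[ -> (G s)%:E <= (C * E s + kappa)%:E + c%:E * h s) ->
  (E t)%:E <= (expR (C * T))%:E *
    ((E 0%R)%:E + (kappa * T)%:E + c%:E * \int[lebesgue_measure]_(s in `[0%R, T]) h s).
Proof.
move=> C0 k0 cgt tT cE cG dE E0 h0 ih hG.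
pose mu := @lebesgue_measure R; have c0 := ltW cgt.
move: (tT); rewrite in_itv/= => /andP[t0 tleT].
have sub : `[0%R, t] `<=` `[0%R, T].
  by move=> s /=; rewrite !in_itv/= => /andP[-> /le_trans ->].
have subo : `]0%R, t[ `<=` `[0%R, T].
  by move=> s /=; rewrite !in_itv/= => /andP[/ltW -> /ltW/le_trans ->].
pose F s := (expR (- C * s) * E s)%R.
pose g s := (expR (- C * s) * (G s - C * E s))%R.
have ce : continuous (fun s : R => expR (- C * s))%R.
  move=> s; apply: (@continuous_comp _ _ _ (fun s : R => - C * s)%R expR).
    by apply: cvgM; [exact: cvg_cst|exact: cvg_id].
  exact: continuous_expR.
have cEt : {within `[0%R, t], continuous E} by exact: continuous_subspaceW cE.
have cGt : {within `[0%R, t], continuous G} by exact: continuous_subspaceW cG.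
have cet : {within `[0%R, t], continuous (fun s : R => expR (- C * s)%R)}.
  exact: continuous_subspaceT.
have cF : {within `[0%R, t], continuous F}.
  by move=> s; apply: cvgM; [exact: cet|exact: cEt].
have cg : {within `[0%R, t], continuous g}.
  move=> s; apply: cvgM; first exact: cet.
  by apply: cvgB; [exact: cGt|apply: cvgM; [exact: cvg_cst|exact: cEt]].
have dF s : s \in `]0%R, t[ -> is_derive s (1%R : R) F (g s).
  move=> st; have sT : s \in `]0%R, T[.
    by move: st; rewrite !in_itv/= => /andP[-> /lt_le_trans ->].
  have de : is_derive s (1%R : R) (fun s : R => expR (- C * s)%R) (expR (- C * s) * - C)%R.
    have dl : is_derive s (1%R : R) (fun s : R => - C * s)%R (- C)%R.
      have -> : (fun s : R => - C * s)%R = (- C)%R \*: id by [].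
      by apply: is_derive_eq; rewrite /GRing.scale/= mulr1.
    by have := @is_derive1_comp R expR (fun s : R => - C * s)%R s _ _ (is_derive_expR _) dl.
  have := is_deriveM de (dE s sT) => H; apply: is_derive_eq H _.
  by rewrite /g /GRing.scale/=; ring.
have ftc : \int[mu]_(s in `[0%R, t]) (g s)%:E = (F t)%:E - (F 0%R)%:E.
  apply: continuous_FTC2 => //.
  - have [_ cF0 cFt] := (continuous_within_itvP _ t0).1 cF.
    by split => // s st; have [] := dF s st.
  - by move=> s st; rewrite derive1E; have [_ ->] := dF s st.
have ig : mu.-integrable `[0%R, t] (EFin \o g).
  by apply: continuous_compact_integrable => //; exact: segment_compact.
have igo : mu.-integrable `]0%R, t[ (EFin \o g).
  by apply: integrableS ig => //; exact: subset_itv_oo_cc.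
have iho : mu.-integrable `]0%R, t[ h by apply: integrableS ih.
have mh := measurable_int _ iho.
have key : \int[mu]_(s in `]0%R, t[) (g s)%:E <=
    \int[mu]_(s in `]0%R, t[) (kappa%:E + c%:E * h s).
  apply: le_integral => //.
    apply: integrableD => //; last exact: integrableZl.
    apply: (@integrableS _ _ _ mu `[0%R, t]) => //; first exact: subset_itv_oo_cc.
    apply: (@continuous_compact_integrable _ (cst kappa)); first exact: segment_compact.
    by apply: continuous_subspaceT => x; exact: cvg_cst.
  move=> s; rewrite inE/= => st; rewrite /g.
  have e1 : (expR (- C * s) <= 1)%R.
    rewrite -expR0 ler_expR mulNr oppr_le0 mulr_ge0//.
    by move: st; rewrite in_itv/= => /andP[/ltW].
  have e0 : (0 <= expR (- C * s))%R by exact: expR_ge0.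
  have := hG s st; have := h0 s; case: (h s) => [x| |]//.
    rewrite !lee_fin => x0 le; move: (expR _) e0 e1 => e e0 e1.
    have cx := mulr_ge0 c0 x0.
    apply: (@le_trans _ _ (e * (kappa + c * x))%R); first by rewrite ler_wpM2l//; lra.
    by rewrite ler_piMl//; lra.
  by move=> _ _; rewrite gt0_muley ?lte_fin// addey// leey.
have I0 : 0 <= \int[mu]_(s in `[0%R, T]) h s by exact: integral_ge0.
have Ifin : \int[mu]_(s in `[0%R, T]) h s \is a fin_num by exact: integrable_fin_num.
have up : \int[mu]_(s in `]0%R, t[) (kappa%:E + c%:E * h s) <=
    (kappa * T)%:E + c%:E * \int[mu]_(s in `[0%R, T]) h s.
  rewrite ge0_integralD//; last 2 first.
    by move=> s _; rewrite mule_ge0.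
    exact: measurable_funeM.
  apply: leeD.
    rewrite integral_cst//= lebesgue_measure_itv/= lte_fin t0 -EFinB -EFinM lee_fin subr0.
    by rewrite ler_wpM2l.
  rewrite ge0_integralZl_EFin//; apply: lee_wpmul2l; first by rewrite lee_fin.
  apply: ge0_subset_integral => //; exact: measurable_int ih.
have := le_trans key up.
rewrite -(@integral_itv_bndoo _ 0%R t _ true false); last exact: measurable_int igo.
rewrite ftc -(fineK Ifin) -EFinB -!EFinM -!EFinD. rewrite !lee_fin /F mulr0 expR0 mul1r.
have i0 : (0 <= fine (\int[mu]_(s in `[0%R, T]) h s))%R by rewrite fine_ge0.
move: (fine _) i0 => I i0 le.
have ct : (C * t <= C * T)%R by rewrite ler_wpM2l.
have -> : E t = (expR (C * t) * (expR (- C * t) * E t))%R.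
  by rewrite mulrA -expRD mulNr subrr expR0 mul1r.
have rhs0 : (0 <= E 0%R + kappa * T + c * I)%R.
  have T0 : (0 <= T)%R by exact: le_trans (ltW t0) tleT.
  by rewrite !addr_ge0// mulr_ge0.
apply: (@le_trans _ _ (expR (C * t) * (E 0%R + kappa * T + c * I))%R).
  by apply: ler_wpM2l; [exact: expR_ge0|lra].
by apply: ler_wpM2r => //; rewrite ler_expR.
Qed.

Local Close Scope ereal_scope.

(** * The energy balance of a truncated difference *)

Local Notation lat2 := (Z3 * Z3)%type.

Lemma tri_row_summ R (a : pfield R 3) (k : Z3) (d : 'rV[R[i]]_3) :
  summ (fun k => mag (a k)) -> summ (fun k => freq R k * mag (a k)) ->
  summ (fun l => tri l (a (k - l)) (a l) d).
Proof.
move=> s0 s1; have [s _] := rsum_prod s0 s1.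
pose e (p : lat2) : lat2 := (p.1 - p.2, p.2).
have be : bijective e.
  by exists (fun p => (p.1 + p.2, p.2)) => -[k' l]; rewrite /e /= ?subrK ?addrK.
have [row _] := summ_pair_row (summ_reindex be s).
apply: summ_le (summ_norm (summZ (mag d) (row k))) => l.
apply: le_trans (tri_le _ _ _ _) _; rewrite /e /= ger0_norm ?mulr_ge0 ?mag_ge0 ?freq_ge0//.
by rewrite le_eqVlt; apply/orP; left; apply/eqP; ring.
Qed.

(** In [diag_term] the derivative falls on w at the top order, but the term is
    antisymmetric in (k, l).  In the others it is traded for a difference of
    weights, for the truncation of u, or for a difference of cutoffs. *)
Section EnergyTerms.
Variables (R : realType) (g phi : Z3 -> R) (U u w : pfield R 3).

Definition diag_term (p : lat2) : R :=
  g p.1 * g p.2 * tri p.2 (U (p.1 - p.2)) (w p.2) (w p.1).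
Definition weight_comm_term (p : lat2) : R :=
  g p.1 * (g p.1 - g p.2) * tri p.2 (U (p.1 - p.2)) (w p.2) (w p.1).
Definition stretch_term (p : lat2) : R :=
  g p.1 ^+ 2 * phi p.2 * tri p.2 (fsub U u (p.1 - p.2)) (u p.2) (w p.1).
Definition cutoff_comm_term (p : lat2) : R :=
  g p.1 ^+ 2 * (phi p.2 - phi p.1) * tri p.2 (u (p.1 - p.2)) (u p.2) (w p.1).

End EnergyTerms.

Lemma rsum_diag_term R (g : Z3 -> R) (U w : pfield R 3) :
  (forall k j, U (- k) 0 j = (U k 0 j)^*) ->
  (forall k : Z3, \sum_(j < 3) (k 0 j)%:~R * U k 0 j = 0) ->
  summ (diag_term g U w) -> rsum (diag_term g U w) = 0.
Proof.
move=> rU dU s; pose e (p : lat2) : lat2 := (p.2, p.1).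
have be : bijective e by exists e => -[].
have := rsum_reindex (diag_term g U w) be.
rewrite (@eq_rsum _ _ _ (fun p => - diag_term g U w p)); last first.
  by move=> [k l]; rewrite /diag_term /e/= (tri_antisym _ _ _ _ rU dU); ring.
by rewrite rsumN//; lra.
Qed.

(** Only the two differences U - u and phi(l) - phi(k) are small; the weight is
    split as g(k)^2 = g(k) g(l) + g(k) (g(k) - g(l)) to isolate the antisymmetric
    part. *)
Lemma advection_split R (g phi : Z3 -> R) (U u : pfield R 3) (p : lat2) :
  let w := fsub U (fmul phi u) in
  g p.1 ^+ 2 * (tri p.2 (U (p.1 - p.2)) (U p.2) (w p.1)
    - phi p.1 * tri p.2 (u (p.1 - p.2)) (u p.2) (w p.1)) =
  (diag_term g U w p + weight_comm_term g U w p)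
   + (stretch_term g phi U u w p + cutoff_comm_term g phi u w p).
Proof.
move=> w; rewrite /diag_term /weight_comm_term /stretch_term /cutoff_comm_term.
case: p => k l /=; move: (w k) => d.
have -> : tri l (U (k - l)) (w l) d
    = tri l (U (k - l)) (U l) d - phi l * tri l (U (k - l)) (u l) d.
  by rewrite /w /fsub /fmul triBr triZr.
have -> : tri l (fsub U u (k - l)) (u l) d
    = tri l (U (k - l)) (u l) d - tri l (u (k - l)) (u l) d.
  by rewrite /fsub triBl.
ring.
Qed.

Lemma rsum_scale_diff R I (a b : I -> R) (x y : R) :
  summ a -> summ b -> rsum (fun i => x * (a i - y * b i)) = x * (rsum a - y * rsum b).
Proof.
move=> sa sb; have sc := summZ y sb; rewrite rsumZ; last exact: summB sa sc.
by rewrite rsumB// rsumZ.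
Qed.

(** The antisymmetric part is absent from the bound.  The force and the time
    derivative of u appear because phi u satisfies the Voigt equation only up to
    (1 - phi) f and alpha^2 |k|^2 phi du. *)
Lemma energy_rate R (g phi om : Z3 -> R) (al : R)
    (U u dU du f : pfield R 3) :
  let w := fsub U (fmul phi u) in let dw := fsub dU (fmul phi du) in
  (forall k, om k ^+ 2 = g k ^+ 2 * (1 + al ^+ 2 * freq2 R k)) ->
  (forall k j, U (- k) 0 j = (U k 0 j)^*) ->
  (forall k : Z3, \sum_(j < 3) (k 0 j)%:~R * U k 0 j = 0) ->
  (forall k : Z3, \sum_(j < 3) (k 0 j)%:~R * u k 0 j = 0) ->
  summ (fun k => mag (U k)) -> summ (fun k => freq R k * mag (U k)) ->
  summ (fun k => mag (u k)) -> summ (fun k => freq R k * mag (u k)) ->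
  (forall (k : Z3) (d : 'rV[R[i]]_3), \sum_(j < 3) (k 0 j)%:~R * d 0 j = 0 ->
    (1 + al ^+ 2 * freq2 R k) * ip (dU k) d
      = ip (f k) d - rsum (fun l => tri l (U (k - l)) (U l) d)) ->
  (forall (k : Z3) (d : 'rV[R[i]]_3), \sum_(j < 3) (k 0 j)%:~R * d 0 j = 0 ->
    ip (du k) d = ip (f k) d - rsum (fun l => tri l (u (k - l)) (u l) d)) ->
  summ (diag_term g U w) -> summ (weight_comm_term g U w) ->
  summ (stretch_term g phi U u w) -> summ (cutoff_comm_term g phi u w) ->
  summ (fun k => g k ^+ 2 * (1 - phi k) * ip (f k) (w k)) ->
  summ (fun k => g k ^+ 2 * freq2 R k * phi k * ip (du k) (w k)) ->
  `|wip om dw w| <= rsum (fun p => `|weight_comm_term g U w p|)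
    + rsum (fun p => `|stretch_term g phi U u w p|)
    + rsum (fun p => `|cutoff_comm_term g phi u w p|)
    + `|rsum (fun k => g k ^+ 2 * (1 - phi k) * ip (f k) (w k))|
    + al ^+ 2 * `|rsum (fun k => g k ^+ 2 * freq2 R k * phi k * ip (du k) (w k))|.
Proof.
move=> w dw omE rU dvU dvu sU sU1 su su1 eqU equ sA s1 s2 s3 sF sV.
have dvw (k : Z3) : \sum_(j < 3) (k 0 j)%:~R * w k 0 j = 0.
  transitivity (\sum_(j < 3) (k 0 j)%:~R * U k 0 j
     - (phi k)%:C * \sum_(j < 3) (k 0 j)%:~R * u k 0 j).
    rewrite mulr_sumr -sumrB; apply: eq_bigr => j _.
    by rewrite /w /fsub /fmul !mxE; ring.
  by rewrite dvU dvu mulr0 subrr.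
pose D (p : lat2) := (diag_term g U w p + weight_comm_term g U w p)
   + (stretch_term g phi U u w p + cutoff_comm_term g phi u w p).
have sD : summ D by apply: summD; exact: summD.
pose F k := g k ^+ 2 * (1 - phi k) * ip (f k) (w k).
pose V k := g k ^+ 2 * freq2 R k * phi k * ip (du k) (w k).
have E k : om k ^+ 2 * ip (dw k) (w k) = (F k - rsum (fun l => D (k, l))) - al ^+ 2 * V k.
  pose tU (l : Z3) := tri l (U (k - l)) (U l) (w k).
  pose tu (l : Z3) := tri l (u (k - l)) (u l) (w k).
  have rowU : summ tU := tri_row_summ k (w k) sU sU1.
  have rowu : summ tu := tri_row_summ k (w k) su su1.
  have -> : rsum (fun l => D (k, l)) = g k ^+ 2 * (rsum tU - phi k * rsum tu).
    rewrite -(rsum_scale_diff _ _ rowU rowu).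
    by apply: eq_rsum => l; rewrite /D -(advection_split g phi U u (k, l)).
  rewrite omE /dw /fsub /fmul ipBl ipZl.
  have := eqU k (w k) (dvw k); have := equ k (w k) (dvw k); rewrite /F /V -/tU -/tu.
  move: (rsum tu) (rsum tU) (ip (du k) _) (ip (dU k) _) (ip (f k) _) => Y X du' dU' f' e1 e2.
  have -> : g k ^+ 2 * (1 + al ^+ 2 * freq2 R k) * (dU' - phi k * du')
    = g k ^+ 2 * ((1 + al ^+ 2 * freq2 R k) * dU' - phi k * du'
        - al ^+ 2 * freq2 R k * phi k * du') by ring.
  by rewrite e2 {1}e1; ring.
have [sDr rD] := rsum_pair sD.
have -> : wip om dw w = rsum F - rsum D - al ^+ 2 * rsum V.
  rewrite /wip (eq_rsum E) rsumB; [|exact: summB|exact: summZ].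
  by rewrite rsumB// rsumZ// -rD.
have rDle : `|rsum D| <= rsum (fun p => `|weight_comm_term g U w p|)
    + rsum (fun p => `|stretch_term g phi U u w p|)
    + rsum (fun p => `|cutoff_comm_term g phi u w p|).
  rewrite /D rsumD; [|exact: summD|exact: summD].
  rewrite rsumD// (rsum_diag_term rU dvU sA) add0r rsumD//.
  rewrite -addrA; apply: le_trans (ler_normD _ _) _; apply: lerD.
    by apply: ler_norm_rsum => //; exact: summ_norm.
  apply: le_trans (ler_normD _ _) _; apply: lerD; apply: ler_norm_rsum => //; exact: summ_norm.
have -> : al ^+ 2 * `|rsum V| = `|al ^+ 2 * rsum V| by rewrite normrM ger0_norm// sqr_ge0.
apply: le_trans (ler_normB _ _) _; apply: lerD => //.
by apply: le_trans (ler_normB _ _) _; rewrite addrC; apply: lerD.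
Qed.

(** * Frequency cutoffs *)

Lemma bound_by R I (t c : I -> R) (B : R) :
  (forall p, `|t p| <= c p) -> summ c -> rsum c <= B ->
  summ t /\ rsum (fun p => `|t p|) <= B.
Proof.
move=> h sc cB; have st := summ_le h sc; split => //; apply: le_trans cB.
by apply: ler_rsum => //; exact: summ_norm.
Qed.

Lemma ip_cs R m (c om1 om2 : Z3 -> R) (v w : pfield R m) :
  (forall k, `|c k| <= `|om1 k * om2 k|) -> inw om1 v -> inw om2 w ->
  summ (fun k => c k * ip (v k) (w k)) /\
  `|rsum (fun k => c k * ip (v k) (w k))| <= wnorm om1 v * wnorm om2 w.
Proof.
move=> h sv sw; have [s l] := cauchy_schwarz sv sw.
have b k : `|c k * ip (v k) (w k)| <= `|wseq om1 v k * wseq om2 w k|.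
  rewrite /wseq mulrACA normrM [leRHS]normrM.
  by rewrite [`|mag _ * _|]ger0_norm ?mulr_ge0 ?mag_ge0// ler_pM// ip_le.
have sn := summ_norm s; split; first exact: summ_le b sn.
by apply: le_trans l; exact: ler_norm_rsum.
Qed.

Lemma wseq_ge0 R m (om : Z3 -> R) (w : pfield R m) k :
  (forall k, 0 <= om k) -> 0 <= wseq om w k.
Proof. by move=> h; rewrite mulr_ge0// mag_ge0. Qed.

(** The weight of the L^2 norm. *)
Definition one_weight R : Z3 -> R := fun=> 1.

Lemma inw_one R m s (w : pfield R m) : w 0 = 0 ->
  inw (fpow R s) w -> inw (@one_weight R) w /\ wnorm (@one_weight R) w <= wnorm (fpow R s) w.
Proof.
move=> w0 h; apply: l2_le h => k; rewrite /wseq mul1r.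
have [->|k0] := eqVneq k 0; first by rewrite w0 mag0 mulr0.
rewrite normrM ler_peMl// ger0_norm ?fpow_ge0// /fpow exprn_ege1//.
exact: freq_ge1.
Qed.

(** Piecewise linear in |k|, equal to 1 up to 2 N and to 0 from 4 N on.  The
    range between N and 2 N, where it is still 1, separates its transition from the
    frequencies that count as low in [tail]. *)
Definition cutoff R (N : R) (k : Z3) : R :=
  Num.max 0 (Num.min 1 (2 - freq R k / (2 * N))).

Definition tail R (N : R) (k : Z3) : R :=
  if freq R k <= N then 0 else 1.

Section Cutoff.
Variables (R : realType) (N : R).
Hypothesis N0 : 0 < N.

Lemma cutoff_ge0 k : 0 <= cutoff N k.
Proof. by rewrite /cutoff le_max lexx. Qed.

Lemma cutoff_le1 k : cutoff N k <= 1.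
Proof. by rewrite /cutoff ge_max ler01/= ge_min lexx. Qed.

Lemma cutoff1 k : freq R k <= 2 * N -> cutoff N k = 1.
Proof.
move=> h; have : freq R k / (2 * N) <= 1 by rewrite ler_pdivrMr ?mul1r// mulr_gt0.
by move=> h1; rewrite /cutoff min_l; [rewrite max_r|lra].
Qed.

Lemma cutoff0 k : 4 * N <= freq R k -> cutoff N k = 0.
Proof.
move=> h; have : 2 <= freq R k / (2 * N) by rewrite ler_pdivlMr ?mulr_gt0//; lra.
by move=> h1; rewrite /cutoff max_l// ge_min; apply/orP; right; lra.
Qed.

Lemma cutoff_freq k : cutoff N k * freq R k <= 4 * N.
Proof.
have [h|h] := leP (4 * N) (freq R k); first by rewrite cutoff0// mul0r mulr_ge0// ltW.
by apply: le_trans (ltW h); rewrite ler_piMl ?freq_ge0// cutoff_le1.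
Qed.

Lemma norm_cutoffB_le1 k l : `|cutoff N l - cutoff N k| <= 1.
Proof.
have := cutoff_ge0 k; have := cutoff_ge0 l; have := cutoff_le1 k; have := cutoff_le1 l.
by rewrite ler_norml => *; apply/andP; split; lra.
Qed.

Lemma freq_dist (k l : Z3) : `|freq R l - freq R k| <= freq R (k - l).
Proof.
have h1 := freq_le_add R k l; have h2 := freq_le_add R l k.
by rewrite freq_subC in h2; rewrite ler_norml; apply/andP; split; lra.
Qed.

Lemma cutoff_lip k l : `|cutoff N l - cutoff N k| <= freq R (k - l) / (2 * N).
Proof.
have clip (x y : R) : `|Num.max 0 (Num.min 1 x) - Num.max 0 (Num.min 1 y)| <= `|x - y|.
  have h1 := ler_norm (x - y); have := ler_norm (- (x - y)); rewrite normrN => h2.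
  have n0 := normr_ge0 (x - y).
  rewrite ler_norml; have [a1|a1] := leP 1 x; have [b1|b1] := leP 1 y.
  - by apply/andP; split; lra.
  - by rewrite (max_r ler01); have [b2|b2] := leP 0 y; apply/andP; split; lra.
  - by rewrite (max_r ler01); have [a2|a2] := leP 0 x; apply/andP; split; lra.
  - by have [a2|a2] := leP 0 x; have [b2|b2] := leP 0 y; apply/andP; split; lra.
apply: le_trans (clip _ _) _.
have -> : 2 - freq R l / (2 * N) - (2 - freq R k / (2 * N)) = (freq R k - freq R l) / (2 * N).
  by ring.
have n2 : 0 < (2 * N)^-1 by rewrite invr_gt0 mulr_gt0.
by rewrite normrM (gtr0_norm n2) ler_pM2r// distrC freq_dist.
Qed.

(** The Lipschitz constant of the cutoff is 1 / (2 N), against |l| <= 6 N; for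
    larger |l| either both values vanish or |k - l| is comparable with |l|. *)
Lemma cutoff_comm k l : `|cutoff N l - cutoff N k| * freq R l <= 3 * freq R (k - l).
Proof.
have m0 := freq_ge0 R (k - l).
have [h|h] := leP (freq R l) (6 * N).
  apply: (@le_trans _ _ (freq R (k - l) / (2 * N) * (6 * N))).
    by apply: ler_pM => //; [exact: freq_ge0|exact: cutoff_lip].
  by rewrite le_eqVlt; apply/orP; left; apply/eqP; field; rewrite gt_eqF.
have [k4|k4] := leP (4 * N) (freq R k).
  have l4 : 4 * N <= freq R l by have := N0; lra.
  by rewrite (cutoff0 k4) (cutoff0 l4) subrr normr0 mul0r mulr_ge0.
apply: (@le_trans _ _ (freq R l)).
  by rewrite ler_piMl ?freq_ge0// norm_cutoffB_le1.
have := freq_le_add R l k; rewrite freq_subC; lra.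
Qed.

Lemma tail_ge0 k : 0 <= tail N k.
Proof. by rewrite /tail; case: ifP. Qed.

Lemma tail_le1 k : tail N k <= 1.
Proof. by rewrite /tail; case: ifP. Qed.

(** If |k - l| and |l| are both at most N then k and l lie where the cutoff is
    constant. *)
Lemma cutoff_comm_tail k l :
  `|cutoff N l - cutoff N k| <= `|cutoff N l - cutoff N k| * (tail N (k - l) + tail N l).
Proof.
rewrite /tail; have [h1|h1] := leP (freq R (k - l)) N; have [h2|h2] := leP (freq R l) N.
- have l2 : freq R l <= 2 * N by have := N0; lra.
  have k2 : freq R k <= 2 * N by have := freq_le_add R k l; lra.
  by rewrite (cutoff1 k2) (cutoff1 l2) subrr normr0 mul0r.
- by rewrite add0r mulr1.
- by rewrite addr0 mulr1.
- by rewrite mulrDr mulr1 lerDl.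
Qed.

Lemma onem_cutoff_tail k : 0 <= 1 - cutoff N k <= tail N k.
Proof.
rewrite subr_ge0 cutoff_le1/= /tail; have [h|h] := leP (freq R k) N.
  have k2 : freq R k <= 2 * N by have := N0; lra.
  by rewrite (cutoff1 k2) subrr.
by have := cutoff_ge0 k; lra.
Qed.

End Cutoff.

Lemma inw_tail R m s (N : R) (w : pfield R m) : inw (fpow R s) w ->
  inw (fpow R s) (fmul (tail N) w) /\ wnorm (fpow R s) (fmul (tail N) w) <= wnorm (fpow R s) w.
Proof.
move=> iw; rewrite -[X in _ /\ _ <= X]mul1r; apply: inw_fmul iw => // k.
by rewrite mul1r normrM ler_piMr// ger0_norm ?tail_ge0 ?tail_le1.
Qed.

Lemma inw_cutoff R m s (N : R) (w : pfield R m) : 0 < N ->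
  inw (fpow R s) w -> inw (fpow R s.+1) (fmul (cutoff N) w).
Proof.
move=> N0 iw; apply: (proj1 (inw_fmul (C := 4 * N) _ _ iw)); first by rewrite mulr_ge0// ltW.
move=> k; have -> : fpow R s.+1 k * cutoff N k = cutoff N k * freq R k * fpow R s k.
  by rewrite /fpow exprS; ring.
rewrite normrM ler_wpM2r// ger0_norm; first exact: cutoff_freq.
by rewrite mulr_ge0 ?freq_ge0 ?cutoff_ge0.
Qed.

Lemma cube_add_le R (k m l : R) : 0 <= k -> 0 <= m -> 0 <= l ->
  k <= m + l -> k ^+ 3 <= 4 * (m ^+ 3 + l ^+ 3).
Proof.
move=> k0 m0 l0 h; apply: (@le_trans _ _ ((m + l) ^+ 3)).
  by rewrite ler_pXn2r ?nnegrE ?addr_ge0.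
have : 0 <= (m + l) * (m - l) ^+ 2 by rewrite mulr_ge0 ?addr_ge0 ?sqr_ge0.
have -> : 4 * (m ^+ 3 + l ^+ 3) = (m + l) ^+ 3 + 3 * ((m + l) * (m - l) ^+ 2) by ring.
by move=> ?; rewrite lerDl mulr_ge0.
Qed.

(** The commutator of |k|^3 loses one derivative on one factor only. *)
Lemma cube_diff_le R (k m l : R) : 0 <= k -> 0 <= m -> 0 <= l ->
  k <= m + l -> `|k - l| <= m -> `|k ^+ 3 - l ^+ 3| <= 5 * (m ^+ 3 + m * l ^+ 2).
Proof.
move=> k0 m0 l0 h1 h2.
have -> : k ^+ 3 - l ^+ 3 = (k - l) * (k ^+ 2 + k * l + l ^+ 2) by ring.
have q0 : 0 <= k ^+ 2 + k * l + l ^+ 2 by rewrite !addr_ge0 ?sqr_ge0 ?mulr_ge0.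
rewrite normrM (ger0_norm q0).
have -> : 5 * (m ^+ 3 + m * l ^+ 2) = m * (5 * (m ^+ 2 + l ^+ 2)) by ring.
apply: ler_pM => //.
have h3 : k ^+ 2 <= (m + l) ^+ 2 by rewrite ler_pXn2r ?nnegrE ?addr_ge0.
have h4 : k * l <= (m + l) * l by rewrite ler_wpM2r.
have := sqr_ge0 (m - l); have := sqr_ge0 m; have := sqr_ge0 l.
move: h3 h4; rewrite sqrrD sqrrB mulrDl !expr2 !mulr2n => *; lra.
Qed.

(** * Energy estimates at a fixed time *)

(** The Voigt equation balances the energy with this weight, not the one with
    weight [g]. *)
Definition voigt_weight R (g : Z3 -> R) (al : R) : Z3 -> R :=
  fun k => g k * Num.sqrt (1 + al ^+ 2 * freq2 R k).

Lemma voigt_factor_ge1 R (al : R) k : 1 <= 1 + al ^+ 2 * freq2 R k.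
Proof. by rewrite lerDl mulr_ge0 ?sqr_ge0 ?freq2_ge0. Qed.

Lemma sqr_voigt_weight R (g : Z3 -> R) (al : R) k :
  voigt_weight g al k ^+ 2 = g k ^+ 2 * (1 + al ^+ 2 * freq2 R k).
Proof.
by rewrite exprMn sqr_sqrtr// (le_trans _ (voigt_factor_ge1 _ _)).
Qed.

(** What the two equations provide at a fixed time; the pressure is gone since
    the test vectors d are orthogonal to the frequency. *)
Record snapshot (R : realType) (al : R) (U dU u du f : pfield R 3) : Prop := Snapshot {
  snap_U0 : U 0 = 0;
  snap_u0 : u 0 = 0;
  snap_rU : forall k j, U (- k) 0 j = (U k 0 j)^*;
  snap_dvU : forall k : Z3, \sum_(j < 3) (k 0 j)%:~R * U k 0 j = 0;
  snap_dvu : forall k : Z3, \sum_(j < 3) (k 0 j)%:~R * u k 0 j = 0;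
  snap_U4 : inw (fpow R 4) U;
  snap_u3 : inw (fpow R 3) u;
  snap_du2 : inw (fpow R 2) du;
  snap_eqU : forall (k : Z3) (d : 'rV[R[i]]_3), \sum_(j < 3) (k 0 j)%:~R * d 0 j = 0 ->
    (1 + al ^+ 2 * freq2 R k) * ip (dU k) d
      = ip (f k) d - rsum (fun l => tri l (U (k - l)) (U l) d);
  snap_equ : forall (k : Z3) (d : 'rV[R[i]]_3), \sum_(j < 3) (k 0 j)%:~R * d 0 j = 0 ->
    ip (du k) d = ip (f k) d - rsum (fun l => tri l (u (k - l)) (u l) d) }.

Section FixedTime.
Variables (R : realType) (al : R) (U dU u du f : pfield R 3).
Hypothesis S : snapshot al U dU u du f.

Let U0 := snap_U0 S.
Let u0 := snap_u0 S.
Let U4 := snap_U4 S.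
Let u3 := snap_u3 S.

Let U3 : inw (fpow R 3) U. Proof. exact: (proj1 (@inw_fpow _ _ 3 4 _ isT U4)). Qed.
Let sU : summ (fun k => mag (U k)).
Proof. exact: (proj1 (summ_mag_H2 U0 (proj1 (@inw_fpow _ _ 2 4 _ isT U4)))). Qed.
Let su : summ (fun k => mag (u k)).
Proof. exact: (proj1 (summ_mag_H2 u0 (proj1 (@inw_fpow _ _ 2 3 _ isT u3)))). Qed.
Let sU1 : summ (fun k => freq R k * mag (U k)).
Proof. exact: (proj1 (summ_freqmag_H3 U0 U3)). Qed.
Let su1 : summ (fun k => freq R k * mag (u k)).
Proof. exact: (proj1 (summ_freqmag_H3 u0 u3)). Qed.

Variable z : pfield R 3.
Hypothesis zE : z = fsub U u.
Let z0 : z 0 = 0. Proof. by rewrite zE /fsub U0 u0 subrr. Qed.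
Let z3 : inw (fpow R 3) z. Proof. by rewrite zE; exact: (proj1 (inwB U3 u3)). Qed.

Let fm_ge0 (w : pfield R 3) k : 0 <= freq R k * mag (w k).
Proof. by rewrite mulr_ge0 ?freq_ge0 ?mag_ge0. Qed.

Let one_ge0 (k : Z3) : 0 <= one_weight R k. Proof. exact: ler01. Qed.

Lemma fmul_one (w : pfield R 3) : fmul (@one_weight R) w = w.
Proof. by apply/funext => k; rewrite /fmul scale1r. Qed.

(** The case of weight 1 without cutoff, in which both commutators vanish and
    the derivative in the stretching term falls on u, so that no power of N is
    needed. *)
Lemma L2_rate :
  `|wip (voigt_weight (@one_weight R) al) (fsub dU du) z|
    <= sob R * wnorm (fpow R 3) u * wnorm (@one_weight R) z ^+ 2
     + al ^+ 2 * (wnorm (fpow R 2) du * wnorm (@one_weight R) z).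
Proof.
have zone := proj1 (inw_one z0 z3).
have lz : l2 (wseq (@one_weight R) z) := zone.
have z1 : l2 (fun k => freq R k * mag (z k)).
  apply: (proj1 (l2_le (b := wseq (fpow R 3) z) _ z3)) => k; rewrite !normrM.
  by rewrite ler_wpM2r// !ger0_norm ?fpow_ge0 ?freq_ge0// -[freq R k]expr1; exact: (@fpow_mono R 1 3).
have a0 k : 0 <= wseq (@one_weight R) z k by rewrite wseq_ge0.
have m0 (w : pfield R 3) k : 0 <= mag (w k) by exact: mag_ge0.
have [sA _] : summ (diag_term (@one_weight R) U z) /\
    rsum (fun p => `|diag_term (@one_weight R) U z p|) <=
    l2norm (wseq (@one_weight R) z) * rsum (fun k => mag (U k)) * l2norm (fun k => freq R k * mag (z k)).
  have [s le] := conv_l2l1l2 a0 (m0 U) (fm_ge0 z) lz sU z1.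
  apply: bound_by s le => p; rewrite /diag_term !mul1r.
  apply: le_trans (tri_le _ _ _ _) _; rewrite /wseq mul1r.
  by rewrite le_eqVlt; apply/orP; left; apply/eqP; ring.
have [sS lS] : summ (stretch_term (@one_weight R) (@one_weight R) U u z) /\
    rsum (fun p => `|stretch_term (@one_weight R) (@one_weight R) U u z p|) <=
    sob R * wnorm (fpow R 3) u * wnorm (@one_weight R) z ^+ 2.
  have [s le] := conv_l2l2l1 a0 a0 (fm_ge0 u) lz lz su1.
  apply: bound_by s _ => [p|].
    rewrite /stretch_term expr1n !mul1r.
    apply: le_trans (tri_le _ _ _ _) _; rewrite /wseq !mul1r.
    by rewrite le_eqVlt; apply/orP; left; apply/eqP; rewrite -zE; ring.
  apply: le_trans le _; rewrite mulrC -expr2; apply: ler_wpM2r; first exact: sqr_ge0.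
  exact: (proj2 (summ_freqmag_H3 u0 u3)).
have zero_fun (I : choiceType) (t : I -> R) : (forall i, t i = 0) ->
    summ t /\ rsum (fun i => `|t i|) = 0.
  move=> h; have -> : t = fun=> 0 by apply/funext.
  by split; [exact: summ0|rewrite normr0 rsum0].
have hW p : weight_comm_term (@one_weight R) U z p = 0.
  by rewrite /weight_comm_term /one_weight subrr mulr0 mul0r.
have hC p : cutoff_comm_term (@one_weight R) (@one_weight R) u z p = 0.
  by rewrite /cutoff_comm_term /one_weight subrr mulr0 mul0r.
have hF k : one_weight R k ^+ 2 * (1 - one_weight R k) * ip (f k) (z k) = 0.
  by rewrite /one_weight subrr mulr0 mul0r.
have [sW rW] := zero_fun _ _ hW; have [sC rC] := zero_fun _ _ hC.
have [sF _] := zero_fun _ _ hF.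
have b k : `|one_weight R k ^+ 2 * freq2 R k * one_weight R k| <= `|fpow R 2 k * one_weight R k|.
  by rewrite /one_weight /fpow expr1n mul1r sqr_freq.
have [sV lV] := ip_cs b (snap_du2 S) zone.
have := @energy_rate R (@one_weight R) (@one_weight R) (voigt_weight (@one_weight R) al) al U u dU du f.
cbv zeta; rewrite !fmul_one -zE => /(_ (sqr_voigt_weight _ al) (snap_rU S) (snap_dvU S)
  (snap_dvu S) sU sU1 su su1 (snap_eqU S) (snap_equ S) sA sW sS sC sF sV) h.
apply: le_trans h _; rewrite rW rC add0r addr0.
have -> : rsum (fun k => one_weight R k ^+ 2 * (1 - one_weight R k) * ip (f k) (z k)) = 0.
  by rewrite -(rsum0 R (Z3)); apply: eq_rsum.
rewrite normr0 addr0; apply: lerD => //.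
by apply: ler_wpM2l; [exact: sqr_ge0|exact: lV].
Qed.

Variables (N : R) (w q : pfield R 3).
Hypothesis N1 : 1 <= N.
Hypothesis wE : w = fsub U (fmul (cutoff N) u).
Hypothesis qE : q = fmul (tail N) u.
Let N0 : 0 < N. Proof. exact: lt_le_trans ltr01 N1. Qed.

Let dw := fsub dU (fmul (cutoff N) du).

Let phi0 k : 0 <= cutoff N k. Proof. exact: cutoff_ge0. Qed.
Let phi1 k : cutoff N k <= 1. Proof. exact: cutoff_le1. Qed.

Let q3 : inw (fpow R 3) q.
Proof. by rewrite qE; exact: (proj1 (inw_tail N u3)). Qed.

Let q0 : q 0 = 0. Proof. by rewrite qE /fmul u0 scaler0. Qed.

Let w4 : inw (fpow R 4) w.
Proof. by rewrite wE; exact: (proj1 (inwB U4 (inw_cutoff N0 u3))). Qed.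

Let w3 : inw (fpow R 3) w. Proof. exact: (proj1 (@inw_fpow _ _ 3 4 _ isT w4)). Qed.

Let w0 : w 0 = 0. Proof. by rewrite wE /fsub /fmul U0 u0 scaler0 subrr. Qed.

Let fpow_ge0' s k : 0 <= fpow R s k. Proof. exact: fpow_ge0. Qed.

Local Notation W := (wnorm (fpow R 3) w).
Local Notation K := (wnorm (fpow R 3) u).
Local Notation Q := (wnorm (fpow R 3) q).

Let m0 (v : pfield R 3) k : 0 <= mag (v k). Proof. exact: mag_ge0. Qed.
Let a0 (v : pfield R 3) k : 0 <= wseq (fpow R 3) v k. Proof. by rewrite wseq_ge0. Qed.

(* The two products of a top-order factor with a summable one. *)
Let conv_top_low (x y : pfield R 3) : inw (fpow R 3) x -> y 0 = 0 -> inw (fpow R 3) y ->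
  summ (fun p : lat2 => wseq (fpow R 3) w p.1 * wseq (fpow R 3) x (p.1 - p.2) * (freq R p.2 * mag (y p.2)))
  /\ rsum (fun p : lat2 => wseq (fpow R 3) w p.1 * wseq (fpow R 3) x (p.1 - p.2) * (freq R p.2 * mag (y p.2)))
    <= W * wnorm (fpow R 3) x * (sob R * wnorm (fpow R 3) y).
Proof.
move=> x3 y0 y3; have [sy ly] := summ_freqmag_H3 y0 y3.
have [s le] := conv_l2l2l1 (a0 w) (a0 x) (fm_ge0 y) w3 x3 sy.
split => //; apply: le_trans le _; apply: ler_wpM2l => //.
by rewrite mulr_ge0 ?wnorm_ge0.
Qed.

Let conv_low_top (x y : pfield R 3) : x 0 = 0 -> inw (fpow R 3) x -> inw (fpow R 3) y ->
  summ (fun p : lat2 => wseq (fpow R 3) w p.1 * (freq R (p.1 - p.2) * mag (x (p.1 - p.2))) * wseq (fpow R 3) y p.2)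
  /\ rsum (fun p : lat2 => wseq (fpow R 3) w p.1 * (freq R (p.1 - p.2) * mag (x (p.1 - p.2))) * wseq (fpow R 3) y p.2)
    <= W * (sob R * wnorm (fpow R 3) x) * wnorm (fpow R 3) y.
Proof.
move=> x0 x3 y3; have [sx lx] := summ_freqmag_H3 x0 x3.
have [s le] := conv_l2l1l2 (a0 w) (fm_ge0 x) (a0 y) w3 sx y3.
split => //; apply: le_trans le _; apply: ler_wpM2r; first exact: wnorm_ge0.
by apply: ler_wpM2l => //; exact: wnorm_ge0.
Qed.

(** One derivative more than the energy contains: this is where U in H^4 and
    the truncation of u are used.  No size is recorded, as the sum is zero. *)
Lemma diag_bound : summ (diag_term (fpow R 3) U w).
Proof.
have [s le] := conv_l2l1l2 (a0 w) (m0 U) (fun k => wseq_ge0 w k (fpow_ge0' 4)) w3 sU w4.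
apply: (proj1 (bound_by _ s le)) => p; rewrite /diag_term normrM.
rewrite (ger0_norm (mulr_ge0 (fpow_ge0' 3 _) (fpow_ge0' 3 _))).
apply: (@le_trans _ _ (fpow R 3 p.1 * fpow R 3 p.2 *
  (freq R p.2 * mag (U (p.1 - p.2)) * mag (w p.2) * mag (w p.1)))).
  by apply: ler_wpM2l; [exact: mulr_ge0|exact: tri_le].
rewrite /wseq /fpow; move: (freq R p.1) (freq R p.2) (mag (U _)) (mag (w p.2)) (mag (w p.1)).
by move=> x1 x2 x3 x4 x5; rewrite le_eqVlt; apply/orP; left; apply/eqP; ring.
Qed.

Lemma weight_comm_bound : summ (weight_comm_term (fpow R 3) U w) /\
  rsum (fun p => `|weight_comm_term (fpow R 3) U w p|)
    <= 10 * sob R * W ^+ 2 * wnorm (fpow R 3) U.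
Proof.
have [s1 l1] := conv_top_low U3 w0 w3; have [s2 l2] := conv_low_top U0 U3 w3.
apply: (bound_by _ (summZ 5 (summD s1 s2))) => [[k l]/=|]; last first.
  by rewrite rsumZ ?rsumD//; [lra|exact: summD].
rewrite /weight_comm_term /= normrM (normrM (fpow R 3 k)) (ger0_norm (fpow_ge0' 3 k)) -mulrA.
have hk : `|fpow R 3 k - fpow R 3 l| <= 5 * (freq R (k - l) ^+ 3 + freq R (k - l) * freq R l ^+ 2).
  apply: cube_diff_le; [exact: freq_ge0..|exact: freq_le_add|].
  by rewrite distrC freq_dist.
apply: (@le_trans _ _ (fpow R 3 k * (5 * (freq R (k - l) ^+ 3 + freq R (k - l) * freq R l ^+ 2) *
   (freq R l * mag (U (k - l)) * mag (w l) * mag (w k))))).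
  by apply: ler_wpM2l => //; apply: ler_pM => //; exact: tri_le.
rewrite /wseq /fpow; move: (freq R k) (freq R l) (freq R (k - l)) (mag (U _)) (mag (w l)) (mag (w k)).
by move=> x1 x2 x3 x4 x5 x6; rewrite le_eqVlt; apply/orP; left; apply/eqP; ring.
Qed.

(** Of the three powers of |k| in the weight at the output, those that fall on
    z leave one derivative on u, which is harmless.  Those that fall on u leave
    phi(l) |l| <= 4 N, and N |z_m| <= |m| |z_m| + N^3 |m|^-2 |z_m| according to
    whether |m| exceeds N or not. *)
Lemma stretch_bound : summ (stretch_term (fpow R 3) (cutoff N) U u w) /\
  rsum (fun p => `|stretch_term (fpow R 3) (cutoff N) U u w p|)
    <= 4 * sob R * K * W * (5 * wnorm (fpow R 3) z + 4 * N ^+ 3 * wnorm (@one_weight R) z).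
Proof.
have zone := proj1 (inw_one z0 z3).
have [s1 l1] := conv_top_low z3 u0 u3.
have [sz lz] : summ (fun k => mag (z k)) /\ N * rsum (fun k => mag (z k)) <=
    sob R * wnorm (fpow R 3) z + N ^+ 3 * (sob R * wnorm (@one_weight R) z).
  have sz := proj1 (summ_mag_H2 z0 (proj1 (@inw_fpow _ _ 2 3 _ isT z3))).
  split => //; have [sf lf] := summ_freqmag_H3 z0 z3.
  have [si li] := cauchy_schwarz (@summ_lattice R) zone.
  have li' : rsum (fun k => (freq2 R k)^-1 * wseq (@one_weight R) z k) <=
      sob R * wnorm (@one_weight R) z.
    by apply: le_trans li; apply: ler_rsum => //; [exact: summ_norm|move=> k; exact: ler_norm].
  apply: (@le_trans _ _ (rsum (fun k => freq R k * mag (z k)) +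
      N ^+ 3 * rsum (fun k => (freq2 R k)^-1 * wseq (@one_weight R) z k))); last first.
    by apply: lerD => //; apply: ler_wpM2l li'; rewrite exprn_ge0// ltW.
  rewrite -rsumZ// -(rsumZ (N ^+ 3) si) -rsumD//; last exact: summZ.
  apply: ler_rsum; [exact: summZ|apply: summD => //; exact: summZ|].
  move=> k; rewrite /wseq mul1r; have [->|k0] := eqVneq k 0.
    by rewrite z0 mag0 !mulr0 addr0.
  rewrite mulrA -mulrDl; apply: ler_wpM2r; first exact: mag_ge0.
  have f1 := freq_ge1 R k0; have f0 : 0 < freq R k by exact: lt_le_trans f1.
  have [h|h] := leP N (freq R k).
    by apply: le_trans h _; rewrite lerDl mulr_ge0 ?invr_ge0 ?freq2_ge0 ?exprn_ge0// ltW.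
  apply: (@le_trans _ _ (N ^+ 3 * (freq2 R k)^-1)); last by rewrite lerDr ltW.
  rewrite -sqr_freq ler_pdivlMr ?exprn_gt0// [N ^+ 3]exprS; apply: ler_wpM2l; first exact: ltW.
  by apply: lerXn2r; rewrite ?nnegrE; exact: ltW.
have [s2 l2'] := conv_l2l1l2 (a0 w) (m0 z) (a0 u) w3 sz u3.
apply: (bound_by _ (summD (summZ 4 s1) (summZ (16 * N) s2))) => [[k l]/=|].
  rewrite /stretch_term /= -zE normrM (ger0_norm (mulr_ge0 (exprn_ge0 2 (fpow_ge0' 3 k)) (phi0 l))).
  have hk := cube_add_le (freq_ge0 R k) (freq_ge0 R (k - l)) (freq_ge0 R l) (freq_le_add R k l).
  have ht := tri_le l (z (k - l)) (u l) (w k).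
  have hp := cutoff_freq N0 l.
  apply: (@le_trans _ _ (fpow R 3 k ^+ 2 * cutoff N l *
    (freq R l * mag (z (k - l)) * mag (u l) * mag (w k)))).
    by apply: ler_wpM2l ht; apply: mulr_ge0 (phi0 l); exact: exprn_ge0.
  rewrite /wseq /fpow; move: (freq_ge0 R k) (freq_ge0 R l) (freq_ge0 R (k - l)) hk hp (phi0 l) (phi1 l).
  move: (mag_ge0 (z (k - l))) (mag_ge0 (u l)) (mag_ge0 (w k)).
  move: (freq R k) (freq R l) (freq R (k - l)) (mag (z _)) (mag (u l)) (mag (w k)) (cutoff N l).
  move=> fk fl fm Z u' w' ph Z0 u'0 w'0 fk0 fl0 fm0 hk hp p0 p1.
  have -> : (fk ^+ 3) ^+ 2 * ph * (fl * Z * u' * w') =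
    (fk ^+ 3 * w' * Z * u' * (ph * fl)) * fk ^+ 3 by ring.
  apply: (@le_trans _ _ ((fk ^+ 3 * w' * Z * u' * (ph * fl)) * (4 * (fm ^+ 3 + fl ^+ 3)))).
    by apply: ler_wpM2l hk; rewrite !mulr_ge0 ?exprn_ge0.
  have -> : (fk ^+ 3 * w' * Z * u' * (ph * fl)) * (4 * (fm ^+ 3 + fl ^+ 3)) =
    4 * (fk ^+ 3 * w' * Z * u' * fm ^+ 3 * fl) * ph
    + 4 * (fk ^+ 3 * w' * Z * u' * fl ^+ 3) * (ph * fl) by ring.
  have -> : 4 * (fk ^+ 3 * w' * (fm ^+ 3 * Z) * (fl * u')) +
    16 * N * (fk ^+ 3 * w' * Z * (fl ^+ 3 * u')) =
    4 * (fk ^+ 3 * w' * Z * u' * fm ^+ 3 * fl) * 1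
    + 4 * (fk ^+ 3 * w' * Z * u' * fl ^+ 3) * (4 * N) by ring.
  by apply: lerD; apply: ler_wpM2l => //; rewrite !mulr_ge0 ?exprn_ge0.
rewrite rsumD; [|exact: summZ|exact: summZ].
rewrite (rsumZ 4 s1) (rsumZ _ s2).
have W0 : 0 <= W by exact: wnorm_ge0.
have K0 : 0 <= K by exact: wnorm_ge0.
have l3 : 16 * N * (W * rsum (fun k => mag (z k)) * K) <=
    16 * (W * K) * (sob R * wnorm (fpow R 3) z + N ^+ 3 * (sob R * wnorm (@one_weight R) z)).
  have -> : 16 * N * (W * rsum (fun k => mag (z k)) * K) =
    16 * (W * K) * (N * rsum (fun k => mag (z k))) by ring.
  by apply: ler_wpM2l lz; rewrite !mulr_ge0.
apply: le_trans (lerD (ler_wpM2l _ l1) (le_trans (ler_wpM2l _ l2') l3)) _ => //.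
  by rewrite mulr_ge0// ltW.
by rewrite le_eqVlt; apply/orP; left; apply/eqP; ring.
Qed.

(** The commutator estimate gives back the derivative, and the factor that
    carries a frequency above N is a tail of u. *)
Lemma cutoff_comm_bound : summ (cutoff_comm_term (fpow R 3) (cutoff N) u w) /\
  rsum (fun p => `|cutoff_comm_term (fpow R 3) (cutoff N) u w p|)
    <= 32 * sob R * K * W * Q.
Proof.
have [s1 l1] := conv_top_low q3 u0 u3; have [s2 l2] := conv_top_low u3 q0 q3.
have [s3 l3] := conv_low_top q0 q3 u3; have [s4 l4] := conv_low_top u0 u3 q3.
apply: (bound_by _ (summD (summZ 4 (summD s1 s2)) (summZ 12 (summD s3 s4)))) => [[k l]/=|]; last first.
  rewrite rsumD; [|by apply: summZ; exact: summD|by apply: summZ; exact: summD].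
  rewrite (rsumZ 4 (summD s1 s2)) (rsumZ 12 (summD s3 s4)) (rsumD s1 s2) (rsumD s3 s4).
  by lra.
rewrite /cutoff_comm_term /= normrM normrM (ger0_norm (exprn_ge0 2 (fpow_ge0' 3 k))).
have hk := cube_add_le (freq_ge0 R k) (freq_ge0 R (k - l)) (freq_ge0 R l) (freq_le_add R k l).
have ht := tri_le l (u (k - l)) (u l) (w k).
have hc := cutoff_comm N0 k l; have hc1 := norm_cutoffB_le1 N k l.
have hct := cutoff_comm_tail N0 k l.
apply: (@le_trans _ _ (fpow R 3 k ^+ 2 * `|cutoff N l - cutoff N k| *
    (freq R l * mag (u (k - l)) * mag (u l) * mag (w k)))).
  by apply: ler_wpM2l ht; apply: mulr_ge0 => //; exact: exprn_ge0.
rewrite /wseq /fpow qE /fmul !magZ !(ger0_norm (tail_ge0 _ _)).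
move: (freq_ge0 R k) (freq_ge0 R l) (freq_ge0 R (k - l)) hk hc hc1 hct (tail_ge0 N (k - l)) (tail_ge0 N l).
move: (normr_ge0 (cutoff N l - cutoff N k)).
move: (mag_ge0 (u (k - l))) (mag_ge0 (u l)) (mag_ge0 (w k)).
move: (freq R k) (freq R l) (freq R (k - l)) (mag (u (k - l))) (mag (u l)) (mag (w k)).
move: (`|cutoff N l - cutoff N k|) (tail N (k - l)) (tail N l).
move=> c tm tl fk fl fm um ul w' um0 ul0 w'0 c0 fk0 fl0 fm0 hk hc hc1 hct tm0 tl0.
pose A := fk ^+ 3 * w' * um * ul.
have A0 : 0 <= A by rewrite !mulr_ge0 ?exprn_ge0.
have -> : (fk ^+ 3) ^+ 2 * c * (fl * um * ul * w') = A * (c * fl) * fk ^+ 3.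
  by rewrite /A; ring.
apply: (@le_trans _ _ (A * (c * fl) * (4 * (fm ^+ 3 + fl ^+ 3)))).
  by apply: ler_wpM2l hk; rewrite !mulr_ge0.
have ct0 : 0 <= c * (tm + tl) by rewrite mulr_ge0 ?addr_ge0.
apply: (@le_trans _ _ (A * (c * (tm + tl) * fl) * (4 * (fm ^+ 3 + fl ^+ 3)))).
  apply: ler_wpM2r; first by rewrite mulr_ge0 ?addr_ge0 ?exprn_ge0.
  by apply: ler_wpM2l => //; apply: ler_wpM2r.
have -> : A * (c * (tm + tl) * fl) * (4 * (fm ^+ 3 + fl ^+ 3)) =
  4 * (A * (tm + tl) * fm ^+ 3 * fl) * c + 4 * (A * (tm + tl) * fl ^+ 3) * (c * fl) by ring.
have -> : 4 * (fk ^+ 3 * w' * (fm ^+ 3 * (tm * um)) * (fl * ul) +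
     fk ^+ 3 * w' * (fm ^+ 3 * um) * (fl * (tl * ul))) +
  12 * (fk ^+ 3 * w' * (fm * (tm * um)) * (fl ^+ 3 * ul) +
     fk ^+ 3 * w' * (fm * um) * (fl ^+ 3 * (tl * ul))) =
  4 * (A * (tm + tl) * fm ^+ 3 * fl) * 1 + 4 * (A * (tm + tl) * fl ^+ 3) * (3 * fm).
  by rewrite /A; ring.
by apply: lerD; apply: ler_wpM2l => //; rewrite !mulr_ge0 ?addr_ge0 ?exprn_ge0.
Qed.

(** The four advection terms, the high frequencies of the force and the Voigt
    term of the truncated field.  In the last one the cutoff turns the three
    missing powers of |k| into (4 N)^3. *)
Lemma H3_rate : inw (fpow R 3) (fmul (tail N) f) ->
  `|wip (voigt_weight (fpow R 3) al) (fsub dU (fmul (cutoff N) du)) w|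
   <= 10 * sob R * W ^+ 2 * wnorm (fpow R 3) U
    + 4 * sob R * K * W * (5 * wnorm (fpow R 3) z + 4 * N ^+ 3 * wnorm (@one_weight R) z)
    + 32 * sob R * K * W * Q
    + wnorm (fpow R 3) (fmul (tail N) f) * W
    + al ^+ 2 * ((4 * N) ^+ 3 * (wnorm (fpow R 2) du * W)).
Proof.
move=> f3.
have [sW lW] := weight_comm_bound; have [sS lS] := stretch_bound.
have [sC lC] := cutoff_comm_bound.
have [sF lF] : summ (fun k => fpow R 3 k ^+ 2 * (1 - cutoff N k) * ip (f k) (w k)) /\
    `|rsum (fun k => fpow R 3 k ^+ 2 * (1 - cutoff N k) * ip (f k) (w k))|
      <= wnorm (fpow R 3) (fmul (tail N) f) * W.
  have [s l] := cauchy_schwarz f3 w3.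
  have b k : `|fpow R 3 k ^+ 2 * (1 - cutoff N k) * ip (f k) (w k)| <=
      `|wseq (fpow R 3) (fmul (tail N) f) k * wseq (fpow R 3) w k|.
    have /andP[h1 h2] := onem_cutoff_tail N0 k.
    rewrite normrM (ger0_norm (mulr_ge0 (exprn_ge0 2 (fpow_ge0' 3 k)) h1)).
    apply: le_trans (ler_norm _); rewrite /wseq /fmul magZ (ger0_norm (tail_ge0 _ _)).
    have := ip_le (f k) (w k); move: (normr_ge0 (ip (f k) (w k))) => i0 hi.
    have -> : fpow R 3 k * (tail N k * mag (f k)) * (fpow R 3 k * mag (w k)) =
      fpow R 3 k ^+ 2 * tail N k * (mag (f k) * mag (w k)) by ring.
    have g0 : 0 <= fpow R 3 k ^+ 2 := exprn_ge0 2 (fpow_ge0' 3 k).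
    by apply: ler_pM => //; [exact: mulr_ge0 g0 h1|exact: ler_wpM2l].
  have sn := summ_norm s; split; first exact: summ_le b sn.
  by apply: le_trans l; exact: ler_norm_rsum.
have [sV lV] : summ (fun k => fpow R 3 k ^+ 2 * freq2 R k * cutoff N k * ip (du k) (w k)) /\
    `|rsum (fun k => fpow R 3 k ^+ 2 * freq2 R k * cutoff N k * ip (du k) (w k))|
      <= (4 * N) ^+ 3 * (wnorm (fpow R 2) du * W).
  have n4 : 0 <= (4 * N) ^+ 3 by rewrite exprn_ge0// mulr_ge0// ltW.
  have b k : `|fpow R 3 k ^+ 2 * freq2 R k * cutoff N k| <=
      `|((4 * N) ^+ 3 * fpow R 2 k) * fpow R 3 k|.
    have l0 := mulr_ge0 (mulr_ge0 (exprn_ge0 2 (fpow_ge0' 3 k)) (freq2_ge0 R k)) (phi0 k).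
    have r0 := mulr_ge0 (mulr_ge0 n4 (fpow_ge0' 2 k)) (fpow_ge0' 3 k).
    rewrite (ger0_norm l0) (ger0_norm r0).
    rewrite -sqr_freq /fpow.
    have -> : (freq R k ^+ 3) ^+ 2 * freq R k ^+ 2 * cutoff N k =
      (cutoff N k * freq R k ^+ 3) * freq R k ^+ 2 * freq R k ^+ 3 by ring.
    do 2!(apply: ler_wpM2r; first by rewrite exprn_ge0// freq_ge0).
    have [h|h] := leP (4 * N) (freq R k); first by rewrite (cutoff0 N0 h) mul0r.
    apply: (@le_trans _ _ (freq R k ^+ 3)); first by rewrite ler_piMl// exprn_ge0// freq_ge0.
    by apply: lerXn2r (ltW h); rewrite ?nnegrE ?freq_ge0// mulr_ge0// ltW.
  have [i2 n2] := l2Z ((4 * N) ^+ 3) (snap_du2 S).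
  have i2' : inw (fun k => (4 * N) ^+ 3 * fpow R 2 k) du.
    by apply: eq_summ i2 => k; rewrite /wseq mulrA.
  have [s l] := ip_cs b i2' w3; split => //; apply: le_trans l _.
  rewrite mulrA; apply: ler_wpM2r; first exact: wnorm_ge0.
  rewrite /wnorm -[X in X * l2norm _](ger0_norm n4) -n2 le_eqVlt; apply/orP; left; apply/eqP.
  by congr Num.sqrt; apply: eq_rsum => k; rewrite /wseq mulrA.
have sA := diag_bound.
have := @energy_rate R (fpow R 3) (cutoff N) (voigt_weight (fpow R 3) al) al U u dU du f.
cbv zeta; rewrite -wE => /(_ (sqr_voigt_weight _ al) (snap_rU S) (snap_dvU S)
  (snap_dvu S) sU sU1 su su1 (snap_eqU S) (snap_equ S) sA sW sS sC sF sV) h.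
apply: le_trans h _; apply: lerD; last by apply: ler_wpM2l lV; exact: sqr_ge0.
by apply: lerD lF; apply: lerD lC; apply: lerD lW lS.
Qed.

End FixedTime.

(** * Uniform smallness of high frequencies *)

Lemma C0w_bounded R m (T : R) (om : Z3 -> R)
    (w : R -> pfield R m) : 0 < T -> C0w T om w ->
  exists2 K, 0 <= K & forall t, t \in `[0, T] -> wnorm om (w t) <= K.
Proof.
move=> T0 cw; have [c cT hc] := EVT_max (ltW T0) (wip_continuous cw cw).
exists (wnorm om (w c)); first exact: wnorm_ge0.
move=> t tT; have := hc t tT; rewrite !wipxx.
by rewrite ler_pXn2r ?nnegrE ?wnorm_ge0.
Qed.

(** Dominated convergence: each coefficient is eventually cut off. *)
Lemma wnorm_tail_cvg R m s (w : pfield R m) : inw (fpow R s) w ->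
  wnorm (fpow R s) (fmul (tail n%:R) w) @[n --> \oo] --> 0.
Proof.
move=> h.
have c0 : rsum (fun k => wseq (fpow R s) (fmul (tail n%:R) w) k ^+ 2) @[n --> \oo] -->
    rsum (fun _ : Z3 => 0 : R).
  apply: (proj2 (rsum_cvg _ _ h _)).
    near=> n => k; rewrite /wseq /fmul magZ (ger0_norm (tail_ge0 _ _)) mulrCA exprMn.
    rewrite ger0_norm; last by apply: mulr_ge0; exact: sqr_ge0.
    apply: ler_piMl; first exact: sqr_ge0.
    by apply: exprn_ile1; [exact: tail_ge0|exact: tail_le1].
  move=> k; apply: cvg_near_cst; near=> n.
  rewrite /wseq /fmul; have -> : tail n%:R k = 0 :> R.
    by rewrite /tail ifT//; near: n; exact: nbhs_infty_ger.
  by rewrite scale0r mag0 mulr0 expr0n.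
rewrite rsum0 in c0; have := cvg_comp _ _ c0 (@sqrt_continuous R 0).
by rewrite sqrtr0.
Unshelve. all: by end_near. Qed.

(** Dini's argument: the tails of w(t) are small for large n, those of
    w(t') - w(t) are small for t' near t, and the interval is compact. *)
Lemma uniform_tail R m s (T e : R) (w : R -> pfield R m) :
  0 < e -> C0w T (fpow R s) w ->
  \forall n \near \oo, forall t, t \in `[0, T] ->
    wnorm (fpow R s) (fmul (tail n%:R) (w t)) <= e.
Proof.
move=> e0 [w1 w2].
have cpt : compact `[0, T]%classic by exact: segment_compact.
have /compact_near_coveringP := cpt.
move=> /(_ nat \oo (fun n t => t \in `[0, T] -> wnorm (fpow R s) (fmul (tail n%:R) (w t)) <= e)).
have e2 : 0 < e / 2 by rewrite divr_gt0.
have loc t : `[0, T]%classic t -> \forall t' \near t & n \near \oo,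
    t' \in `[0, T] -> wnorm (fpow R s) (fmul (tail n%:R) (w t')) <= e.
  move=> tT.
  have near1 : \forall t' \near t, t' \in `[0, T] -> wnorm (fpow R s) (fsub (w t') (w t)) <= e / 2.
    have /cvgrPdist_le/(_ _ e2) := w2 t tT; rewrite near_withinE.
    apply: filterS => r h rT; have := h rT.
    by rewrite sub0r normrN ger0_norm// wnorm_ge0.
  have near2 : \forall n \near \oo, wnorm (fpow R s) (fmul (tail n%:R) (w t)) <= e / 2.
    have /cvgrPdist_le/(_ _ e2) := wnorm_tail_cvg (w1 t tT).
    by apply: filterS => n; rewrite sub0r normrN ger0_norm// wnorm_ge0.
  exists ([set t' | t' \in `[0, T] -> wnorm (fpow R s) (fsub (w t') (w t)) <= e / 2],
    [set n | wnorm (fpow R s) (fmul (tail n%:R) (w t)) <= e / 2]); first by split.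
  move=> [t' n] [/= h1' h2] t'T; have h1 := h1' t'T.
  have [s1 _] := inwB (w1 t' t'T) (w1 t tT).
  have [s2 l2] := inw_tail n%:R s1; have [s3 _] := inw_tail n%:R (w1 t tT).
  have : wnorm (fpow R s) (fmul (tail n%:R) (w t')) <=
      wnorm (fpow R s) (fmul (tail n%:R) (fsub (w t') (w t)))
      + wnorm (fpow R s) (fmul (tail n%:R) (w t)).
    apply: (proj2 (inwD_gen _ s2 s3)) => k; rewrite /fmul /fsub.
    by apply: le_trans (magD _ _); rewrite -scalerDr subrK.
  by move=> h3; apply: le_trans h3 _; rewrite [e]splitr; exact: lerD (le_trans l2 h1) h2.
move=> /(_ _ loc); apply: filterS => n h t tT; exact: h.
Qed.

(** The sum over the frequencies becomes a series, whose measurability in time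
    follows term by term. *)
Lemma pickle_esum R (I : countType) (a : I -> \bar R) : (forall i, (0 <= a i)%E) ->
  (\esum_(i in [set: I]) a i =
   \sum_(n <oo) (if @pickle_inv I n is Some i then a i else 0))%E.
Proof.
move=> a0; pose b n : \bar R := (if @pickle_inv I n is Some i then a i else 0)%E.
have b0 n : (0 <= b n)%E by rewrite /b; case: pickle_inv.
rewrite nneseries_esumT//.
transitivity (\esum_(n in pickle @` [set: I]) b n)%E.
  rewrite esum_image; last by move=> x y _ _; exact: (pcan_inj (@pickleK I)).
  by apply: eq_esum => i _; rewrite /b pickleK_inv.
rewrite esum_mkcond; apply: eq_esum => n _; case: ifPn => //.
rewrite notin_setE => h; rewrite /b; case E : (pickle_inv n) => [i|]//.
exfalso; apply: h; exists i => //; have := @pickle_invK I n; rewrite E /=.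
by [].
Qed.

(** The norm is a countable sum of functions that are continuous in time. *)
Lemma measurable_Hnorm R m s (T : R) (w : R -> pfield R m) :
  (forall k, {within `[0, T], continuous (fun t => mag (w t k) ^+ 2)}) ->
  measurable_fun (`[0, T] : set (measurableTypeR R)) (fun t : R => Hnorm s.+1%:R (w t) : \bar R).
Proof.
move=> cw.
have E t : Hnorm s.+1%:R (w t) =
    poweR (\esum_(k in [set: Z3]) (wseq (fpow R s.+1) (w t) k ^+ 2)%R%:E)%E 2^-1.
  by rewrite /Hnorm esum_Hnorm poweR12_sqrt// esum_ge0// => k _; rewrite lee_fin sqr_ge0.
have -> : (fun t => Hnorm s.+1%:R (w t)) = (fun x : \bar R => poweR x 2^-1) \o
    (fun t => \sum_(n <oo) (if @pickle_inv Z3 n is Some k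
       then (wseq (fpow R s.+1) (w t) k ^+ 2)%R%:E else 0))%E.
  by apply/funext => t; rewrite E pickle_esum// => k; rewrite lee_fin sqr_ge0.
apply: measurableT_comp; first exact: measurable_poweR.
apply: ge0_emeasurable_sum.
  by move=> n t _ _; case: pickle_inv => // k; rewrite lee_fin sqr_ge0.
move=> n _; case: pickle_inv => [k|]; last exact: measurable_cst.
apply/measurable_EFinP; apply: subspace_continuous_measurable_fun => //.
have -> : (fun t => wseq (fpow R s.+1) (w t) k ^+ 2) =
    (fun t => fpow R s.+1 k ^+ 2 * mag (w t k) ^+ 2).
  by apply/funext => t; rewrite /wseq exprMn.
move=> t; apply: cvgM; [exact: cvg_cst|exact: cw].
Qed.

Lemma mag_le_wnorm R m s (w : pfield R m) k : w 0 = 0 ->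
  inw (fpow R s) w -> mag (w k) <= wnorm (fpow R s) w.
Proof.
move=> w0 iw; have [io lo] := inw_one w0 iw; apply: le_trans lo.
rewrite -(@ler_pXn2r _ 2)// ?nnegrE ?mag_ge0 ?wnorm_ge0// sqr_l2norm.
have := @le_rsum_pt R _ (fun k => wseq (@one_weight R) w k ^+ 2) k (fun=> sqr_ge0 _) io.
by rewrite /= {1}/wseq mul1r.
Qed.

Lemma coef_continuous R m s (T : R) (w : R -> pfield R m) k :
  (forall t, t \in `[0, T] -> w t 0 = 0) -> C0w T (fpow R s) w ->
  {within `[0, T], continuous (fun t => mag (w t k) ^+ 2)}.
Proof.
move=> w0 [w1 w2]; apply/subspace_continuousP => t /= tT.
suff c : mag (w r k) @[r --> within `[0, T] (nbhs t)] --> mag (w t k).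
  exact: (cvgM c c).
apply: (@cvg_of_le _ _ _ _ _ (fun r => wnorm (fpow R s) (fsub (w r) (w t)))); last exact: w2.
near=> r; have rT : r \in `[0, T] by near: r; exact: near_within.
apply: (@le_trans _ _ (mag (w r k - w t k))).
  rewrite ler_distl; apply/andP; split.
    by rewrite lerBlDr -[mag (w r k - _)]magN opprB -{1}[w t k](subrK (w r k)) addrC magD.
  by rewrite addrC -{1}[w r k](subrK (w t k)) magD.
apply: (@mag_le_wnorm R m s (fsub (w r) (w t)) k); last exact: (proj1 (inwB (w1 r rT) (w1 t tT))).
by rewrite /fsub (w0 r rT) (w0 t tT) subrr.
Unshelve. all: by end_near. Qed.

(** Almost every f(t) is in H^3, where its tails tend to 0, and they are
    dominated by the integrable norm of f itself.  Since f need not be continuous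
    in H^3, the smallness is only in the mean. *)
Lemma force_tail R m (T : R) (f : R -> pfield R m) :
  (forall t, t \in `[0, T] -> f t 0 = 0) -> C0w T (fpow R 2) f ->
  (\int[lebesgue_measure]_(t in `[0%R, T]) Hnorm 3%:R (f t) < +oo)%E ->
  (forall n, lebesgue_measure.-integrable `[0%R, T]
     (fun t => Hnorm 3%:R (fmul (tail (n%:R : R)) (f t)))) /\
  (\int[lebesgue_measure]_(t in `[0%R, T]) Hnorm 3%:R (fmul (tail (n%:R : R)) (f t))
     @[n --> \oo] --> 0)%E.
Proof.
move=> f0 cf hf; pose mu := @lebesgue_measure R.
have mf : measurable_fun (`[0, T] : set (measurableTypeR R)) (fun t => Hnorm 3%:R (f t)).
  by apply: (@measurable_Hnorm R m 2) => k; exact: coef_continuous f0 cf.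
have mt n : measurable_fun (`[0, T] : set (measurableTypeR R))
    (fun t => Hnorm 3%:R (fmul (tail (n%:R : R)) (f t))).
  apply: (@measurable_Hnorm R m 2 T (fun t => fmul (tail n%:R) (f t))) => k.
  apply: (@coef_continuous R m 2 T (fun t => fmul (tail n%:R) (f t)) k).
    by move=> t tT; rewrite /fmul f0// scaler0.
  apply: C0w_fmul cf; first exact: ler01.
  by move=> k'; rewrite mul1r normrM ler_piMr// ger0_norm ?tail_ge0 ?tail_le1.
have H0 (v : pfield R m) : (0 <= Hnorm 3%:R v)%E by exact: sqrte_ge0.
have le n t : (Hnorm 3%:R (fmul (tail (n%:R : R)) (f t)) <= Hnorm 3%:R (f t))%E.
  rewrite /Hnorm lee_sqrt; last first.
    by apply: esum_ge0 => k _; rewrite lee_fin mulr_ge0 ?powR_ge0 ?coef_norm2_ge0.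
  apply: le_esum => k _; rewrite lee_fin; apply: ler_wpM2l; first exact: powR_ge0.
  rewrite -!sqr_mag /fmul magZ ler_pXn2r ?nnegrE ?mulr_ge0 ?mag_ge0//.
  by rewrite ler_piMl ?mag_ge0// ger0_norm ?tail_ge0 ?tail_le1.
have mI : measurable (`[0, T] : set (measurableTypeR R)) by exact: measurable_itv.
have iF : mu.-integrable `[0, T] (fun t => Hnorm 3%:R (f t)).
  apply/integrableP; split => //.
  by under eq_integral do rewrite gee0_abs//.
split.
  move=> n; apply: (@le_integrable _ _ R mu `[0, T] mI _ (fun t => Hnorm 3%:R (f t)) (mt n) _ iF) => t _.
  by rewrite !gee0_abs.
have [] := @dominated_convergence _ (measurableTypeR R) R mu `[0, T] mI
  (fun n t => Hnorm 3%:R (fmul (tail (n%:R : R)) (f t))) (cst 0%E) (fun t => Hnorm 3%:R (f t))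
  mt (measurable_cst _ ) _ iF _.
- have := integrable_ae mI iF; apply: filterS => t h tT.
  have i3 : inw (fpow R 3) (f t).
    by apply: Hnorm_inw; have := h tT; rewrite ge0_fin_numE.
  have E n : Hnorm 3%:R (fmul (tail (n%:R : R)) (f t)) =
      (wnorm (fpow R 3) (fmul (tail n%:R) (f t)))%:E.
    exact: inw_Hnorm (proj1 (inw_tail _ i3)).
  rewrite /=; under eq_fun do rewrite E.
  by apply: cvg_EFin; [near=> n|exact: wnorm_tail_cvg].
- by apply: aeW => t n _; rewrite gee0_abs.
by move=> _ _; rewrite integral0.
Unshelve. all: by end_near. Qed.

(** * The two stages of the estimate in time *)

Lemma sob_ge0 R : 0 <= sob R.
Proof. exact: l2norm_ge0. Qed.

Lemma le_of_sqr R (x y : R) : 0 <= x -> 0 <= y -> x ^+ 2 <= y ^+ 2 -> x <= y.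
Proof. by move=> x0 y0; rewrite ler_pXn2r. Qed.

Lemma C1w_weight R (T C : R) (om om' : Z3 -> R)
    (w dw : R -> pfield R 3) : 0 <= C -> (forall k, `|om' k| <= C * `|om k|) ->
  C1w T om w dw -> C1w T om' w dw.
Proof.
move=> C0 h hw.
have E (v : R -> pfield R 3) : v = (fun t => fmul (@one_weight R) (v t)).
  by apply/funext => t; rewrite fmul_one.
rewrite (E w) (E dw); apply: C1w_fmul C0 _ hw => k; by rewrite mulr1.
Qed.

(** The Voigt factor costs one derivative, with a factor alpha. *)
Lemma voigt_factor_le R (al : R) (k : Z3) : 0 <= al ->
  Num.sqrt (1 + al ^+ 2 * freq2 R k) <= 1 + al * freq R k.
Proof.
move=> a0; have f0 := freq_ge0 R k; have af := mulr_ge0 a0 f0.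
rewrite -(@ler_pXn2r _ 2)// ?nnegrE ?sqrtr_ge0 ?addr_ge0//.
rewrite sqr_sqrtr ?(le_trans _ (voigt_factor_ge1 _ _))// -sqr_freq sqrrD expr1n mul1r exprMn.
by rewrite mulr2n; lra.
Qed.

Lemma voigt_factor_sqrt_ge1 R (al : R) (k : Z3) :
  1 <= Num.sqrt (1 + al ^+ 2 * freq2 R k).
Proof. by rewrite -[X in X <= _]sqrtr1 ler_sqrt ?voigt_factor_ge1// (le_trans _ (voigt_factor_ge1 _ _)). Qed.

Lemma voigt_weight_ge0 R (g : Z3 -> R) (al : R) k : 0 <= g k ->
  0 <= voigt_weight g al k.
Proof. by move=> g0; rewrite mulr_ge0// sqrtr_ge0. Qed.

Lemma wnorm_voigt_ge R (g : Z3 -> R) (al : R) (w : pfield R 3) :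
  inw (voigt_weight g al) w -> inw g w /\ wnorm g w <= wnorm (voigt_weight g al) w.
Proof.
move=> iw; rewrite -[X in _ /\ _ <= X]mul1r; apply: inw_le iw => // k.
rewrite mul1r normrM ler_peMr// ger0_norm ?sqrtr_ge0//; exact: voigt_factor_sqrt_ge1.
Qed.

(** The constant weight, with the zero frequency removed so as to be dominated
    by the powers of |k|; on fields of mean zero the two agree. *)
Definition nz_weight R : Z3 -> R := fun k => (k != 0)%:R.

Lemma wip_eq R m (om om' : Z3 -> R) (v w : pfield R m) :
  w 0 = 0 -> (forall k, k != 0 -> om k = om' k) -> wip om v w = wip om' v w.
Proof.
move=> w0 h; apply: eq_rsum => k; have [->|k0] := eqVneq k 0; last by rewrite h.
by rewrite w0; have := ip_le (v 0) 0; rewrite mag0 mulr0 normr_le0 => /eqP ->; rewrite !mulr0.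
Qed.

(** Under the bootstrap assumption W <= rho <= 1 the quadratic terms in W are
    bounded by the energy, with a constant that does not involve N, and one factor
    W of the remaining terms by rho. *)
Lemma bootstrap_rate R (rho S K Q Z0 N al D2 g F W z Z U k d q E : R) :
  0 <= S -> 0 <= K -> 0 <= Q -> 0 <= Z0 -> 0 <= N -> 0 <= D2 -> 0 <= F -> 0 <= W ->
  0 <= z -> 0 <= Z -> 0 <= U -> 0 <= k -> 0 <= d -> 0 <= q ->
  0 < rho -> rho <= 1 -> W ^+ 2 <= E -> E < rho ^+ 2 ->
  z <= W + Q -> U <= W + K -> k <= K -> d <= D2 -> q <= Q -> Z <= Z0 ->
  g <= 10 * S * W ^+ 2 * U + 4 * S * k * W * (5 * z + 4 * N ^+ 3 * Z)
     + 32 * S * k * W * q + F * W + al ^+ 2 * ((4 * N) ^+ 3 * (d * W)) ->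
  2 * g <= (20 * S * (1 + K) + 40 * S * K) * E
    + rho * (104 * S * K * Q + 32 * S * K * (N ^+ 3 * Z0) + 128 * (N ^+ 3 * (al ^+ 2 * D2)))
    + 2 * rho * F.
Proof.
move=> S0 K0 Q0 Z00 N0 D0 F0 W0 z0 Z0' U0 k0 d0 q0 r0 r1 WE Er zW UW kK dD qQ ZZ h.
have Wr : W <= rho.
  by apply: le_of_sqr W0 (ltW r0) _; exact: le_trans WE (ltW Er).
have E0 : 0 <= E by apply: le_trans WE; exact: sqr_ge0.
have n3 : 0 <= N ^+ 3 by exact: exprn_ge0.
have t1 : 10 * S * W ^+ 2 * U <= 10 * S * E * (1 + K).
  apply: ler_pM => //; first by rewrite !mulr_ge0 ?sqr_ge0.
    by apply: ler_wpM2l => //; exact: mulr_ge0.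
  by apply: le_trans UW _; rewrite lerD2r; exact: le_trans Wr r1.
have SKW : 4 * S * k * W <= 4 * S * K * W.
  by apply: ler_wpM2r => //; apply: ler_wpM2l => //; exact: mulr_ge0.
have SKW0 : 0 <= 4 * S * k * W by rewrite !mulr_ge0.
have t2 : 4 * S * k * W * (5 * z + 4 * N ^+ 3 * Z) <=
   4 * S * K * W * (5 * (W + Q) + 4 * N ^+ 3 * Z0).
  apply: ler_pM => //; first by rewrite addr_ge0// !mulr_ge0.
  by apply: lerD; apply: ler_wpM2l => //; exact: mulr_ge0.
have SK0 : 0 <= S * K by exact: mulr_ge0.
have t2' : 4 * S * K * W * (5 * (W + Q) + 4 * N ^+ 3 * Z0) <=
   20 * (S * K) * E + rho * (20 * (S * K) * Q + 16 * (S * K) * (N ^+ 3 * Z0)).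
  have -> : 4 * S * K * W * (5 * (W + Q) + 4 * N ^+ 3 * Z0) =
    20 * (S * K) * W ^+ 2 + W * (20 * (S * K) * Q + 16 * (S * K) * (N ^+ 3 * Z0)) by ring.
  apply: lerD; first by apply: ler_wpM2l => //; exact: mulr_ge0.
  apply: ler_wpM2r => //; apply: addr_ge0; first by rewrite !mulr_ge0.
  by apply: mulr_ge0; [exact: mulr_ge0|exact: mulr_ge0].
have t3 : 32 * S * k * W * q <= 32 * (S * K) * (rho * Q).
  have -> : 32 * S * k * W * q = 8 * (4 * S * k * W) * q by ring.
  have -> : 32 * (S * K) * (rho * Q) = 8 * (4 * S * K * rho) * Q by ring.
  apply: ler_pM => //; first exact: mulr_ge0.
  apply: ler_wpM2l => //; apply: le_trans SKW _.
  by apply: ler_wpM2l => //; rewrite !mulr_ge0.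
have t4 : F * W <= F * rho by apply: ler_wpM2l.
have t5 : al ^+ 2 * ((4 * N) ^+ 3 * (d * W)) <= 64 * (N ^+ 3 * (al ^+ 2 * (D2 * rho))).
  have -> : al ^+ 2 * ((4 * N) ^+ 3 * (d * W)) = 64 * (N ^+ 3 * (al ^+ 2 * (d * W))) by ring.
  apply: ler_wpM2l => //; apply: ler_wpM2l n3 _ _ _; apply: ler_wpM2l; first exact: sqr_ge0.
  exact: ler_pM.
apply: (@le_trans _ _ (2 * (10 * S * E * (1 + K)
   + (20 * (S * K) * E + rho * (20 * (S * K) * Q + 16 * (S * K) * (N ^+ 3 * Z0)))
   + 32 * (S * K) * (rho * Q) + F * rho + 64 * (N ^+ 3 * (al ^+ 2 * (D2 * rho)))))).
  apply: ler_wpM2l => //; apply: le_trans h _.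
  by apply: lerD t5; apply: lerD t4; apply: lerD t3; apply: lerD t1 (le_trans t2 t2').
by rewrite le_eqVlt; apply/orP; left; apply/eqP; ring.
Qed.

Section Stages.
Variables (R : realType) (T al K D2 : R) (f u du U dU : R -> pfield R 3).
Hypothesis T0 : 0 < T.
Hypothesis al0 : 0 <= al.
Hypothesis al1 : al <= 1.
Hypothesis cU : C1w T (fpow R 4) U dU.
Hypothesis cu : C1w T (fpow R 2) u du.
Hypothesis cu3 : C0w T (fpow R 3) u.
Hypothesis snaps : forall t, t \in `]0, T[ -> snapshot al (U t) (dU t) (u t) (du t) (f t).
Hypothesis U00 : forall t, t \in `[0, T] -> U t 0 = 0.
Hypothesis u00 : forall t, t \in `[0, T] -> u t 0 = 0.
Hypothesis uK : forall t, t \in `[0, T] -> wnorm (fpow R 3) (u t) <= K.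
Hypothesis duD : forall t, t \in `[0, T] -> wnorm (fpow R 2) (du t) <= D2.

Local Notation S := (sob R).
Local Notation L2w := (voigt_weight (@nz_weight R) al).

Let oo_cc t : t \in `]0, T[ -> t \in `[0, T].
Proof. by move=> h; apply: subset_itv_oo_cc. Qed.

Let zT : (0 : R) \in `[0, T]. Proof. by rewrite in_itv/= lexx ltW. Qed.

Let K0 : 0 <= K. Proof. by apply: le_trans (uK zT); exact: wnorm_ge0. Qed.
Let D0 : 0 <= D2. Proof. by apply: le_trans (duD zT); exact: wnorm_ge0. Qed.

Let z t := fsub (U t) (u t).

Lemma L2w_le k : `|L2w k| <= (1 + al) * `|fpow R 1 k|.
Proof.
have a1 : 0 <= 1 + al by rewrite addr_ge0.
rewrite /voigt_weight /nz_weight /fpow expr1; have [->|k0] := eqVneq k 0.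
  by rewrite mul0r normr0 mulr_ge0.
rewrite mul1r !ger0_norm ?sqrtr_ge0 ?freq_ge0//; apply: le_trans (voigt_factor_le k al0) _.
by rewrite mulrDl mul1r lerD2r; exact: freq_ge1.
Qed.

Lemma L2w_le_fpow s k : (0 < s)%N -> `|L2w k| <= (1 + al) * `|fpow R s k|.
Proof.
move=> s0; apply: le_trans (L2w_le k) _; rewrite ler_wpM2l ?addr_ge0//.
by rewrite !ger0_norm ?fpow_ge0// fpow_mono.
Qed.

(** Gronwall's lemma with the square of alpha^2 D2 as the forcing, so that the
    bound is of second order in alpha. *)
Lemma L2_stage t : t \in `[0, T] ->
  wnorm (@one_weight R) (z t) ^+ 2 <=
    expR ((2 * S * K + 1) * T) *
      (4 * wnorm (fpow R 3) (z 0) ^+ 2 + al ^+ 4 * D2 ^+ 2 * T).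
Proof.
move=> tT; have a1 : 0 <= 1 + al by rewrite addr_ge0.
pose dz t := fsub (dU t) (du t).
have cU2 : C1w T (fpow R 2) U dU.
  apply: C1w_weight ler01 _ cU => k.
  by rewrite mul1r !ger0_norm ?fpow_ge0// fpow_mono.
have cz2 : C1w T (fpow R 2) z dz by exact: C1w_sub.
have cz : C1w T L2w z dz by apply: C1w_weight a1 _ cz2 => k; exact: L2w_le_fpow.
have [z1 dz1 _] := cz.
have z00 s : s \in `[0, T] -> z s 0 = 0.
  by move=> sT; rewrite /z /fsub U00// u00// subrr.
have z3 s : s \in `[0, T] -> inw (fpow R 3) (z s).
  move=> sT; apply: (proj1 (inwB _ _)); last by case: cu3 => + _; apply.
  by apply: (proj1 (@inw_fpow _ _ 3 4 _ isT _)); case: cU => [[+ _] _ _]; apply.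
pose E s := wnorm L2w (z s) ^+ 2.
pose G s := 2 * wip L2w (dz s) (z s).
have lowE s : s \in `[0, T] -> wnorm (@one_weight R) (z s) ^+ 2 <= E s.
  move=> sT; have [_ le] := wnorm_voigt_ge (proj1 z1 s sT).
  rewrite ler_pXn2r ?nnegrE ?wnorm_ge0//; apply: le_trans le.
  rewrite -(@ler_pXn2r _ 2)// ?nnegrE ?wnorm_ge0// -!wipxx.
  rewrite (@wip_eq _ _ (@one_weight R) (@nz_weight R)) ?z00// => k k0.
  by rewrite /nz_weight k0.
have E0 : E 0 <= 4 * wnorm (fpow R 3) (z 0) ^+ 2.
  have -> : 4 * wnorm (fpow R 3) (z 0) ^+ 2 = (2 * wnorm (fpow R 3) (z 0)) ^+ 2 by ring.
  rewrite ler_pXn2r ?nnegrE ?mulr_ge0 ?wnorm_ge0//.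
  apply: le_trans (proj2 (inw_le a1 (fun k => @L2w_le_fpow 3 k isT) (z3 0 zT))) _.
  by apply: ler_wpM2r; [exact: wnorm_ge0|move: al1; lra].
have S0 := sob_ge0 R.
have C0 : 0 <= 2 * S * K + 1 by rewrite addr_ge0// !mulr_ge0.
have k0 : 0 <= al ^+ 4 * D2 ^+ 2 by rewrite mulr_ge0 ?exprn_ge0.
have e1 : 1 <= expR ((2 * S * K + 1) * T) by rewrite -[X in X <= _]expR0 ler_expR; exact: mulr_ge0 C0 (ltW T0).
apply: le_trans (lowE t tT) _.
apply: (@le_trans _ _ (expR ((2 * S * K + 1) * T) * (E 0 + al ^+ 4 * D2 ^+ 2 * T))); last first.
  by rewrite ler_wpM2l ?expR_ge0// lerD2r.
have [->|tn] := eqVneq t 0.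
  rewrite -[X in X <= _]mul1r; apply: ler_pM => //; first by rewrite sqr_ge0.
  by rewrite lerDl; exact: mulr_ge0 k0 (ltW T0).
have tT' : t \in `]0, T] by move: tT; rewrite !in_itv/= lt_neqAle eq_sym tn.
suff : ((E t)%:E <= (expR ((2 * S * K + 1) * T))%:E *
    ((E 0)%:E + (al ^+ 4 * D2 ^+ 2 * T)%:E))%E by rewrite -EFinD -EFinM lee_fin.
apply: le_trans (@gronwall_integral R T (2 * S * K + 1) (al ^+ 4 * D2 ^+ 2) 1 t E G (cst 0%E)
  C0 k0 ltr01 tT' _ _ _ _ _ _ _) _; last by rewrite integral0 mule0 adde0.
- have -> : E = fun s => wip L2w (z s) (z s) by apply/funext => s; rewrite wipxx.
  exact: wip_continuous.
- move=> s; apply: cvgM; [exact: cvg_cst|exact: (wip_continuous dz1 z1)].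
- by move=> s sT; exact: energy_derive cz sT.
- by move=> s; exact: sqr_ge0.
- by [].
- exact: integrable0.
move=> s st.
have sT : s \in `]0, T[.
  by move: st tT'; rewrite !in_itv/= => /andP[-> /lt_le_trans h /andP[_ /h]].
have sT' := oo_cc sT.
rewrite mule0 adde0 lee_fin.
have := L2_rate (snaps sT) (erefl (z s)).
rewrite -(@wip_eq _ _ L2w _ (dz s)) ?z00//; last first.
  by move=> k k0'; rewrite /voigt_weight /nz_weight k0'.
move=> /(le_trans (ler_norm _)) h; rewrite /G.
have l := lowE s sT'; have y0 := wnorm_ge0 (@one_weight R) (z s).
move: (wip _ _ _) (wnorm _ (z s)) h l y0 (uK sT') (duD sT') => g y h l y0 hK hD.
have n3 := wnorm_ge0 (fpow R 3) (u s); have n2 := wnorm_ge0 (fpow R 2) (du s).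
have h1 : S * wnorm (fpow R 3) (u s) * y ^+ 2 <= S * K * E s.
  by apply: ler_pM => //; [exact: mulr_ge0|exact: sqr_ge0|exact: ler_wpM2l].
have h2 : al ^+ 2 * (wnorm (fpow R 2) (du s) * y) <= al ^+ 2 * (D2 * y).
  by apply: ler_wpM2l; [exact: sqr_ge0|exact: ler_wpM2r].
have h3 : 2 * (al ^+ 2 * (D2 * y)) <= y ^+ 2 + al ^+ 4 * D2 ^+ 2.
  rewrite -subr_ge0.
  have -> : y ^+ 2 + al ^+ 4 * D2 ^+ 2 - 2 * (al ^+ 2 * (D2 * y)) = (y - al ^+ 2 * D2) ^+ 2 by ring.
  exact: sqr_ge0.
apply: (@le_trans _ _ (2 * (S * K * E s + al ^+ 2 * (D2 * y)))).
  by apply: ler_wpM2l => //; apply: le_trans h _; exact: lerD h1 h2.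
move: (E s) l => Es l.
have -> : (2 * S * K + 1) * Es + al ^+ 4 * D2 ^+ 2 =
    2 * (S * K * Es) + (Es + al ^+ 4 * D2 ^+ 2) by ring.
by rewrite mulrDr lerD2l; apply: le_trans h3 _; rewrite lerD2r.
Qed.

Variables (N rho Q Z0 : R).
Hypothesis N1 : 1 <= N.
Hypothesis rho0 : 0 < rho.
Hypothesis rho1 : rho <= 1.
Hypothesis uQ : forall t, t \in `[0, T] -> wnorm (fpow R 3) (fmul (tail N) (u t)) <= Q.
Hypothesis zZ : forall t, t \in `[0, T] -> wnorm (@one_weight R) (z t) <= Z0.
Let h (t : R) : \bar R := Hnorm 3%:R (fmul (tail N) (f t)).
Hypothesis ih : lebesgue_measure.-integrable `[0, T] h.

Let w t := fsub (U t) (fmul (cutoff N) (u t)).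
Local Notation H3w := (voigt_weight (fpow R 3) al).

Let N0 : 0 < N. Proof. exact: lt_le_trans ltr01 N1. Qed.
Let Q0 : 0 <= Q. Proof. by apply: le_trans (uQ zT); exact: wnorm_ge0. Qed.
Let Z00 : 0 <= Z0. Proof. by apply: le_trans (zZ zT); exact: wnorm_ge0. Qed.

Lemma H3w_le k : `|H3w k| <= (1 + al) * `|fpow R 4 k|.
Proof.
rewrite (ger0_norm (voigt_weight_ge0 _ (fpow_ge0 _ _ _))) (ger0_norm (fpow_ge0 _ _ _)).
rewrite /voigt_weight; have [->|k0] := eqVneq k 0.
  by rewrite /fpow freq0 !expr0n/= mul0r mulr0.
have -> : (1 + al) * fpow R 4 k = fpow R 3 k * ((1 + al) * freq R k).
  by rewrite /fpow; ring.
apply: ler_wpM2l; first exact: fpow_ge0.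
apply: le_trans (voigt_factor_le k al0) _.
by rewrite mulrDl mul1r lerD2r; exact: freq_ge1.
Qed.

Lemma H3w_cutoff_le k : `|H3w k * cutoff N k| <= (1 + al) * (4 * N) ^+ 2 * `|fpow R 2 k|.
Proof.
have p0 := cutoff_ge0 N k; have a1 : 0 <= 1 + al by rewrite addr_ge0.
rewrite normrM (ger0_norm p0) (ger0_norm (fpow_ge0 _ 2 _)).
apply: (@le_trans _ _ ((1 + al) * `|fpow R 4 k| * cutoff N k)).
  by apply: ler_wpM2r (H3w_le k).
rewrite (ger0_norm (fpow_ge0 _ _ _)) /fpow.
have -> : (1 + al) * freq R k ^+ 4 * cutoff N k =
   (1 + al) * (cutoff N k * freq R k ^+ 2) * freq R k ^+ 2 by ring.
apply: ler_wpM2r; first exact: sqr_ge0.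
apply: ler_wpM2l => //; have [hk|hk] := leP (4 * N) (freq R k).
  by rewrite (cutoff0 N0 hk) mul0r sqr_ge0.
apply: (@le_trans _ _ (freq R k ^+ 2)).
  by rewrite ler_piMl ?cutoff_le1// sqr_ge0.
by apply: lerXn2r (ltW hk); rewrite ?nnegrE ?freq_ge0// mulr_ge0// ltW.
Qed.

Let C := 20 * S * (1 + K) + 40 * S * K.
Let kappa := rho * (104 * S * K * Q + 32 * S * K * (N ^+ 3 * Z0)
  + 128 * (N ^+ 3 * (al ^+ 2 * D2))).

(** As long as the energy is below rho^2 its growth is controlled, and the
    control keeps it below rho^2; the truncated part of u adds at most Q. *)
Lemma H3_stage :
  expR (C * T) * (wnorm H3w (w 0) ^+ 2 + kappa * T
    + 2 * rho * fine (\int[lebesgue_measure]_(t in `[0%R, T]) h t)%E) < rho ^+ 2 ->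
  forall t, t \in `[0, T] -> wnorm (fpow R 3) (z t) <= rho + Q.
Proof.
move=> small; have a1 : 0 <= 1 + al by rewrite addr_ge0.
have S0 := sob_ge0 R.
pose dw t := fsub (dU t) (fmul (cutoff N) (du t)).
have cw : C1w T H3w w dw.
  apply: C1w_sub; first by apply: C1w_weight a1 _ cU; exact: H3w_le.
  apply: (C1w_fmul (C := (1 + al) * (4 * N) ^+ 2)) cu; last exact: H3w_cutoff_le.
  by rewrite mulr_ge0 ?sqr_ge0.
have [w1 dw1 _] := cw.
pose E s := wnorm H3w (w s) ^+ 2.
pose G s := 2 * wip H3w (dw s) (w s).
pose I := fine (\int[lebesgue_measure]_(t in `[0%R, T]) h t)%E.
have h0 s : (0 <= h s)%E by exact: sqrte_ge0.
have Ifin : (\int[lebesgue_measure]_(t in `[0%R, T]) h t)%E \is a fin_num.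
  by apply: integrable_fin_num.
have I0 : 0 <= I by apply: fine_ge0; exact: integral_ge0.
have C0 : 0 <= C by rewrite addr_ge0// !mulr_ge0// addr_ge0.
have k0 : 0 <= kappa.
  apply: mulr_ge0 (ltW rho0) _; have n3 : 0 <= N ^+ 3 by exact: exprn_ge0 (ltW N0).
  apply: addr_ge0; last by apply: mulr_ge0; [exact: ler0n|exact: mulr_ge0 n3 (mulr_ge0 (sqr_ge0 _) D0)].
  have c n : 0 <= n%:R * S * K := mulr_ge0 (mulr_ge0 (ler0n _ n) S0) K0.
  by apply: addr_ge0; [exact: mulr_ge0 (c 104%N) Q0|exact: mulr_ge0 (c 32%N) (mulr_ge0 n3 Z00)].
have e1 : 1 <= expR (C * T).
  by rewrite -[X in X <= _]expR0 ler_expR; exact: mulr_ge0 C0 (ltW T0).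
have lowE s : s \in `[0, T] -> wnorm (fpow R 3) (w s) ^+ 2 <= E s.
  move=> sT; have [_ le] := wnorm_voigt_ge (proj1 w1 s sT).
  by rewrite ler_pXn2r ?nnegrE ?wnorm_ge0.
have cE : {within `[0, T], continuous E}.
  have -> : E = fun s => wip H3w (w s) (w s) by apply/funext => s; rewrite wipxx.
  exact: wip_continuous.
have rest0 : 0 <= kappa * T + 2 * rho * I.
  by apply: addr_ge0; [exact: mulr_ge0 k0 (ltW T0)|apply: mulr_ge0 I0; apply: mulr_ge0 (ltW rho0)].
have E0 : E 0 < rho ^+ 2.
  apply: le_lt_trans small; rewrite -[X in X <= _]mul1r; apply: ler_pM => //; first exact: sqr_ge0.
  by rewrite -addrA lerDl.
have wz s : s \in `[0, T] -> 
    wnorm (fpow R 3) (z s) <= wnorm (fpow R 3) (w s) + Q /\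
    wnorm (fpow R 3) (U s) <= wnorm (fpow R 3) (w s) + K.
  move=> sT; have [w3 _] := wnorm_voigt_ge (proj1 w1 s sT).
  have u3 : inw (fpow R 3) (u s) by case: cu3 => + _; apply.
  have [q3 _] := inw_tail N u3.
  split.
    apply: le_trans (_ : _ <= wnorm (fpow R 3) (w s) + wnorm (fpow R 3) (fmul (tail N) (u s))) _.
      apply: (proj2 (inwD_gen _ w3 q3)) => k.
      have /andP[t1 t2] := onem_cutoff_tail N0 k.
      have -> : z s k = w s k - (1 - cutoff N k)%:C *: u s k.
        by rewrite /z /w /fsub /fmul rmorphB rmorph1 scalerBl scale1r opprB addrA subrK.
      apply: le_trans (magB _ _) _; rewrite lerD2l /fmul !magZ.
      by rewrite (ger0_norm t1) (ger0_norm (tail_ge0 _ _)) ler_wpM2r ?mag_ge0.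
    by rewrite lerD2l; exact: uQ.
  apply: le_trans (_ : _ <= wnorm (fpow R 3) (w s) + wnorm (fpow R 3) (u s)) _.
    apply: (proj2 (inwD_gen _ w3 u3)) => k.
    rewrite -{1}[U s k](subrK (fmul (cutoff N) (u s) k)).
    apply: le_trans (magD _ _) _; rewrite lerD2l /fmul magZ.
    by rewrite ger0_norm ?cutoff_ge0// ler_piMl ?mag_ge0 ?cutoff_le1.
  by rewrite lerD2l; exact: uK.
suff lt t : t \in `[0, T] -> E t < rho ^+ 2.
  move=> t tT; have [l _] := wz t tT; apply: le_trans l _; apply: lerD (lexx Q).
  apply: le_of_sqr (wnorm_ge0 _ _) (ltW rho0) _.
  exact: le_trans (lowE t tT) (ltW (lt t tT)).
move: t; apply: (barrier cE E0) => t tT' below.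
apply: le_lt_trans small; rewrite -/I.
suff : ((E t)%:E <= (expR (C * T))%:E *
    ((E 0)%:E + (kappa * T)%:E + (2 * rho)%:E * I%:E))%E.
  by rewrite -(EFinM (2 * rho) I) -!EFinD -EFinM lee_fin.
have c0 : 0 < 2 * rho by rewrite mulr_gt0.
rewrite /I (fineK Ifin).
apply: (@gronwall_integral R T C kappa (2 * rho) t E G h C0 k0 c0 tT' cE _ _ _ h0 ih).
- by move=> s; apply: cvgM; [exact: cvg_cst|exact: (wip_continuous dw1 w1)].
- by move=> s sT; exact: energy_derive cw sT.
- by move=> s; exact: sqr_ge0.
move=> s st.
have sT : s \in `]0, T[.
  by move: st tT'; rewrite !in_itv/= => /andP[-> /lt_le_trans hh /andP[_ /hh]].
have sT' := oo_cc sT.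
have Es : E s < rho ^+ 2.
  by apply: below; move: st; rewrite !in_itv/= => /andP[/ltW -> ->].
have [hy|/negP hy] := boolP ((h s < +oo)%E); last first.
  have -> : h s = +oo%E by move: hy; rewrite ltey => /negP; rewrite negbK => /eqP.
  by rewrite gt0_muley ?lte_fin// addey// leey.
have f3 : inw (fpow R 3) (fmul (tail N) (f s)) by exact: Hnorm_inw hy.
rewrite /h (inw_Hnorm f3) -EFinM -EFinD lee_fin.
have := H3_rate (snaps sT) (erefl (z s)) N1 (erefl (w s)) (erefl _) f3.
move=> /(le_trans (ler_norm _)); rewrite /G -/(dw s).
have [lz lU] := wz s sT'; have lw := lowE s sT'.
apply: bootstrap_rate S0 K0 Q0 Z00 (ltW N0) D0 _ _ _ _ _ _ _ _ rho0 rho1 lw Es lz lU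
  (uK sT') (duD sT') (uQ sT') (zZ sT'); exact: wnorm_ge0.
Qed.

End Stages.

(** * Choice of the parameters *)

Lemma Hdiv_fin R (s : R) (v : pfield R 3) : Hdiv s v -> (Hnorm s v < +oo)%E.
Proof. by case=> -[]. Qed.

Lemma Hdot_fin R m (s : R) (v : pfield R m) :
  Hdot m s v -> (Hnorm s v < +oo)%E.
Proof. by case. Qed.

Lemma voigt_snapshots R (al T : R) (f u du U : R -> pfield R 3)
    (p P : R -> pfield R 1) (u0 U0 : pfield R 3) :
  (forall t, t \in `[0, T] -> Hdot 3 2 (f t)) ->
  euler_solution T f u p u0 -> C1w T (fpow R 2) u du ->
  (forall t, t \in `[0, T] -> Hdiv 2 (du t)) ->
  euler_voigt_solution al T f U P U0 ->
  exists2 dU, C1w T (fpow R 4) U dU &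
    forall t, t \in `]0, T[ -> snapshot al (U t) (dU t) (u t) (du t) (f t).
Proof.
move=> hf eu cu hdu vo.
have [[[hU _] _] _ _ _] := vo; have [[hu _] _ _ _ _] := eu.
have [c1U _ _ _] := vo.
have [dU cU hdU] := @C1path_C1w R 3 3 T (Hdiv 4) U (@Hdiv_fin R 4) c1U.
exists dU => // t tT; have tT' : t \in `[0, T] by apply: subset_itv_oo_cc.
have [U00 rU iU dvU] := @HdivE R 3 _ (hU t tT').
have [u00 ru iu dvu] := @HdivE R 2 _ (hu t tT').
have [_ _ idu _] := @HdivE R 1 _ (hdu t tT').
split => //.
- exact: (voigt_fourier hf vo cU hdU tT).
- exact: (euler_fourier hf eu cu hdu tT).
Qed.

(** The initial value in H^4 enters the energy with a factor alpha only. *)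
Lemma wnorm_voigt_le R (al : R) (w : pfield R 3) : 0 <= al ->
  inw (fpow R 4) w ->
  wnorm (voigt_weight (fpow R 3) al) w <= wnorm (fpow R 3) w + al * wnorm (fpow R 4) w.
Proof.
move=> al0 i4; have [i3 _] := @inw_fpow R 3 3 4 w isT i4.
have [ia na] := l2Z al i4; have [i le] := l2norm_triangle i3 ia.
rewrite na (ger0_norm al0) in le; apply: le_trans le.
apply: (proj2 (l2_le _ i)) => k.
rewrite /wseq mulrA -mulrDl normrM [leRHS]normrM; apply: ler_wpM2r => //.
rewrite (ger0_norm (voigt_weight_ge0 al (fpow_ge0 R 3 k))).
apply: le_trans (ler_norm _); rewrite /voigt_weight.
have -> : fpow R 3 k + al * fpow R 4 k = fpow R 3 k * (1 + al * freq R k).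
  by rewrite /fpow; ring.
by apply: ler_wpM2l; [exact: fpow_ge0|exact: voigt_factor_le].
Qed.

Lemma budget_ge0 R (T S K : R) : 0 <= T -> 0 <= S -> 0 <= K ->
  0 <= 11 + T * (136 * S * K + 128).
Proof.
move=> T0 S0 K0; apply: addr_ge0; first exact: ler0n.
apply: mulr_ge0 T0 _; apply: addr_ge0; last exact: ler0n.
by apply: mulr_ge0 K0; apply: mulr_ge0 S0; exact: ler0n.
Qed.

(** The size x of all the data is proportional to rho, and every term on the
    left has a factor rho, since e0^2 <= 9 x^2 <= 9 rho x. *)
Lemma small_budget R (M T S K rho x e0 Q NZ ND I : R) :
  1 <= M -> 0 < T -> 0 <= S -> 0 <= K -> 0 < rho ->
  x = rho / (M * (11 + T * (136 * S * K + 128)) + 1) ->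
  0 <= e0 -> e0 <= 3 * x -> Q <= x -> NZ <= x -> ND <= x -> I <= x ->
  M * (e0 ^+ 2 + rho * (104 * S * K * Q + 32 * S * K * NZ + 128 * ND) * T + 2 * rho * I)
    < rho ^+ 2.
Proof.
move=> M1 T0 S0 K0 r0 xE e00 he hQ hZ hD hI.
have M0 : 0 <= M by exact: le_trans ler01 M1.
pose A := 11 + T * (136 * S * K + 128).
have SK0 : 0 <= S * K by exact: mulr_ge0.
have A0 : 0 <= A by exact: budget_ge0 (ltW T0) S0 K0.
have B0 : 0 < M * A + 1 by exact: ltr_wpDl (mulr_ge0 M0 A0) ltr01.
have x0 : 0 < x by rewrite xE; exact: divr_gt0 r0 B0.
have xr : x * (M * A + 1) = rho by rewrite xE divfK// (gt_eqF B0).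
have xler : x <= rho.
  by rewrite -xr ler_peMr ?(ltW x0)// lerDr mulr_ge0.
have hsq : e0 ^+ 2 <= 9 * (rho * x).
  apply: (@le_trans _ _ (3 * x * (3 * x))).
    by rewrite expr2; apply: ler_pM.
  have -> : 3 * x * (3 * x) = 9 * (x * x) by ring.
  by apply: ler_wpM2l => //; apply: ler_wpM2r => //; exact: ltW.
have hk : 104 * S * K * Q + 32 * S * K * NZ + 128 * ND <= (136 * S * K + 128) * x.
  have -> : (136 * S * K + 128) * x = 104 * S * K * x + 32 * S * K * x + 128 * x by ring.
  apply: lerD; last exact: ler_wpM2l.
  by apply: lerD; apply: ler_wpM2l => //; rewrite -mulrA mulr_ge0.
apply: (@le_lt_trans _ _ (M * (9 * (rho * x) + rho * ((136 * S * K + 128) * x) * T + 2 * rho * x))).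
  apply: ler_wpM2l => //; apply: lerD; last by apply: ler_wpM2l => //; apply: mulr_ge0 (ltW r0).
  apply: lerD => //; apply: ler_wpM2r; first exact: ltW.
  by apply: ler_wpM2l hk; exact: ltW.
have -> : M * (9 * (rho * x) + rho * ((136 * S * K + 128) * x) * T + 2 * rho * x) =
  rho * (x * (M * A)) by rewrite /A; ring.
by rewrite expr2 ltr_pM2l// -xr ltr_pM2l// ltrDl.
Qed.

(** Half of the budget y^2 goes to the initial distance and half to alpha. *)
Lemma small_L2 R (L T D y delta al z : R) :
  1 <= L -> 0 < T -> 0 <= D -> 0 < y -> y <= 1 -> 0 <= delta -> 0 <= z ->
  delta <= y / (8 * L) -> 0 <= al -> al <= 1 -> al <= y / (2 * (D ^+ 2 * T * L + 1)) ->
  z ^+ 2 <= L * (4 * delta ^+ 2 + al ^+ 4 * D ^+ 2 * T) -> z <= y.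
Proof.
move=> L1 T0 D0 y0 y1 d0 z0 hd a0 a1 ha hz.
have L0 : 0 < L by exact: lt_le_trans ltr01 L1.
apply: le_of_sqr z0 (ltW y0) _; apply: le_trans hz _.
have hd' : 8 * L * delta <= y by move: hd; rewrite ler_pdivlMr ?mulr_gt0// mulrC.
have E0 : 0 < D ^+ 2 * T * L + 1.
  by rewrite ltr_wpDl// !mulr_ge0 ?sqr_ge0// ltW.
have ha' : 2 * ((D ^+ 2 * T * L + 1) * al) <= y.
  by move: ha; rewrite ler_pdivlMr ?mulr_gt0// mulrC mulrA.
have p1 : 0 <= 8 * L * delta by rewrite !mulr_ge0// ltW.
have s1 : L * (4 * delta ^+ 2) <= y ^+ 2 / 2.
  have q : (8 * L * delta) ^+ 2 <= y ^+ 2 by rewrite lerXn2r// ?nnegrE// ltW.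
  have r : L * delta ^+ 2 * 1 <= L * delta ^+ 2 * L.
    by apply: ler_wpM2l L1; rewrite mulr_ge0 ?sqr_ge0// ltW.
  have : (8 * L * delta) ^+ 2 = 64 * (L * delta ^+ 2 * L) by ring.
  move: q r (sqr_ge0 y); lra.
have s2 : L * (al ^+ 4 * D ^+ 2 * T) <= y ^+ 2 / 2.
  have p2 : 0 <= D ^+ 2 * T * L by rewrite !mulr_ge0 ?sqr_ge0// ltW.
  have q1 : D ^+ 2 * T * L * al <= y / 2 by move: ha' a0; lra.
  have q2 : al ^+ 3 <= y.
    apply: (@le_trans _ _ al).
      by rewrite -[X in _ <= X]expr1; exact: ler_wiXn2l.
    have : 0 <= D ^+ 2 * T * L * al by rewrite mulr_ge0.
    by move: ha' a0; lra.
  have -> : L * (al ^+ 4 * D ^+ 2 * T) = D ^+ 2 * T * L * al * al ^+ 3 by ring.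
  have -> : y ^+ 2 / 2 = y / 2 * y by ring.
  by apply: ler_pM => //; [exact: mulr_ge0|exact: exprn_ge0].
by rewrite mulrDr; lra.
Qed.

(** The order of the quantifiers is the point: the admissible distance of the
    initial values is chosen before v0, the range of alpha after it. *)
Lemma close_solutions R (T : R) (f u : R -> pfield R 3)
    (p : R -> pfield R 1) (u0 : pfield R 3) :
  0 < T -> admissible_force T f -> euler_solution T f u p u0 ->
  forall eps : R, 0 < eps -> exists2 delta : R, 0 < delta &
  forall v0 : pfield R 3, Hdiv 4 v0 -> wnorm (fpow R 3) (fsub v0 u0) <= delta ->
  exists2 a0 : R, 0 < a0 &
  forall (a : R) (U : R -> pfield R 3) (P : R -> pfield R 1),
    0 < a -> a <= a0 -> euler_voigt_solution a T f U P v0 ->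
  forall t, t \in `[0, T] -> inw (fpow R 3) (fsub (U t) (u t)) /\
    wnorm (fpow R 3) (fsub (U t) (u t)) <= eps.
Proof.
move=> T0 [cf fint] eu eps eps0.
have hf : forall t, t \in `[0, T] -> Hdot 3 2 (f t) := cf.1.
have cfw : C0w T (fpow R 2) f := @C0path_C0w R 3 1 T _ f (@Hdot_fin R 3 2) cf.
have f0 t : t \in `[0, T] -> f t 0 = 0 by move=> /hf[].
have [c3 c2 _ u0E _] := eu.
have cu3 : C0w T (fpow R 3) u := @C0path_C0w R 3 2 T _ u (@Hdiv_fin R 3) c3.
have [du cu hdu] := @C1path_C1w R 3 1 T _ u (@Hdiv_fin R 2) c2.
have [_ cdu _] := cu.
have u00 t : t \in `[0, T] -> u t 0 = 0 by move=> /(c3.1)[[]].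
have [K K0 uK] := C0w_bounded T0 cu3; have [D D0 duD] := C0w_bounded T0 cdu.
have zT : (0 : R) \in `[0, T] by rewrite in_itv/= lexx ltW.
have S0 := sob_ge0 R.
pose C := 20 * sob R * (1 + K) + 40 * sob R * K.
pose M := expR (C * T).
have C0 : 0 <= C by rewrite addr_ge0// !mulr_ge0// addr_ge0.
have M1 : 1 <= M.
  by rewrite /M -[X in X <= _]expR0 ler_expR; exact: mulr_ge0 C0 (ltW T0).
pose rho := Num.min 1 (eps / 2).
have rho0 : 0 < rho by rewrite lt_min ltr01 divr_gt0.
have rho1 : rho <= 1 by rewrite ge_min lexx.
have rhoe : rho <= eps / 2 by rewrite ge_min lexx orbT.
pose B := M * (11 + T * (136 * sob R * K + 128)) + 1.
have B1 : 1 <= B.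
  rewrite lerDr; apply: mulr_ge0 (le_trans ler01 M1) _.
  exact: budget_ge0 (ltW T0) S0 K0.
have B0 : 0 < B by exact: lt_le_trans ltr01 B1.
(* The common size of all the small data, as required by [small_budget]. *)
pose x := rho / B; have x0 : 0 < x by rewrite divr_gt0.
have xrho : x <= rho by rewrite ler_pdivrMr// ler_peMr// ltW.
have [ih cvI] := force_tail f0 cfw fint.
have nearI : \forall n \near \oo,
    fine (\int[lebesgue_measure]_(t in `[0%R, T]) Hnorm 3%:R (fmul (tail (n%:R : R)) (f t)))%E <= x.
  by apply: (cvgr_le _ (fine_cvg cvI)).
have [n [n1 [nQ nI]]] := filter_ex (filterI (nbhs_infty_ge 1) (filterI (uniform_tail x0 cu3) nearI)).
pose N : R := n%:R.
have N1 : 1 <= N by rewrite /N ler1n.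
have N0 : 0 < N by exact: lt_le_trans ltr01 N1.
have N3 : 1 <= N ^+ 3 by exact: exprn_ege1.
have N30 : 0 < N ^+ 3 by exact: exprn_gt0.
pose L := expR ((2 * sob R * K + 1) * T).
have L1 : 1 <= L.
  rewrite /L -[X in X <= _]expR0 ler_expR; apply: mulr_ge0 (ltW T0).
  by rewrite addr_ge0// !mulr_ge0.
have L0 : 0 < L by exact: lt_le_trans ltr01 L1.
(* The tolerance for z in L^2, which is multiplied by N^3 in the estimate. *)
pose y := x / N ^+ 3; have y0 : 0 < y by rewrite divr_gt0.
have yx : N ^+ 3 * y = x by rewrite /y mulrC -mulrA mulVf ?mulr1// gt_eqF.
have y1 : y <= 1.
  by rewrite ler_pdivrMr// mul1r; apply: le_trans xrho (le_trans rho1 N3).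
exists (Num.min x (y / (8 * L))); first by rewrite lt_min x0/= divr_gt0// mulr_gt0.
move=> v0 hv0; rewrite le_min => /andP[dx dy].
pose w0 := fsub v0 (fmul (cutoff N) u0).
pose B4 := wnorm (fpow R 4) w0; have B40 : 0 <= B4 by exact: wnorm_ge0.
have E0 : 0 < D ^+ 2 * T * L + 1 by rewrite ltr_wpDl// !mulr_ge0 ?sqr_ge0// ltW.
exists (Num.min (Num.min 1 (y / (2 * (D ^+ 2 * T * L + 1)))) (Num.min (y / (D + 1)) (x / (B4 + 1)))).
  by rewrite !lt_min ltr01 !divr_gt0// ?mulr_gt0// ltr_wpDl.
move=> a U P apos; rewrite !le_min => /andP[/andP[a1 ay] /andP[aD aB]] vo t tT.
have a0 := ltW apos.
have [dU cU snaps] := voigt_snapshots hf eu cu hdu vo.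
have [[[hU _] _] _ U0E _] := vo.
have U00 s : s \in `[0, T] -> U s 0 = 0 by move=> /hU[[]].
have U3 s : s \in `[0, T] -> inw (fpow R 3) (U s).
  by move=> sT; apply: (proj1 (@inw_fpow R 3 3 4 _ isT _)); have [_ _ ? _] := @HdivE R 3 _ (hU s sT).
have u3 s : s \in `[0, T] -> inw (fpow R 3) (u s) by case: cu3 => + _; apply.
split; first exact: (proj1 (inwB (U3 t tT) (u3 t tT))).
have zZ s : s \in `[0, T] -> wnorm (@one_weight R) (fsub (U s) (u s)) <= y.
  move=> sT; have h := L2_stage T0 a0 a1 cU cu cu3 snaps U00 u00 uK duD sT.
  apply: (small_L2 L1 T0 D0 y0 y1 _ _ dy a0 a1 ay); [exact: wnorm_ge0..|].
  by rewrite -{1}U0E -{1}u0E; exact: h.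
have u03 : inw (fpow R 3) u0 by rewrite -u0E; exact: u3.
have v04 : inw (fpow R 4) v0 by have [_ _ ? _] := @HdivE R 3 _ hv0.
have w04 : inw (fpow R 4) w0 := proj1 (inwB v04 (inw_cutoff N0 u03)).
have e0 : wnorm (voigt_weight (fpow R 3) a) w0 <= 3 * x.
  apply: le_trans (wnorm_voigt_le a0 w04) _.
  have [q3 _] := inw_tail N u03.
  have z3 : inw (fpow R 3) (fsub v0 u0).
    by apply: (proj1 (inwB _ u03)); exact: (proj1 (@inw_fpow R 3 3 4 _ isT v04)).
  have t1 : wnorm (fpow R 3) w0 <= wnorm (fpow R 3) (fsub v0 u0) + wnorm (fpow R 3) (fmul (tail N) u0).
    apply: (proj2 (inwD_gen _ z3 q3)) => k.
    have /andP[h1 h2] := onem_cutoff_tail N0 k.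
    have -> : w0 k = fsub v0 u0 k + (1 - cutoff N k)%:C *: u0 k.
      by rewrite /w0 /fsub /fmul rmorphB rmorph1 scalerBl scale1r addrA subrK.
    apply: le_trans (magD _ _) _; rewrite lerD2l /fmul !magZ.
    by rewrite (ger0_norm h1) (ger0_norm (tail_ge0 _ _)) ler_wpM2r ?mag_ge0.
  have t2 : wnorm (fpow R 3) (fmul (tail N) u0) <= x by rewrite -u0E; exact: nQ.
  have t3 : a * B4 <= x.
    have B41 : 0 < B4 + 1 by rewrite ltr_wpDl.
    move: aB; rewrite ler_pdivlMr// => aB.
    by apply: le_trans aB; rewrite ler_wpM2l// lerDl.
  have -> : 3 * x = x + x + x by ring.
  by apply: lerD t3; apply: le_trans t1 _; exact: lerD dx t2.
have ND : N ^+ 3 * (a ^+ 2 * D) <= x.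
  rewrite -yx ler_pM2l//.
  have D10 : 0 < D + 1 by rewrite ltr_wpDl.
  move: aD; rewrite ler_pdivlMr// => aD.
  have s1 : a ^+ 2 * D <= a * D.
    by rewrite ler_wpM2r// -[X in _ <= X]expr1; exact: ler_wiXn2l.
  apply: le_trans s1 _; apply: le_trans aD.
  by rewrite ler_wpM2l// lerDl.
have yx' : N ^+ 3 * y <= x by rewrite yx.
have small := small_budget M1 T0 S0 K0 rho0 (erefl : x = rho / B) (wnorm_ge0 _ _) e0
  (lexx x) yx' ND nI.
have hh : forall s, s \in `[0, T] -> wnorm (fpow R 3) (fsub (U s) (u s)) <= rho + x.
  move=> s sT; apply: (H3_stage T0 a0 cU cu cu3 snaps uK duD N1 rho0 rho1 nQ zZ (ih n) _ sT).
  by rewrite U0E u0E; exact: small.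
by apply: le_trans (hh t tT) _; move: xrho rhoe; lra.
Qed.

(** * Diagonal choice of the regularisation parameter *)

(** At the n-th step the finitely many tolerances m <= n that can be met are
    met together; each of them is met from some step on. *)
Lemma diagonal_choice R (Q : nat -> nat -> R -> Prop) :
  (forall m, \forall n \near \oo, exists2 a0 : R, 0 < a0 &
     forall a, 0 < a -> a <= a0 -> Q m n a) ->
  exists a_ : nat -> R, [/\ (forall n, 0 < a_ n), a_ n @[n --> \oo] --> 0 &
    forall m, \forall n \near \oo, Q m n (a_ n)].
Proof.
move=> h; pose good m n := exists2 a0 : R, 0 < a0 & forall a, 0 < a -> a <= a0 -> Q m n a.
have step n k : exists2 c : R, 0 < c & c <= n.+1%:R^-1 /\
    forall a, 0 < a -> a <= c -> forall m, (m < k)%N -> good m n -> Q m n a.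
  elim: k => [|k [c c0 [cn hc]]].
    by exists n.+1%:R^-1; [rewrite invr_gt0|split].
  have [[d d0 hd]|nd] := pselect (good k n).
    exists (Num.min c d); first by rewrite lt_min c0 d0.
    split; first by rewrite ge_min cn.
    move=> a a0; rewrite le_min => /andP[ac ad] m; rewrite ltnS leq_eqVlt => /orP[/eqP -> _|mk].
      exact: hd.
    exact: hc.
  exists c => //; split => // a a0 ac m; rewrite ltnS leq_eqVlt => /orP[/eqP -> //|mk].
  exact: hc.
have hex n : exists a : R, 0 < a /\ (a <= n.+1%:R^-1 /\
    forall m, (m <= n)%N -> good m n -> Q m n a).
  have [c c0 [cn hc]] := step n n.+1.
  by exists c; split => //; split => // m mn; exact: hc.
have [a_ ha] := boolp.choice hex.
exists a_; split; first by move=> n; have [] := ha n.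
  apply: (@squeeze_cvgr _ _ _ _ (fun=> 0) (fun n => n.+1%:R^-1)).
  - by near=> n; have [h1 [h2 _]] := ha n; rewrite ltW.
  - exact: cvg_cst.
  - exact: cvg_harmonic.
move=> m; near=> n; have [_ [_ hn]] := ha n; apply: hn.
  by near: n; exact: nbhs_infty_ge.
by near: n; exact: h.
Unshelve. all: by end_near. Qed.

Local Close Scope complex_scope.

Theorem theorem3p3 (R : realType) (T : R) (T_gt0 : 0 < T)
    (f : R -> pfield R 3) (f_force : admissible_force T f)
    (u0 : pfield R 3) (u0_H3 : Hdiv 3 u0)
    (u : R -> pfield R 3) (p : R -> pfield R 1)
    (u_sol : euler_solution T f u p u0)
    (u0b : R -> pfield R 3)
    (u0b_H4 : forall b, 0 < b -> Hdiv 4 (u0b b))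
    (u0b_cvg : Hnorm 3 (fsub (u0b b) u0) @[b --> 0^'+] --> 0%E)
    (uab : R -> R -> R -> pfield R 3) (pab : R -> R -> R -> pfield R 1)
    (uab_sol : forall a b, 0 < a -> 0 < b ->
       euler_voigt_solution a T f (uab a b) (pab a b) (u0b b)) :
  forall b_ : nat -> R, (forall n, 0 < b_ n) -> b_ n @[n --> \oo] --> 0 ->
  exists a_ : nat -> R,
    [/\ (forall n, 0 < a_ n),
        a_ n @[n --> \oo] --> 0 &
        ereal_sup [set Hnorm 3 (fsub (uab (a_ n) (b_ n) t) (u t))
                  | t in `]0, T[ ] @[n --> \oo] --> 0%E].
Proof.
move=> b_ b0 bc.
have cb : b_ n @[n --> \oo] --> 0^'+.
  move=> A hA; have hA' : nbhs (0 : R) [set r : R | 0 < r -> A r] := hA.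
  have hb : \forall n \near \oo, 0 < b_ n -> A (b_ n) := bc _ hA'.
  suff : \forall n \near \oo, A (b_ n) by [].
  by apply: filterS hb => n; apply.
have ic n : inw (fpow R 3) (fsub (u0b (b_ n)) u0).
  have [_ _ i0 _] := @HdivE R 2 _ u0_H3; have [_ _ i4 _] := @HdivE R 3 _ (u0b_H4 _ (b0 n)).
  apply: (proj1 (inwB _ i0)); exact: (proj1 (@inw_fpow R 3 3 4 _ isT i4)).
have dc : wnorm (fpow R 3) (fsub (u0b (b_ n)) u0) @[n --> \oo] --> 0.
  apply: cvg_trans (fine_cvg (cvg_comp _ _ cb u0b_cvg)); apply: near_eq_cvg; near=> n.
  by rewrite /= (@inw_Hnorm R 3 2).
pose Q (m n : nat) (a : R) := forall t, t \in `[0, T] ->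
  inw (fpow R 3) (fsub (uab a (b_ n) t) (u t)) /\
  wnorm (fpow R 3) (fsub (uab a (b_ n) t) (u t)) <= m.+1%:R^-1.
have [m|a_ [a0 ac hQ]] := @diagonal_choice R Q.
  have e0 : (0 : R) < m.+1%:R^-1 by rewrite invr_gt0.
  have [d d0 hd] := close_solutions T_gt0 f_force u_sol e0.
  near=> n.
  have [|c c0 hc] := hd _ (u0b_H4 _ (b0 n)).
    by near: n; exact: (cvgr_le _ dc).
  exists c => // a a0 ac t tT.
  exact: (hc a (uab a (b_ n)) (pab a (b_ n)) a0 ac (uab_sol _ _ a0 (b0 n)) t tT).
exists a_; split => //.
pose F n := ereal_sup [set Hnorm 3 (fsub (uab (a_ n) (b_ n) t) (u t)) | t in `]0, T[ ].
have F0 n : (0 <= F n)%E.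
  have hT : T / 2 \in `]0, T[ by rewrite in_itv/= divr_gt0//= ltr_pdivrMr// ltr_pMr// ltr1n.
  apply: le_ereal_sup_tmp; exists (Hnorm 3 (fsub (uab (a_ n) (b_ n) (T / 2)) (u (T / 2)))).
    by exists (T / 2).
  exact: sqrte_ge0.
have Fle m : \forall n \near \oo, (F n <= m.+1%:R^-1%:E)%E.
  have := hQ m; apply: filterS => n hn.
  apply: ge_ereal_sup => _ [t tT <-].
  have [i le] := hn t (subset_itv_oo_cc tT).
  by rewrite (@inw_Hnorm R 3 2)// lee_fin.
apply/fine_cvgP; split.
  have := Fle 0%N; apply: filterS => n hn.
  by rewrite (ge0_fin_numE (F0 n)); apply: le_lt_trans hn _; rewrite ltry.
apply/cvgrPdist_le => e e0.
have [m me] : exists m, m.+1%:R^-1 <= e.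
  have [m hm] := filter_ex (cvgr_le _ (@cvg_harmonic R) _ e0).
  by exists m; exact: hm.
have := Fle m; apply: filterS => n hn.
have fin : F n \is a fin_num by rewrite (ge0_fin_numE (F0 n)); apply: le_lt_trans hn _; rewrite ltry.
rewrite sub0r normrN (ger0_norm (fine_ge0 (F0 n))).
by apply: le_trans me; rewrite -lee_fin (fineK fin).
Unshelve. all: by end_near. Qed.
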